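(* Let $\nu>0$. Let $(F_n)_{n\ge1}=\big(\sum_{i\ge1}c_{i,n}(N_i^2-1)\big)_{n\ge1}$ be a sequence of elements of the second Wiener chaos, with $|c_{1,n}|\ge|c_{2,n}|\ge\ldots$ (and $c_{i,n}\ge c_{i+1,n}$ whenever $|c_{i,n}|=|c_{i+1,n}|$) and $\mathbb{E}[F_n^2]=2\sum_{i\ge1}c_{i,n}^2=2\nu$ for all $n\ge1$. Assume in addition that $\operatorname{Var}(\Gamma_1(F_n)-2F_n)\to0$ as $n\to\infty$. Then $F_n$ converges in distribution to $G(\nu)\sim CenteredGamma(\nu)$. Furthermore, if $\vartheta(n)\approx_C\omega(n)$, where $$\omega(n)=\max\{|1-c_{i,n}|: i\in\{1,\ldots,\nu\}\},\qquad \vartheta(n)=\sum_{i\ge\nu+1}c_{i,n}^2,$$ then there exist two constants $0<C_1<C_2$ (possibly depending on the sequence $(F_n)$, but independent of $n$) such that for all $n\ge1$, $$C_1\,\mathbf{M}(F_n)\le d_2(F_n,G(\nu))\le C_2\,\mathbf{M}(F_n),$$ where $\mathbf{M}(F_n)=\max\{|\kappa_3(F_n)-\kappa_3(G(\nu))|,\,|\kappa_4(F_n)-\kappa_4(G(\nu))|\}$.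
   Context: The $N_i$ are i.i.d. $\mathscr{N}(0,1)$ random variables, and every element $I_2(f)$ of the second Wiener chaos of an isonormal Gaussian process over a real separable Hilbert space $\mathfrak{H}$ has a representation $\sum_i c_i(N_i^2-1)$, where the $c_i$ are the eigenvalues of the Hilbert–Schmidt operator $g\mapsto f\otimes_1 g$. Gamma operators: $\Gamma_0(F)=F$, $\Gamma_{i+1}(F)=\langle D\Gamma_i(F),-DL^{-1}F\rangle_{\mathfrak{H}}$, where $D$ is the Malliavin derivative and $L^{-1}$ the pseudo-inverse of the Ornstein–Uhlenbeck generator ($L^{-1}F=-\sum_{p\ge1}\frac1pI_p(f_p)$ for $F=\sum_p I_p(f_p)$). $CenteredGamma(\nu)$ is the law of $2\widehat{G}(\nu/2)-\nu$, with $\widehat{G}(\nu/2)$ having density $x^{\nu/2-1}e^{-x}\Gamma(\nu/2)^{-1}\mathbf{1}_{(0,\infty)}(x)$. $\kappa_n$ denotes the $n$-th cumulant. $d_2(X,Y)=\sup_{h\in\mathcal{H}_2}|\mathbb{E}[h(X)]-\mathbb{E}[h(Y)]|$, where $\mathcal{H}_2=\{h\in C^1(\mathbb{R}):h'\text{ Lipschitz},\ \|h'\|_\infty\le1,\ \|h''\|_\infty\le1\}$. For non-negative sequences, $a_n\approx_C b_n$ means $\lim_{n\to\infty}a_n/b_n=C$ for some constant $C>0$. Convergence in distribution of such a sequence to $G(\nu)$ forces $\nu$ to be an integer, so $\omega(n)$ and $\vartheta(n)$ make sense. *)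

(* Defs.v *)
From HB Require Import structures.
From mathcomp Require Import all_boot all_order all_algebra.
From mathcomp Require Import all_classical all_reals all_analysis.

Set Implicit Arguments.
Unset Strict Implicit.
Unset Printing Implicit Defensive.

Import Order.TTheory GRing.Theory Num.Theory.
Import numFieldNormedType.Exports.

Local Open Scope classical_set_scope.
Local Open Scope ring_scope.

(** ** Hilbert spaces *)

(* Completeness comes with [completeNormedModType]; the norm of the type is
   required to be the one induced by [ip]. *)
Definition inner_product (R : realType) (H : normedModType R)
    (ip : H -> H -> R) : Prop :=
  [/\ forall x y, ip x y = ip y x,
      forall a x y z, ip (a *: x + y) z = a * ip x z + ip y z &
      forall x, ip x x = `|x| ^+ 2].

Definition separable (T : topologicalType) : Prop :=
  exists A : set T, countable A /\ dense A.

(** ** Isonormal Gaussian processes *)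

Definition L2_cvg d (Om : measurableType d) (R : realType)
    (P : probability Om R) (Y : nat -> Om -> R) (Z : Om -> R) : Prop :=
  ('E_P[fun w => ((Y k w - Z w) ^+ 2)%R])%E @[k --> \oo] --> 0%E.

(* [normal_prob 0 0] is a junk value in the library, hence the case split:
   the Gaussian law with variance 0 is the Dirac mass. *)
Definition centered_gaussian d (Om : measurableType d) (R : realType)
    (P : probability Om R) (Z : Om -> R) : Prop :=
  exists s : R, 0 <= s /\
    forall A : set R, measurable A ->
      P (Z @^-1` A) = (if s == 0 then \d_(0 : R) A else normal_prob 0 s A).

Definition isonormal d (Om : measurableType d) (R : realType)
    (P : probability Om R) (H : normedModType R) (ip : H -> H -> R)
    (X : H -> {RV P >-> R}) : Prop :=
  (forall (m : nat) (a : 'I_m -> R) (h : 'I_m -> H),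
     centered_gaussian P (fun w => \sum_(i < m) a i * X (h i) w)) /\
  (forall g h : H, ('E_P[fun w => (X g w * X h w)%R] = (ip g h)%:E)%E).

(** ** Malliavin derivative *)

Definition partial_derive (R : realType) (m : nat) (i : 'I_m)
    (f : 'rV[R]_m -> R) : 'rV[R]_m -> R :=
  fun x => 'D_(delta_mx 0 i) f x.

(* C^oo functions all of whose partial derivatives have polynomial growth *)
Definition smooth_poly_growth (R : realType) (m : nat)
    (f : 'rV[R]_m -> R) : Prop :=
  forall s : seq 'I_m,
    let g := foldr (@partial_derive R m) f s in
    (forall x, differentiable g x) /\
    exists (C : R) (k : nat), forall x, `|g x| <= C * (1 + `|x|) ^+ k.

Definition gauss_vec d (Om : measurableType d) (R : realType)
    (P : probability Om R) (H : normedModType R) (X : H -> {RV P >-> R})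
    (m : nat) (h : 'I_m -> H) (w : Om) : 'rV[R]_m :=
  \row_(j < m) X (h j) w.

(* The functional f(X(h_1), ..., X(h_m)) and its derivative
   sum_i d_i f(X(h_1), ..., X(h_m)) h_i *)
Definition smooth_functional d (Om : measurableType d) (R : realType)
    (P : probability Om R) (H : normedModType R) (X : H -> {RV P >-> R})
    (F : Om -> R) (DF : Om -> H) : Prop :=
  exists (m : nat) (f : 'rV[R]_m -> R) (h : 'I_m -> H),
    [/\ smooth_poly_growth f,
        forall w, F w = f (gauss_vec X h w) &
        forall w, DF w =
          \sum_(i < m) partial_derive i f (gauss_vec X h w) *: h i].

(* [malliavin_derivative ip X F DF]: F is in D^{1,2} and DF is a version of its
   Malliavin derivative, i.e. (F, DF) lies in the closure in
   L^2(P) x L^2(P; H) of the graph of D on smooth functionals.  As H is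
   separable, weak measurability of DF amounts to strong measurability. *)
Definition malliavin_derivative d (Om : measurableType d) (R : realType)
    (P : probability Om R) (H : normedModType R) (ip : H -> H -> R)
    (X : H -> {RV P >-> R}) (F : {RV P >-> R}) (DF : Om -> H) : Prop :=
  (forall h : H, measurable_fun setT (fun w => ip (DF w) h)) /\
  exists (Fk : nat -> Om -> R) (DFk : nat -> Om -> H),
    [/\ forall k, smooth_functional X (Fk k) (DFk k),
        L2_cvg P Fk F &
        ('E_P[fun w => (`|DFk k w - DF w| ^+ 2)%R])%E @[k --> \oo] --> 0%E].

(** ** Wiener chaos and the pseudo-inverse of the Ornstein-Uhlenbeck generator *)

(* Probabilists' normalization: H_2 = X^2 - 1. *)
Fixpoint hermite (R : realType) (p : nat) : {poly R} :=
  if p is q.+1 then 'X * hermite R q - (hermite R q)^`() else 1.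

(* Closed linear span in L^2(P) of { H_p(X(h)) : |h| = 1 }, i.e. the range of
   the multiple integral I_p *)
Definition wiener_chaos d (Om : measurableType d) (R : realType)
    (P : probability Om R) (H : normedModType R) (X : H -> {RV P >-> R})
    (p : nat) (F : {RV P >-> R}) : Prop :=
  exists (m : nat -> nat) (a : nat -> nat -> R) (h : nat -> nat -> H),
    (forall k j, `|h k j| = 1) /\
    L2_cvg P
      (fun k w => \sum_(j < m k) a k j * (hermite R p).[X (h k j) w]) F.

(* [OU_pseudo_inverse X F G]: G is a version of L^{-1} F, that is
   F = sum_p F_p with F_p in the p-th chaos and G = - sum_{p >= 1} F_p / p. *)
Definition OU_pseudo_inverse d (Om : measurableType d) (R : realType)
    (P : probability Om R) (H : normedModType R) (X : H -> {RV P >-> R})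
    (F G : {RV P >-> R}) : Prop :=
  exists Fp : nat -> {RV P >-> R},
    [/\ forall p, wiener_chaos X p (Fp p),
        L2_cvg P (fun m w => \sum_(0 <= p < m) Fp p w) F &
        L2_cvg P (fun m w => - \sum_(1 <= p < m) p%:R^-1 * Fp p w) G].

(* [gamma_operator ip X i F G]: G is a version of Gamma_i(F), where
   Gamma_0(F) = F and Gamma_{i+1}(F) = < D Gamma_i(F), - D L^{-1} F >. *)
Fixpoint gamma_operator d (Om : measurableType d) (R : realType)
    (P : probability Om R) (H : normedModType R) (ip : H -> H -> R)
    (X : H -> {RV P >-> R}) (i : nat) (F G : {RV P >-> R}) : Prop :=
  if i is j.+1 then
    exists (Gj LF : {RV P >-> R}) (DGj DLF : Om -> H),
      [/\ gamma_operator ip X j F Gj,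
          malliavin_derivative ip X Gj DGj,
          OU_pseudo_inverse X F LF,
          malliavin_derivative ip X LF DLF &
          {ae P, forall w, G w = ip (DGj w) (- DLF w)}]
  else {ae P, forall w, G w = F w}.

(** ** The centered Gamma law *)

Definition Gamma_fun (R : realType) (a : R) : R :=
  Rintegral lebesgue_measure `]0, +oo[ (fun x : R => x `^ (a - 1) * expR (- x)).

Definition gamma_pdf (R : realType) (a x : R) : R :=
  if 0 < x then x `^ (a - 1) * expR (- x) / Gamma_fun a else 0.

Definition gamma_law (R : realType) (a : R) (A : set R) : \bar R :=
  (\int[lebesgue_measure]_(x in A) (gamma_pdf a x)%:E)%E.

(* The law of 2 G(nu/2) - nu *)
Definition centered_gamma_law (R : realType) (nu : R) (A : set R) : \bar R :=
  gamma_law (nu / 2) ((fun x => 2 * x - nu) @^-1` A).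

(** ** Cumulants, convergence in law, distance *)

Definition moment d (Om : measurableType d) (R : realType)
    (P : probability Om R) (Y : Om -> R) (k : nat) : R :=
  fine ('E_P[fun w => (Y w ^+ k)%R])%E.

(* n! times the coefficient of t^n in log(sum_k E[Y^k] t^k / k!), the logarithm
   being expanded as sum_j (-1)^(j-1) u^j / j; equivalently
   (-i)^n (d/dt)^n log E[exp(itY)] at t = 0.  Only the terms with j, k <= n
   contribute to the coefficient of t^n. *)
Definition cumulant d (Om : measurableType d) (R : realType)
    (P : probability Om R) (n : nat) (Y : Om -> R) : R :=
  let u : {poly R} :=
    \sum_(1 <= k < n.+1) (moment P Y k / (k`!)%:R) *: 'X^k in
  (n`!)%:R * (\sum_(1 <= j < n.+1) ((-1) ^+ j.-1 / j%:R) *: u ^+ j)`_n.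

Definition cvg_in_law d d' (Om : measurableType d) (Om' : measurableType d')
    (R : realType) (P : probability Om R) (P' : probability Om' R)
    (F : nat -> Om -> R) (G : Om' -> R) : Prop :=
  forall f : R -> R, continuous f -> (exists B, forall x, `|f x| <= B) ->
    ('E_P[f \o F n])%E @[n --> \oo] --> ('E_P'[f \o G])%E.

(* [h''] only exists almost everywhere, and its sup norm is an essential one. *)
Definition class_H2 (R : realType) (h : R -> R) : Prop :=
  [/\ forall x, derivable h x 1,
      continuous (derive1 h),
      exists k : R, k.-lipschitz (derive1 h),
      forall x, `|derive1 h x| <= 1 &
      {ae (@lebesgue_measure R), forall x,
         derivable (derive1 h) x 1 /\ `|derive1 (derive1 h) x| <= 1}].

Definition dist2 d d' (Om : measurableType d) (Om' : measurableType d')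
    (R : realType) (P : probability Om R) (P' : probability Om' R)
    (Y : Om -> R) (Z : Om' -> R) : \bar R :=
  ereal_sup [set `|'E_P[h \o Y] - 'E_P'[h \o Z]|%E | h in @class_H2 R].

Definition cumulant_gap d d' (Om : measurableType d) (Om' : measurableType d')
    (R : realType) (P : probability Om R) (P' : probability Om' R)
    (Y : Om -> R) (Z : Om' -> R) : R :=
  Num.max `|cumulant P 3 Y - cumulant P' 3 Z|
          `|cumulant P 4 Y - cumulant P' 4 Z|.

(** ** Coefficients; indices start at 0, so [c 0] is the leading one *)

Definition sorted_coef (R : realType) (c : nat -> R) : Prop :=
  forall i, `|c i.+1| <= `|c i| /\ (`|c i| = `|c i.+1| -> c i.+1 <= c i).

(* F = sum_i c_i (N_i^2 - 1) with N_i = X(e_i), the e_i being orthonormal.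
   Orthonormality is only required where c_i is nonzero (the other terms
   vanish), so that H may be finite-dimensional. *)
Definition second_chaos_series d (Om : measurableType d) (R : realType)
    (P : probability Om R) (H : normedModType R) (ip : H -> H -> R)
    (X : H -> {RV P >-> R}) (e : nat -> H) (c : nat -> R)
    (F : {RV P >-> R}) : Prop :=
  (forall i j, c i != 0 -> c j != 0 -> ip (e i) (e j) = (i == j)%:R) /\
  L2_cvg P (fun m w => \sum_(i < m) c i * (X (e i) w ^+ 2 - 1)) F.

Definition omega_rate (R : realType) (k : nat) (c : nat -> R) : R :=
  \big[Num.max/0]_(i < k) `|1 - c i|.

Definition theta_rate (R : realType) (k : nat) (c : nat -> R) : R :=
  limn (fun m => \sum_(k <= i < m) c i ^+ 2).

(* The limit of a/b is C > 0.  Since x / 0 = 0, this forces b to be eventually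
   nonzero. *)
Definition approx_const (R : realType) (C : R) (a b : nat -> R) : Prop :=
  0 < C /\ a n / b n @[n --> \oo] --> C.

(* Main.v *)
(* Since [Gamma_1 F = 2 sum_i c_i^2 N_i^2], one has
   [Var (Gamma_1 F - 2 F) = 8 sum_i c_i^2 (1 - c_i)^2].  When this vanishes under
   [sum_i c_i^2 = nu], the number [nu] is an integer [k], the first [k]
   coefficients tend to [1], and [theta = sum_(i >= k) c_i^2] tends to [0]: the
   head of [F] approaches [G = sum_(i < k) (N_i^2 - 1)] and the tail disappears.

   Upper bound: the tail is centered and independent of the head, so the first
   order term of [E h(head + tail)] vanishes and [d_2(F, G) <= 2 theta + 2 k omega].
   Lower bound: in the test function [sin(t x)] the remainder
   [sin(t x) - t x + t^3 x^3 / 6] costs [O(t^4 (theta + omega))], whereas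
   [kappa_3 F - kappa_3 G] is [-12 theta] up to smaller terms.  As
   [theta ~ C omega], for large [n] the quantities [M(F_n)], [theta] and
   [d_2(F_n, G)] are comparable.  For each of the finitely many remaining [n], a
   vanishing [M(F_n)] forces all coefficients into [{0, 1}], hence equal laws,
   and otherwise [sin(t x)] and [cos(t x)] with small [t] detect the moments and
   give [d_2 > 0].

   Independence of the [N_i] is read off their cosine transforms, and laws of
   quadratic forms are identified by their Laplace transforms. *)

Require Import Defs.
From HB Require Import structures.
From mathcomp Require Import all_boot all_order all_algebra.
From mathcomp Require Import all_classical all_reals all_analysis.
From mathcomp Require Import ring lra measurable_realfun.

Set Implicit Arguments.
Unset Strict Implicit.
Unset Printing Implicit Defensive.

Import Order.TTheory GRing.Theory Num.Theory.
Import numFieldNormedType.Exports.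

Local Open Scope classical_set_scope.
Local Open Scope ring_scope.

(** * Expectations and weighted laws *)

Section RealMeasurability.
Context d (T : measurableType d) (R : realType).

(** Independence has to be extracted from the Gaussian law of linear combinations. Only the squares
    [N_i^2] occur in the second chaos, so real, even transforms suffice: averaging [cos (r N)] over
    a Gaussian [r] turns a cosine transform into the Laplace transform of [N^2], which is inverted
    by powers of [1 - e^(-n z)] converging to indicators of half-lines. Both steps are carried out
    for laws carrying a signed weight, such as an indicator of the past times a cosine of the
    future; this makes independence provable by induction on the index.

    The lower bound must hold with one [t] for all large [n]. A remainder of order [t^4] alone would
    not do; it has to be proportional to [theta + omega], which is why the remainder is itself
    expanded around the head. The coefficient [-12] stems from the fixed sum of squares:
    [x^3 - 1 + 3/2 (1 - x^2)] vanishes to second order at [1], so the head contributes [-12 theta]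
    up to [omega^2], and [omega^2] is negligible because [omega] is at most a multiple of
    [theta]. *)

Lemma measurableT_comp_normr (f : T -> R) :
  measurable_fun setT f -> measurable_fun setT (fun x => `|f x|).
Proof. by move=> mf; apply: (measurableT_comp _ mf). Qed.

Lemma measurable_oppr_comp (f : T -> R) :
  measurable_fun setT f -> measurable_fun setT (fun x => - f x).
Proof. by move=> mf; apply: (measurableT_comp _ mf). Qed.

Lemma measurable_continuous_comp (g : R -> R) (f : T -> R) : continuous g ->
  measurable_fun setT f -> measurable_fun setT (fun x => g (f x)).
Proof.
move=> cg mf; apply: (measurableT_comp _ mf).
exact: continuous_measurable_fun.
Qed.

Lemma measurable_cos_comp (f : T -> R) :
  measurable_fun setT f -> measurable_fun setT (fun x => cos (f x)).
Proof. by move=> mf; apply: measurable_continuous_comp mf; apply: continuous_cos. Qed.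

Lemma measurable_sin_comp (f : T -> R) :
  measurable_fun setT f -> measurable_fun setT (fun x => sin (f x)).
Proof. by move=> mf; apply: measurable_continuous_comp mf; apply: continuous_sin. Qed.

Lemma measurable_exp_comp (f : T -> R) :
  measurable_fun setT f -> measurable_fun setT (fun x => expR (f x)).
Proof. by move=> mf; apply: measurable_continuous_comp mf; apply: continuous_expR. Qed.

Lemma measurable_minr_comp (f g : T -> R) :
  measurable_fun setT f -> measurable_fun setT g ->
  measurable_fun setT (fun x => Num.min (f x) (g x)).
Proof. by move=> mf mg; apply: measurable_minr. Qed.

End RealMeasurability.

Ltac solve_measurable :=
  repeat first
    [ assumption | exact: measurable_cst | exact: measurable_id
    | exact: measurable_funP | exact: measurable_funPT
    | apply: measurable_funB | apply: measurable_funD | apply: measurable_funM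
    | apply: measurable_funX | apply: measurableT_comp_normr
    | apply: measurable_oppr_comp
    | apply: measurable_cos_comp | apply: measurable_sin_comp
    | apply: measurable_exp_comp | apply: measurable_minr_comp
    | (apply: measurable_sum; move=> ?) ].

Section RealExpectation.
Context d (T : measurableType d) (R : realType).
Variable mu : {measure set T -> \bar R}.
Implicit Types f g : T -> R.

(** Expectations are kept real-valued: [Ex] sends an infinite integral to [0], so integrability
    travels separately as [intgr]. *)
Definition intgr f : Prop := mu.-integrable setT (EFin \o f).
Definition Ex f : R := \int[mu]_x f x.

Lemma intgr_meas f : intgr f -> measurable_fun setT f.
Proof. by move=> /integrableP[/measurable_EFinP]. Qed.

Lemma eq_intgr f g : f =1 g -> intgr f -> intgr g.
Proof. by move=> /funext ->. Qed.

Lemma eq_Ex f g : f =1 g -> Ex f = Ex g.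
Proof. by move=> /funext ->. Qed.

Lemma intgrD f g : intgr f -> intgr g -> intgr (fun x => f x + g x).
Proof. by move=> hf hg; apply: (integrableD measurableT hf hg). Qed.

Lemma intgrZ (k : R) f : intgr f -> intgr (fun x => k * f x).
Proof. by move=> hf; apply: (integrableZl measurableT k hf). Qed.

Lemma intgrN f : intgr f -> intgr (fun x => - f x).
Proof. by move=> hf; apply: (integrableN hf). Qed.

Lemma intgrB f g : intgr f -> intgr g -> intgr (fun x => f x - g x).
Proof. by move=> hf hg; apply: intgrD => //; apply: intgrN. Qed.

Lemma intgr0 : intgr (fun=> 0).
Proof. exact: integrable0. Qed.

Lemma intgr_sum I (s : seq I) (h : I -> T -> R) :
  (forall i, intgr (h i)) -> intgr (fun x => \sum_(i <- s) h i x).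
Proof.
move=> hh; elim: s => [|i s IH].
  by apply: eq_intgr intgr0 => x; rewrite big_nil.
by apply: eq_intgr (intgrD (hh i) IH) => x; rewrite big_cons.
Qed.

Lemma intgr_le f g : measurable_fun setT f -> (forall x, `|f x| <= g x) ->
  intgr g -> intgr f.
Proof.
move=> mf fg ig; apply: (le_integrable measurableT _ _ ig).
  exact/measurable_EFinP.
by move=> x _; rewrite /= lee_fin (le_trans (fg x))// ler_norm.
Qed.

Lemma intgr_norm f : intgr f -> intgr (fun x => `|f x|).
Proof. exact: integrable_norm. Qed.

Lemma intgrM_bounded (K : R) f g : measurable_fun setT f ->
  (forall x, `|f x| <= K) -> intgr g -> intgr (fun x => f x * g x).
Proof.
move=> mf fK ig; apply: (intgr_le _ _ (intgrZ K (intgr_norm ig))).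
  by apply: measurable_funM => //; apply: intgr_meas.
by move=> x; rewrite normrM ler_wpM2r.
Qed.

Lemma ExD f g : intgr f -> intgr g -> Ex (fun x => f x + g x) = Ex f + Ex g.
Proof. by move=> hf hg; rewrite /Ex RintegralD. Qed.

Lemma ExB f g : intgr f -> intgr g -> Ex (fun x => f x - g x) = Ex f - Ex g.
Proof. by move=> hf hg; rewrite /Ex RintegralB. Qed.

Lemma ExZ (k : R) f : intgr f -> Ex (fun x => k * f x) = k * Ex f.
Proof. by move=> hf; rewrite /Ex RintegralZl. Qed.

Lemma Ex0 : Ex (fun=> 0) = 0.
Proof. by rewrite /Ex /Rintegral integral0. Qed.

Lemma Ex_sum I (s : seq I) (h : I -> T -> R) : (forall i, intgr (h i)) ->
  Ex (fun x => \sum_(i <- s) h i x) = \sum_(i <- s) Ex (h i).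
Proof.
move=> hh; elim: s => [|i s IH].
  by rewrite big_nil -[RHS]Ex0; apply: eq_Ex => x; rewrite big_nil.
rewrite big_cons -IH -ExD//; last exact: intgr_sum.
by apply: eq_Ex => x; rewrite big_cons.
Qed.

Lemma le_Ex f g : intgr f -> intgr g -> (forall x, f x <= g x) -> Ex f <= Ex g.
Proof. by move=> hf hg fg; apply: le_Rintegral => // x _; apply: fg. Qed.

Lemma Ex_ge0 f : (forall x, 0 <= f x) -> 0 <= Ex f.
Proof. by move=> f0; apply: Rintegral_ge0. Qed.

Lemma le_norm_Ex f : intgr f -> `|Ex f| <= Ex (fun x => `|f x|).
Proof. by move=> hf; apply: le_normr_Rintegral. Qed.

Lemma le_norm_Ex_le f g : intgr f -> intgr g -> (forall x, `|f x| <= g x) ->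
  `|Ex f| <= Ex g.
Proof.
move=> hf hg fg; apply: le_trans (le_norm_Ex hf) _.
by apply: le_Ex => //; apply: intgr_norm.
Qed.

Lemma EFin_Ex f : intgr f -> (\int[mu]_x (f x)%:E = (Ex f)%:E)%E.
Proof. by move=> hf; rewrite /Ex /Rintegral fineK//; apply: integrable_fin_num. Qed.

Lemma ge0_intgr f : measurable_fun setT f -> (forall x, 0 <= f x) ->
  (\int[mu]_x (f x)%:E < +oo)%E -> intgr f.
Proof.
move=> mf f0 foo; apply/integrableP; split; first exact/measurable_EFinP.
by under eq_integral do rewrite /= ger0_norm//.
Qed.

Lemma ge0_intgr_le (K : R) f : measurable_fun setT f -> (forall x, 0 <= f x) ->
  (\int[mu]_x (f x)%:E <= K%:E)%E -> intgr f /\ Ex f <= K.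
Proof.
move=> mf f0 fK; have hf : intgr f.
  by apply: ge0_intgr => //; apply: le_lt_trans fK (ltry _).
by split=> //; rewrite -lee_fin -EFin_Ex.
Qed.

Lemma Ex_dct (f_ : nat -> T -> R) f g : (forall n, measurable_fun setT (f_ n)) ->
  measurable_fun setT f -> (forall x, f_ ^~ x @ \oo --> f x) ->
  intgr g -> (forall n x, `|f_ n x| <= g x) ->
  intgr f /\ Ex (f_ n) @[n --> \oo] --> Ex f.
Proof.
move=> mf_ mf cf ig fg.
have h x : (EFin \o f_ n) x @[n --> \oo] --> (EFin \o f) x.
  by apply: cvg_EFin; [apply: nearW|apply: cf].
have [i1 _ i2] := @dominated_convergence _ _ _ mu _ measurableT
  (fun n => EFin \o f_ n) (EFin \o f) (EFin \o g)
  (fun n => proj2 (measurable_EFinP _ _) (mf_ n)) (proj2 (measurable_EFinP _ _) mf)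
  (aeW _ (fun x _ => h x)) ig
  (aeW _ (fun x n _ => fg n x : `|(EFin \o f_ n) x| <= (EFin \o g) x)%E).
split => //.
by apply: fine_cvg; rewrite fineK//; exact: integrable_fin_num i1.
Qed.

End RealExpectation.

Section ProbabilityExpectation.
Context d (T : measurableType d) (R : realType) (P : probability T R).
Implicit Types f g : T -> R.

Lemma intgr_bounded (K : R) f : measurable_fun setT f -> (forall x, `|f x| <= K) ->
  intgr P f.
Proof.
move=> mf fK; apply: (intgr_le mf fK).
by apply: finite_measure_integrable_cst.
Qed.

Lemma intgr_cst (r : R) : intgr P (fun=> r).
Proof. by apply: (@intgr_bounded `|r|) => //; exact: measurable_cst. Qed.

Lemma Ex_cst (r : R) : Ex P (fun=> r) = r.
Proof. by rewrite /Ex Rintegral_cst//= probability_setT mulr1. Qed.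

End ProbabilityExpectation.

Section WeightedLaw.
Context (R : realType) d1 (T1 : measurableType d1) (mu1 : {measure set T1 -> \bar R})
  d2 (T2 : measurableType d2) (mu2 : {measure set T2 -> \bar R}).
Context d (T : measurableType d).
Variables (V1 : T1 -> R) (Y1 : T1 -> T) (V2 : T2 -> R) (Y2 : T2 -> T).
Hypotheses (iV1 : intgr mu1 V1) (mY1 : measurable_fun setT Y1).
Hypotheses (iV2 : intgr mu2 V2) (mY2 : measurable_fun setT Y2).

(** Image under [Y] of the signed measure of density [V]. Signs are allowed because the weights of
    interest are products of an indicator and a cosine. *)
Definition wlaw d' (T' : measurableType d') (mu : {measure set T' -> \bar R})
    (V : T' -> R) (Y : T' -> T) (B : set T) : R :=
  Ex mu (fun x => V x * \1_B (Y x)).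

Lemma norm_indic_le1 (U : Type) (A : set U) (x : U) : `|\1_A x : R| <= 1.
Proof. by rewrite indicE; case: (_ \in _); rewrite /= ?normr1 ?normr0. Qed.

Lemma measurable_indic_comp d' (T' : measurableType d') (Y : T' -> T) B :
  measurable_fun setT Y -> measurable B ->
  measurable_fun setT (fun x => \1_B (Y x) : R).
Proof. by move=> mY mB; apply: (measurableT_comp _ mY); exact: measurable_indic. Qed.

Lemma intgr_wlaw d' (T' : measurableType d') (mu : {measure set T' -> \bar R})
    (V : T' -> R) (Y : T' -> T) (B : set T) : intgr mu V -> measurable_fun setT Y ->
  measurable B -> intgr mu (fun x => V x * \1_B (Y x)).
Proof.
move=> iV mY mB.
apply: (eq_intgr _ (intgrM_bounded (measurable_indic_comp mY mB)
  (fun x => norm_indic_le1 _ _) iV)).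
by move=> x; rewrite mulrC.
Qed.

Lemma wlawT d' (T' : measurableType d') (mu : {measure set T' -> \bar R})
    (V : T' -> R) (Y : T' -> T) : wlaw mu V Y setT = Ex mu V.
Proof. by apply: eq_Ex => x; rewrite indicT mulr1. Qed.

Lemma wlawC d' (T' : measurableType d') (mu : {measure set T' -> \bar R})
    (V : T' -> R) (Y : T' -> T) (B : set T) : intgr mu V -> measurable_fun setT Y ->
  measurable B -> wlaw mu V Y (~` B) = Ex mu V - wlaw mu V Y B.
Proof.
move=> iV mY mB; rewrite -ExB//; last exact: intgr_wlaw.
by apply: eq_Ex => x; rewrite !indicE in_setC; case: (_ \in _); rewrite /= ?mulr1 ?mulr0 ?subr0 ?subrr.
Qed.

(** Dominated convergence with bound [|V|]: for a disjoint family the partial sums of indicators are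
    again indicators. *)
Lemma wlaw_bigcup d' (T' : measurableType d') (mu : {measure set T' -> \bar R})
    (V : T' -> R) (Y : T' -> T) (F : (set T)^nat) : intgr mu V ->
  measurable_fun setT Y -> (forall n, measurable (F n)) -> trivIset setT F ->
  \sum_(i < n) wlaw mu V Y (F i) @[n --> \oo] --> wlaw mu V Y (\bigcup_k F k).
Proof.
move=> iV mY mF tF.
have mU : measurable (\bigcup_k F k) by exact: bigcupT_measurable.
pose S n x : R := \sum_(i < n) \1_(F i) (Y x).
have SE n x : S n x = \1_(\bigcup_(i < n) F i) (Y x).
  elim: n => [|n IH]; first by rewrite /S big_ord0 bigcup_mkord big_ord0 indic0.
  rewrite /S big_ord_recr /= -/(S n x) IH !bigcup_mkord big_ord_recr/=.
  rewrite !indicE in_setU; case: (boolP (Y x \in F n)) => Fn; last first.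
    by rewrite orbF addr0.
  rewrite orbT memNset ?add0r//; rewrite -bigcup_mkord => -[i /= ilt Fiy].
  have := tF i n I I (ex_intro _ (Y x) (conj Fiy (set_mem Fn))) => in_.
  by rewrite in_ ltnn in ilt.
have -> : (fun n => \sum_(i < n) wlaw mu V Y (F i)) =
    (fun n => Ex mu (fun x => S n x * V x)).
  apply/funext => n; rewrite -Ex_sum; last by move=> i; exact: intgr_wlaw.
  by apply: eq_Ex => x; rewrite /S mulr_suml; apply: eq_bigr => i _; rewrite mulrC.
rewrite /wlaw.
apply: (@Ex_dct _ _ _ mu _ _ (fun x => `|V x|) _ _ _ _ _).2.
- move=> n; apply: measurable_funM; last exact: intgr_meas iV.
  by apply: measurable_sum => i; exact: measurable_indic_comp.
- by apply: measurable_funM; [exact: intgr_meas iV|exact: measurable_indic_comp].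
- move=> x; rewrite mulrC; apply: cvgMl.
  have [[k _ Fk]|nF] := pselect ((\bigcup_k F k) (Y x)).
    rewrite indicE mem_set; last by exists k.
    apply: cvg_near_cst; near=> n; rewrite SE indicE mem_set//.
    exists k => //=; near: n; exact: nbhs_infty_gt.
  rewrite indicE memNset//.
  apply: cvg_near_cst; near=> n; rewrite SE indicE memNset// => -[k _ Fk].
  by apply: nF; exists k.
- exact: intgr_norm.
- by move=> n x; rewrite SE normrM ler_piMl// norm_indic_le1.
Unshelve. all: by end_near.
Qed.

(** Dynkin's theorem. Total masses are compared separately, since [G] need not contain the whole
    space. *)
Lemma wlaw_unique (G : set (set T)) : measurable = <<s G >> -> setI_closed G ->
  Ex mu1 V1 = Ex mu2 V2 ->
  (forall B, G B -> wlaw mu1 V1 Y1 B = wlaw mu2 V2 Y2 B) ->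
  forall B, measurable B -> wlaw mu1 V1 Y1 B = wlaw mu2 V2 Y2 B.
Proof.
move=> GE GI eT eG B mB.
apply: (@dynkin_induction _ _ G
  (fun B => wlaw mu1 V1 Y1 B = wlaw mu2 V2 Y2 B)) => //.
- by rewrite !wlawT.
- by move=> S mS eS; rewrite !wlawC// eS eT.
- move=> F mF tF eF.
  apply/(cvg_unique _ (wlaw_bigcup iV1 mY1 mF tF)) => //.
  rewrite (_ : (fun n => _) = (fun n => \sum_(i < n) wlaw mu2 V2 Y2 (F i))).
    exact: wlaw_bigcup.
  by apply/funext => n; apply: eq_bigr => i _.
- by rewrite -GE.
Qed.

End WeightedLaw.

(** * Uniqueness of Laplace transforms *)

Section LaplaceUniqueness.
Context (R : realType).

Lemma bernoulli_ineq (y : R) n : 0 <= y <= 1 -> 1 - n%:R * y <= (1 - y) ^+ n.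
Proof.
move=> /andP[y0 y1]; elim: n => [|n IH]; first by rewrite mul0r subr0 expr0.
rewrite exprS -natr1.
apply: (@le_trans _ _ ((1 - y) * (1 - n%:R * y))); last first.
  by apply: ler_wpM2l IH; rewrite subr_ge0.
have := ler0n R n; nra.
Qed.

(** From [e^(m y) = (e^(m y / 2))^2 >= (m y / 2)^2], which is the source of [4 / y^2]. *)
Lemma exp_mulN_le (n : nat) (y : R) : 0 < y ->
  n.+1%:R * expR (- (n.+1%:R * y)) <= 4 / y ^+ 2 * n.+1%:R^-1.
Proof.
move=> y0; have n0 : 0 < n.+1%:R :> R by rewrite ltr0n.
set m : R := n.+1%:R in n0 *.
have h : (m * y / 2) ^+ 2 <= expR (m * y).
  have {2}-> : m * y = m * y / 2 + m * y / 2 by field.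
  rewrite expRD -expr2.
  have t0 : 0 <= m * y / 2 by apply: divr_ge0 => //; apply: mulr_ge0; apply: ltW.
  rewrite ler_sqr ?nnegrE ?expR_ge0//.
  by apply: le_trans (expR_ge1Dx _); rewrite lerDr.
have e0 := expR_gt0 (m * y).
rewrite expRN ler_pdivrMr//.
apply: (@le_trans _ _ (4 / y ^+ 2 / m * (m * y / 2) ^+ 2)).
  by rewrite le_eqVlt; apply/orP; left; apply/eqP; field; rewrite !gt_eqF.
by apply: ler_wpM2l h; rewrite ltW// !divr_gt0// exprn_gt0.
Qed.

Definition steep_exponent (x : R) (n : nat) : nat :=
  (Num.truncn (n.+1%:R * expR (n.+1%:R * x))).+1.

(* With [M = steep_exponent x n ~ n e^{nx}], the power [(1 - e^{-nz})^M] tends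
   to 1 for [z > x] by Bernoulli's inequality, and it is at most [e^{-n}] for
   [z <= x]. *)
Lemma steep_power_cvg (x z : R) : 0 <= x -> 0 <= z ->
  (1 - expR (- z) ^+ n.+1) ^+ steep_exponent x n @[n --> \oo] -->
  (\1_(`]x, +oo[%classic : set R) z : R).
Proof.
move=> x0 z0; set u := fun n => _.
have w01 n : 0 <= expR (- z) ^+ n.+1 <= 1.
  by rewrite exprn_ge0 ?expR_ge0//= exprn_ile1 ?expR_ge0// -expR0 ler_expR oppr_le0.
have wE n : expR (- z) ^+ n.+1 = expR (- (n.+1%:R * z)).
  by rewrite -expRM_natl mulrN.
have M1 n : n.+1%:R * expR (n.+1%:R * x) < (steep_exponent x n)%:R.
  exact: truncnS_gt.
have M2 n : (steep_exponent x n)%:R <= n.+1%:R * expR (n.+1%:R * x) + 1.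
  by rewrite /steep_exponent -natr1 lerD2r truncn_le// mulr_ge0// expR_ge0.
have [K hK] : exists K : R, forall n, `|\1_(`]x, +oo[%classic : set R) z - u n| <= K * n.+1%:R^-1.
  have [xz|zx] := ltP x z.
    (* The two terms bound [m e^(- m (z - x))] and [e^(- m z)] with [m = n + 1]: the contributions
       of [m e^(m x)] and of the [+ 1] in the upper bound of the exponent. *)
    exists (4 / (z - x) ^+ 2 + 4 / z ^+ 2) => n.
    rewrite indicE mem_set/= ?in_itv/= ?xz// /u.
    have z1 : 0 < z by exact: le_lt_trans xz.
    have b := bernoulli_ineq (steep_exponent x n) (w01 n).
    have p1 : (1 - expR (- z) ^+ n.+1) ^+ steep_exponent x n <= 1.
      by apply: exprn_ile1; have := w01 n; lra.
    rewrite ger0_norm ?subr_ge0// mulrDl.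
    have e1 := exp_mulN_le n (y := z - x); rewrite subr_gt0 in e1.
    have {e1} := e1 xz.
    have -> : - (n.+1%:R * (z - x)) = n.+1%:R * x + - (n.+1%:R * z) by ring.
    rewrite expRD => e1.
    have e2 := exp_mulN_le n z1.
    have e3 : expR (- (n.+1%:R * z)) <= n.+1%:R * expR (- (n.+1%:R * z)).
      by rewrite ler_peMl ?expR_ge0// ler1n.
    have e4 : (steep_exponent x n)%:R * expR (- (n.+1%:R * z)) <=
        (n.+1%:R * expR (n.+1%:R * x) + 1) * expR (- (n.+1%:R * z)).
      by rewrite ler_wpM2r// expR_ge0.
    move: b; rewrite wE => b.
    rewrite mulrDl mul1r -mulrA in e4.
    apply: le_trans (lerD e1 (le_trans e3 e2)); apply: le_trans e4.
    by rewrite lerBlDr -lerBlDl.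
  exists 1 => n; rewrite indicE memNset/= ?in_itv/= ?andbT; last first.
    by apply/negP; rewrite -leNgt.
  have p0 : 0 <= u n by apply: exprn_ge0; have := w01 n; lra.
  rewrite sub0r normrN ger0_norm// mul1r.
  have : u n <= expR (- n.+1%:R).
    apply: (@le_trans _ _ (expR (- expR (- z) ^+ n.+1) ^+ steep_exponent x n)).
      apply: lerXn2r; rewrite ?nnegrE ?expR_ge0//; first by have := w01 n; lra.
      by apply: le_trans (expR_ge1Dx _); rewrite lexx.
    rewrite -expRM_natl ler_expR mulrN lerN2 wE.
    apply: le_trans (ler_wpM2r (expR_ge0 _) (ltW (M1 n))).
    rewrite -mulrA -expRD ler_peMr//.
    rewrite -expR0 ler_expR -mulrBr mulr_ge0// subr_ge0//.
  move/le_trans; apply.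
  rewrite expRN lef_pV2 ?posrE ?expR_gt0//.
  by apply: le_trans (expR_ge1Dx _); rewrite lerDr.
apply/cvgrPdist_le => e e0.
have h : (fun n => K * n.+1%:R^-1) @ \oo --> (0 : R).
  rewrite -(mulr0 K); apply: cvgMr; exact: cvg_harmonic.
near=> n; apply: le_trans (hK n) _; apply: le_trans (ler_norm _) _.
rewrite -normrN -[- _]add0r; near: n; move/cvgrPdist_le : h; exact.
Unshelve. all: by end_near.
Qed.

Context d1 (T1 : measurableType d1) (mu1 : {measure set T1 -> \bar R})
  d2 (T2 : measurableType d2) (mu2 : {measure set T2 -> \bar R}).
Variables (V1 Z1 : T1 -> R) (V2 Z2 : T2 -> R).
Hypotheses (iV1 : intgr mu1 V1) (mZ1 : measurable_fun setT Z1)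
  (Z1_ge0 : forall x, 0 <= Z1 x).
Hypotheses (iV2 : intgr mu2 V2) (mZ2 : measurable_fun setT Z2)
  (Z2_ge0 : forall x, 0 <= Z2 x).
Hypothesis laplaceE : forall n : nat,
  Ex mu1 (fun x => V1 x * expR (- (n%:R * Z1 x))) =
  Ex mu2 (fun x => V2 x * expR (- (n%:R * Z2 x))).

Let expRN_01 (z : R) : 0 <= z -> 0 <= expR (- z) <= 1.
Proof. by move=> z0; rewrite expR_ge0 -expR0 ler_expR oppr_le0. Qed.

Let intgr_laplace d (T : measurableType d) (mu : {measure set T -> \bar R})
  (V Z : T -> R) (iV : intgr mu V) (mZ : measurable_fun setT Z)
  (Z_ge0 : forall x, 0 <= Z x) (n : nat) :
  intgr mu (fun x => V x * expR (- (n%:R * Z x))).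
Proof.
apply: (eq_intgr (fun x => mulrC _ _)); apply: (intgrM_bounded (K := 1)) iV.
  by solve_measurable.
by move=> x; rewrite ger0_norm ?expR_ge0// -expR0 ler_expR oppr_le0 mulr_ge0.
Qed.

Let Ex_horner d (T : measurableType d) (mu : {measure set T -> \bar R})
  (V Z : T -> R) (iV : intgr mu V) (mZ : measurable_fun setT Z)
  (Z_ge0 : forall x, 0 <= Z x) (p : {poly R}) :
  Ex mu (fun x => p.[expR (- Z x)] * V x) =
  \sum_(i < size p) p`_i * Ex mu (fun x => V x * expR (- (i%:R * Z x))).
Proof.
rewrite (eq_bigr (fun i : 'I_(size p) =>
    Ex mu (fun x => p`_i * (V x * expR (- (i%:R * Z x)))))); last first.
  by move=> i _; rewrite ExZ//; exact: intgr_laplace.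
rewrite -Ex_sum; last by move=> i; apply: intgrZ; exact: intgr_laplace.
apply: eq_Ex => x; rewrite horner_coef mulr_suml; apply: eq_bigr => i _.
by rewrite -mulrN expRM_natl; ring.
Qed.

Let wlaw_itv d (T : measurableType d) (mu : {measure set T -> \bar R})
  (V Z : T -> R) (iV : intgr mu V) (mZ : measurable_fun setT Z)
  (Z_ge0 : forall x, 0 <= Z x) (x : R) : 0 <= x ->
  Ex mu (fun t => ((1 - 'X ^+ n.+1) ^+ steep_exponent x n : {poly R}).[expR (- Z t)] * V t)
    @[n --> \oo] --> wlaw mu V Z `]x, +oo[%classic.
Proof.
move=> x0.
apply: (@Ex_dct _ _ _ mu _ _ (fun x => `|V x|) _ _ _ _ _).2.
- move=> n; apply: measurable_funM; last exact: intgr_meas iV.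
  apply: measurable_continuous_comp; first exact: continuous_horner.
  by solve_measurable.
- by apply: measurable_funM; [exact: intgr_meas iV|apply: measurable_indic_comp].
- move=> t; rewrite [X in _ --> X]mulrC; apply: cvgMl.
  have := steep_power_cvg x0 (Z_ge0 t).
  rewrite (_ : (fun n => _) = (fun n =>
    ((1 - 'X ^+ n.+1) ^+ steep_exponent x n : {poly R}).[expR (- Z t)]))//.
  by apply/funext => n; rewrite horner_exp !hornerE.
- exact: intgr_norm.
- move=> n t; rewrite normrM ler_piMl// horner_exp !hornerE.
  have /andP[e0 e1] := expRN_01 (Z_ge0 t).
  have p0 : 0 <= expR (- Z t) ^+ n.+1 by rewrite exprn_ge0.
  have p1 : expR (- Z t) ^+ n.+1 <= 1 by rewrite exprn_ile1.
  rewrite ger0_norm; first by rewrite exprn_ile1//; lra.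
  by rewrite exprn_ge0//; lra.
Qed.

(** Integer points suffice: by linearity they give equality on every polynomial in [e^(-Z)], in
    particular on the steep powers, whose limits are the indicators of the half-lines that generate
    the Borel sets. *)
Lemma laplace_unique B : measurable B ->
  wlaw mu1 V1 Z1 B = wlaw mu2 V2 Z2 B.
Proof.
have e0 : Ex mu1 V1 = Ex mu2 V2.
  have := laplaceE 0.
  rewrite (_ : Ex mu1 _ = Ex mu1 V1); last by apply: eq_Ex => x; rewrite mul0r oppr0 expR0 mulr1.
  by move->; apply: eq_Ex => x; rewrite mul0r oppr0 expR0 mulr1.
refine (@wlaw_unique R _ _ mu1 _ _ mu2 _ _ V1 Z1 V2 Z2 iV1 mZ1 iV2 mZ2 (@RGenOInfty.G R) _ _ _ _ B) => //.
- exact: RGenOInfty.measurableE.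
- move=> _ _ [x ->] [y ->]; exists (Num.max x y).
  rewrite predeqE => t; rewrite /= !in_itv/= !andbT gt_max; split=> [[-> ->]//|/andP//].
- move=> _ [x ->].
  (* A half-line with negative endpoint carries the total mass, as [Z >= 0]. *)
  have [x0|x0] := leP 0 x; last first.
    rewrite (_ : wlaw mu1 _ _ _ = Ex mu1 V1); last first.
      apply: eq_Ex => t; rewrite indicE mem_set ?mulr1//= in_itv/= andbT.
      exact: lt_le_trans x0 _.
    rewrite e0; apply: eq_Ex => t; rewrite indicE mem_set ?mulr1//= in_itv/= andbT.
    exact: lt_le_trans x0 _.
  apply/(cvg_unique _ (wlaw_itv iV1 mZ1 Z1_ge0 x0)) => //.
  rewrite (_ : (fun n => _) = (fun n =>
    Ex mu2 (fun t => ((1 - 'X ^+ n.+1) ^+ steep_exponent x n : {poly R}).[expR (- Z2 t)] * V2 t))).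
    exact: wlaw_itv.
  apply/funext => n; rewrite !Ex_horner//.
  by apply: eq_bigr => i _; rewrite laplaceE.
Qed.

End LaplaceUniqueness.

(** * Transfer of integrals between equal weighted laws *)

Section WeightedTransfer.
Import HBNNSimple.
Context (R : realType) d1 (T1 : measurableType d1) (mu1 : {measure set T1 -> \bar R})
  d2 (T2 : measurableType d2) (mu2 : {measure set T2 -> \bar R}).
Context d (T : measurableType d).
Variables (V1 : T1 -> R) (Y1 : T1 -> T) (V2 : T2 -> R) (Y2 : T2 -> T).
Hypotheses (iV1 : intgr mu1 V1) (mY1 : measurable_fun setT Y1) (V1_ge0 : forall x, 0 <= V1 x).
Hypotheses (iV2 : intgr mu2 V2) (mY2 : measurable_fun setT Y2) (V2_ge0 : forall x, 0 <= V2 x).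
Hypothesis wlawE : forall B, measurable B -> wlaw mu1 V1 Y1 B = wlaw mu2 V2 Y2 B.

Let wlaw_sfun d' (T' : measurableType d') (mu : {measure set T' -> \bar R})
    (V : T' -> R) (Y : T' -> T) (g : {nnsfun T >-> R}) : intgr mu V ->
  measurable_fun setT Y ->
  intgr mu (fun x => V x * g (Y x)) /\
  Ex mu (fun x => V x * g (Y x)) =
    \sum_(r <- finmap.enum_fset (fset_set (range g))) r * wlaw mu V Y (g @^-1` [set r]).
Proof.
move=> iV mY.
have E : (fun x => V x * g (Y x)) =1 (fun x => \sum_(r <- finmap.enum_fset (fset_set (range g)))
    r * (V x * \1_(g @^-1` [set r]) (Y x))).
  move=> x; rewrite fimfunE fsbig_finite//= mulr_sumr.
  by apply: eq_bigr => r _; rewrite mulrCA.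
have i1 r : intgr mu (fun x => V x * \1_(g @^-1` [set r]) (Y x)).
  by apply: intgr_wlaw => //; exact: measurable_funPTI.
split.
  by apply: (eq_intgr (fun x => esym (E x))); apply: intgr_sum => r; exact: intgrZ.
rewrite (eq_Ex _ E) Ex_sum; last by move=> r; exact: intgrZ.
by apply: eq_bigr => r _; rewrite ExZ.
Qed.

Let wlaw_approx d' (T' : measurableType d') (mu : {measure set T' -> \bar R})
    (V : T' -> R) (Y : T' -> T) (f : T -> R) (mf : measurable_fun setT (EFin \o f)) :
    intgr mu V -> measurable_fun setT Y -> (forall x, 0 <= V x) ->
    (forall x, 0 <= f x) ->
  (\int[mu]_x (V x * nnsfun_approx measurableT mf n (Y x))%:E)%E @[n --> \oo] -->
  (\int[mu]_x (V x * f (Y x))%:E)%E.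
Proof.
move=> iV mY V0 f0.
have mV : measurable_fun setT V := intgr_meas iV.
rewrite [X in _ --> X](_ : _ =
  \int[mu]_x (limn (fun n => (V x * nnsfun_approx measurableT mf n (Y x))%:E)))%E.
  apply: cvg_monotone_convergence => //.
  - move=> n; apply/measurable_EFinP; apply: measurable_funM => //.
    by apply: measurableT_comp.
  - by move=> n x _; rewrite lee_fin mulr_ge0.
  - move=> x _ m n mn; rewrite lee_fin ler_wpM2l//.
    exact/lefP/nd_nnsfun_approx.
apply: eq_integral => x _; apply/esym/cvg_lim => //.
under eq_fun do rewrite EFinM.
rewrite EFinM; apply: cvgeZl => //.
by apply: (cvg_nnsfun_approx _ _ (f := EFin \o f)) => // y _; rewrite /= lee_fin.
Qed.

(** Monotone convergence along simple functions, for which the weights are taken nonnegative; the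
    common value may be infinite. *)
Lemma wlaw_integral_ge0 (f : T -> R) : measurable_fun setT f -> (forall x, 0 <= f x) ->
  (\int[mu1]_x (V1 x * f (Y1 x))%:E = \int[mu2]_x (V2 x * f (Y2 x))%:E)%E.
Proof.
move=> /measurable_EFinP mf f0.
apply/(cvg_unique _ (wlaw_approx mf iV1 mY1 V1_ge0 f0)) => //.
rewrite (_ : (fun n => _) =
  (fun n => \int[mu2]_x (V2 x * nnsfun_approx measurableT mf n (Y2 x))%:E)%E).
  exact: wlaw_approx.
apply/funext => n.
have [i1 e1] := wlaw_sfun (nnsfun_approx measurableT mf n) iV1 mY1.
have [i2 e2] := wlaw_sfun (nnsfun_approx measurableT mf n) iV2 mY2.
rewrite !EFin_Ex// e1 e2; congr EFin; apply: eq_bigr => r _.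
by rewrite wlawE//; exact: measurable_funPTI.
Qed.

Lemma wlaw_intgr (f : T -> R) : measurable_fun setT f ->
  intgr mu1 (fun x => V1 x * f (Y1 x)) -> intgr mu2 (fun x => V2 x * f (Y2 x)).
Proof.
move=> mf i1.
have m2 : measurable_fun setT (fun x => V2 x * f (Y2 x)).
  by apply: measurable_funM; [exact: intgr_meas iV2|exact: measurableT_comp].
apply: (intgr_le (g := fun x => V2 x * `|f (Y2 x)|)) => //.
  by move=> x; rewrite normrM (ger0_norm (V2_ge0 x)).
apply: ge0_intgr.
- apply: measurable_funM; first exact: intgr_meas iV2.
  by apply: measurableT_comp_normr; exact: measurableT_comp.
- by move=> x; rewrite mulr_ge0.
- rewrite -(@wlaw_integral_ge0 (fun y => `|f y|))//; last exact: measurableT_comp_normr.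
  rewrite EFin_Ex ?ltry//.
  apply: (eq_intgr _ (intgr_norm i1)) => x.
  by rewrite normrM (ger0_norm (V1_ge0 x)).
Qed.

Lemma wlaw_Ex (f : T -> R) : measurable_fun setT f ->
  intgr mu1 (fun x => V1 x * f (Y1 x)) ->
  Ex mu1 (fun x => V1 x * f (Y1 x)) = Ex mu2 (fun x => V2 x * f (Y2 x)).
Proof.
move=> mf i1; have i2 := wlaw_intgr mf i1.
pose fp x := Num.max (f x) 0; pose fn x := Num.max (- f x) 0.
have fE x : f x = fp x - fn x.
  by rewrite /fp /fn; case: (leP (f x) 0); case: (leP (- f x) 0); lra.
have mfp : measurable_fun setT fp by apply: measurable_maxr.
have mfn : measurable_fun setT fn.
  by apply: measurable_maxr => //; exact: measurable_oppr_comp.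
have fp0 x : 0 <= fp x by rewrite /fp le_max lexx orbT.
have fn0 x : 0 <= fn x by rewrite /fn le_max lexx orbT.
have fpf x : `|fp x| <= `|f x|.
  by rewrite ger0_norm// /fp ge_max ler_norm normr_ge0.
have fnf x : `|fn x| <= `|f x|.
  by rewrite ger0_norm// /fn ge_max normr_ge0 andbT -normrN ler_norm.
have int_le d' (T' : measurableType d') (mu : {measure set T' -> \bar R})
    (V : T' -> R) (Y : T' -> T) (g : T -> R) : intgr mu V -> measurable_fun setT Y ->
    measurable_fun setT g -> (forall x, `|g x| <= `|f x|) ->
    intgr mu (fun x => V x * f (Y x)) -> intgr mu (fun x => V x * g (Y x)).
  move=> iV mY mg gf /intgr_norm; apply: intgr_le.
    by apply: measurable_funM; [exact: intgr_meas iV|exact: measurableT_comp].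
  by move=> x; rewrite !normrM ler_wpM2l.
have E d' (T' : measurableType d') (mu : {measure set T' -> \bar R})
    (V : T' -> R) (Y : T' -> T) : intgr mu V -> measurable_fun setT Y ->
    intgr mu (fun x => V x * f (Y x)) ->
    Ex mu (fun x => V x * f (Y x)) =
    Ex mu (fun x => V x * fp (Y x)) - Ex mu (fun x => V x * fn (Y x)).
  move=> iV mY iVf; rewrite -ExB; [|exact: int_le iVf|exact: int_le iVf].
  by apply: eq_Ex => x; rewrite fE mulrBr.
rewrite !E//; congr (_ - _).
  by rewrite /Ex /Rintegral wlaw_integral_ge0.
by rewrite /Ex /Rintegral wlaw_integral_ge0.
Qed.

End WeightedTransfer.

(** * Rules for continuous real functions *)

Section ContinuityRules.
Context (R : realType).
Implicit Types f g : R -> R.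

Lemma contD f g : continuous f -> continuous g -> continuous (fun x => f x + g x).
Proof. by move=> cf cg x; apply: cvgD; [exact: cf|exact: cg]. Qed.

Lemma contN f : continuous f -> continuous (fun x => - f x).
Proof. by move=> cf x; apply: cvgN; exact: cf. Qed.

Lemma contM f g : continuous f -> continuous g -> continuous (fun x => f x * g x).
Proof. by move=> cf cg x; apply: cvgM; [exact: cf|exact: cg]. Qed.

Lemma cont_id : continuous (fun x : R => x).
Proof. by move=> x; exact: cvg_id. Qed.

Lemma cont_cst (a : R) : continuous (fun _ : R => a).
Proof. exact: cst_continuous. Qed.

Lemma contX f n : continuous f -> continuous (fun x => f x ^+ n).
Proof.
move=> cf; elim: n => [|n IH]; first exact: cont_cst.
rewrite (_ : (fun x => _) = (fun x => f x * f x ^+ n)); last by apply/funext => x; rewrite exprS.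
exact: contM.
Qed.

Lemma cont_comp f g : continuous g -> continuous f -> continuous (fun x => g (f x)).
Proof. by move=> cg cf x; apply: (continuous_comp (cf x)); exact: cg. Qed.

Lemma cont_cos f : continuous f -> continuous (fun x => cos (f x)).
Proof. by move=> cf; apply: (cont_comp _ cf); exact: continuous_cos. Qed.

Lemma cont_sin f : continuous f -> continuous (fun x => sin (f x)).
Proof. by move=> cf; apply: (cont_comp _ cf); exact: continuous_sin. Qed.

Lemma cont_expR f : continuous f -> continuous (fun x => expR (f x)).
Proof. by move=> cf; apply: (cont_comp _ cf); exact: continuous_expR. Qed.

End ContinuityRules.

Ltac solve_continuous :=
  repeat (try assumption; lazymatch goal with
  | |- continuous (fun x => (@?f x + @?g x)%R) => apply: (@contD _ f g)
  | |- continuous (fun x => (@?f x * @?g x)%R) => apply: (@contM _ f g)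
  | |- continuous (fun x => (- @?f x)%R) => apply: (@contN _ f)
  | |- continuous (fun x => (@?f x ^+ ?n)%R) => apply: (@contX _ f n)
  | |- continuous (fun x => cos (@?f x)) => apply: (@cont_cos _ f)
  | |- continuous (fun x => sin (@?f x)) => apply: (@cont_sin _ f)
  | |- continuous (fun x => expR (@?f x)) => apply: (@cont_expR _ f)
  | |- continuous (fun x => x) => exact: cont_id
  | |- continuous (fun x => ?a) => exact: (@cont_cst _ a)
  end).

(** * Gaussian calculus *)

Section GaussianCalculus.
Context (R : realType).
Local Notation leb := (@lebesgue_measure R).

Definition gauss (x : R) : R := expR (- x ^+ 2 / 2).

Lemma is_derive_conv (f h : R -> R) (x a b : R) :
  is_derive x (1 : R) f a -> f =1 h -> a = b -> is_derive x (1 : R) h b.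
Proof. by move=> df /funext <- <-. Qed.

Lemma is_derive_gauss (x : R) : is_derive x 1 gauss (- x * gauss x).
Proof.
have h : is_derive x 1 (fun t : R => (- (2^-1)%:P * 'X ^+ 2 : {poly R}).[t])
   ((- (2^-1)%:P * 'X ^+ 2 : {poly R})^`().[x]) by exact: is_derive_poly.
have -> : gauss = expR \o (fun t : R => (- (2^-1)%:P * 'X ^+ 2 : {poly R}).[t]).
  apply/funext => t; rewrite /gauss /= !hornerE /=.
  by congr (expR _); field.
apply: is_derive_eq.
by rewrite /= derivM !derivN !derivC oppr0 mul0r add0r derivXn /= !hornerE /=; field.
Qed.

Lemma continuous_gauss : continuous gauss.
Proof.
move=> x; apply/differentiable_continuous/derivable1_diffP.
by have := is_derive_gauss x; case.
Qed.

(** On [[-n, n]] the fundamental theorem of calculus leaves two boundary terms of size at most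
    [C / n]; dominated convergence passes to the whole line. *)
Lemma Ex_derivative0 (f F : R -> R) (C : R) : continuous f ->
  (forall x : R, is_derive x (1 : R) F (f x)) -> (forall x, `|x| * `|F x| <= C) ->
  intgr leb f -> Ex leb f = 0.
Proof.
move=> cf dF FC iF.
have cF : continuous F.
  by move=> x; apply/differentiable_continuous/derivable1_diffP; have := dF x; case.
have [_ h] : intgr leb f /\ Ex leb (f \_ `[- (n.+1%:R), n.+1%:R]%classic)
    @[n --> \oo] --> Ex leb f.
  apply: (@Ex_dct _ _ _ leb _ _ (fun x => `|f x|)).
  - move=> n; apply/(measurable_restrictT _ _).1 => //.
    by apply: measurable_funTS; exact: intgr_meas iF.
  - exact: intgr_meas iF.
  - move=> x; apply: cvg_near_cst; near=> n.
    rewrite patchE mem_set//= in_itv/= -ler_norml.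
    have : `|x| <= n%:R by near: n; exact: nbhs_infty_ger.
    by move/le_trans; apply; rewrite ler_nat.
  - exact: intgr_norm.
  - by move=> n x; rewrite patchE; case: ifP => // _; rewrite normr0.
have e n : Ex leb (f \_ `[- (n.+1%:R), n.+1%:R]%classic) =
    F n.+1%:R - F (- n.+1%:R).
  have n0 : - n.+1%:R < n.+1%:R :> R by rewrite gtrN// ltr0n.
  rewrite /Ex -Rintegral_mkcond /Rintegral (@continuous_FTC2 R f F)//.
  - exact: continuous_subspaceT.
  - split; first by move=> x _; have := dF x; case.
    + by apply: cvg_at_right_filter; exact: cF.
    + by apply: cvg_at_left_filter; exact: cF.
  - by move=> x _; rewrite derive1E; have := dF x; case.
apply/eqP; rewrite -normr_le0; apply/ler_addgt0Pr => _ /posnumP[eps]; rewrite add0r.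
move/cvgrPdist_le : h => /(_ (eps%:num / 2) _)[]// N _ h.
have C0 : 0 <= C by apply: le_trans (FC 0); rewrite normr0 mul0r.
pose n := maxn N (Num.truncn (4 * C / eps%:num)).
have := h n (leq_maxl _ _); rewrite e => h1.
have n1 : 4 * C / eps%:num < n.+1%:R.
  apply: lt_le_trans (truncnS_gt _) _; rewrite ler_nat ltnS; exact: leq_maxr.
have n2 : 4 * C < n.+1%:R * eps%:num by rewrite -ltr_pdivrMr.
have a1 := FC n.+1%:R; have a2 := FC (- n.+1%:R).
rewrite normrN ger0_norm// in a1 a2.
have b1 : `|F n.+1%:R| <= eps%:num / 4 by have := ltr0Sn R n; nra.
have b2 : `|F (- n.+1%:R)| <= eps%:num / 4 by have := ltr0Sn R n; nra.
have := ler_normB (F n.+1%:R) (F (- n.+1%:R)).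
have := ler_normD (Ex leb f - (F n.+1%:R - F (- n.+1%:R))) (F n.+1%:R - F (- n.+1%:R)).
rewrite subrK; lra.
Unshelve. all: by end_near.
Qed.

(** Half of the exponent absorbs the power: with [y = x^2 / 4], [|x|^n <= 4^n y^n + 1] and
    [y^n <= n! e^y]. *)
Lemma normr_exp_le (x : R) n : `|x| ^+ n * gauss x <= (4 ^+ n * n`!%:R + 1) * expR (- x ^+ 2 / 4).
Proof.
have -> : gauss x = expR (- x ^+ 2 / 4) * expR (- (x ^+ 2 / 4)).
  by rewrite -expRD /gauss; congr expR; field.
rewrite mulrCA mulrC ler_wpM2r ?expR_ge0//.
have h : `|x| ^+ n <= 4 ^+ n * (x ^+ 2 / 4) ^+ n + 1.
  rewrite -exprMn mulrC divfK// -(real_normK (num_real x)).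
  rewrite -exprM mulnC exprM; have := sqr_ge0 (`|x| ^+ n - 1); have := sqr_ge0 (`|x| ^+ n); lra.
rewrite expRN ler_pdivrMr ?expR_gt0//; apply: le_trans h _.
have y0 : 0 <= x ^+ 2 / 4 by rewrite divr_ge0 ?sqr_ge0.
have e1 : 1 <= expR (x ^+ 2 / 4) by rewrite -[leLHS]expR0 ler_expR.
rewrite [leRHS]mulrDl mul1r -[X in _ <= X + _]mulrA; apply: lerD => //.
apply: ler_wpM2l; first by rewrite exprn_ge0.
case: n => [|n]; first by rewrite expr0 mul1r.
have := expR_ge1Dxn n y0; rewrite -ler_pdivrMl ?ltr0n ?fact_gt0//.
rewrite mulrC; lra.
Qed.

Lemma normal_pdf01 (x : R) : normal_pdf 0 1 x = normal_peak 1 * gauss x.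
Proof. by rewrite normal_pdfE ?oner_eq0// /normal_fun /gauss subr0 expr1n. Qed.

Lemma intgr_normal_pdf (m s : R) : intgr leb (normal_pdf m s).
Proof. exact: integrable_normal_pdf. Qed.

Lemma Ex_normal_pdf (m s : R) : Ex leb (normal_pdf m s) = 1.
Proof. by rewrite /Ex /Rintegral integral_normal_pdf. Qed.

(** A multiple of the normal density of variance [1 / (2 s)]. *)
Lemma intgr_exp_sqr (s : R) : 0 < s -> intgr leb (fun x => expR (- s * x ^+ 2)) /\
  Ex leb (fun x => expR (- s * x ^+ 2)) = (normal_peak (Num.sqrt (2 * s))^-1)^-1.
Proof.
move=> s0; set sg := (Num.sqrt (2 * s))^-1.
have sg0 : sg != 0 by rewrite invr_eq0 gt_eqF// sqrtr_gt0 mulr_gt0.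
have E x : expR (- s * x ^+ 2) = (normal_peak sg)^-1 * normal_pdf 0 sg x.
  rewrite normal_pdfE// mulKf ?gt_eqF ?normal_peak_gt0// /normal_fun subr0.
  congr expR; rewrite /sg exprVn sqr_sqrtr ?mulr_ge0 ?ltW//.
  by field; rewrite gt_eqF.
have E' x := esym (E x); split; first by apply: (@eq_intgr _ _ _ leb _ _ E'); apply: intgrZ; exact: intgr_normal_pdf.
by rewrite (@eq_Ex _ _ _ leb _ _ E) ExZ ?Ex_normal_pdf ?mulr1//; exact: intgr_normal_pdf.
Qed.

Lemma intgr_gauss_dom (f : R -> R) (n : nat) (C : R) : measurable_fun setT f ->
  (forall x, `|f x| <= C * (`|x| ^+ n)) -> intgr leb (fun x => f x * gauss x).
Proof.
move=> mf fC.
have mg : measurable_fun setT gauss by apply: continuous_measurable_fun; exact: continuous_gauss.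
have C0 : 0 <= C.
  by have := fC 1; rewrite normr1 expr1n mulr1; apply: le_trans.
apply: (@intgr_le _ _ _ leb _ ( fun x => C * (4 ^+ n * n`!%:R + 1) * expR (- 4^-1 * x ^+ 2))).
- exact: measurable_funM.
- move=> x; rewrite normrM (ger0_norm (expR_ge0 _)) -mulrA.
  apply: (@le_trans _ _ (C * (`|x| ^+ n * gauss x))).
    by rewrite mulrA ler_wpM2r// expR_ge0.
  rewrite ler_wpM2l//; apply: le_trans (normr_exp_le x n) _.
  by rewrite le_eqVlt; apply/orP; left; apply/eqP; congr (_ * expR _); field.
- by apply: intgrZ; have [] := @intgr_exp_sqr 4^-1; rewrite // invr_gt0.
Qed.

Lemma continuous_is_derive (F f : R -> R) :
  (forall x : R, is_derive x (1 : R) F (f x)) -> continuous F.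
Proof.
move=> dF x; apply/differentiable_continuous/derivable1_diffP.
by have := dF x; case.
Qed.

(** Stein's identity [E[N F(N)] = E[F'(N)]] without the normalizing factor: the derivative of
    [F * gauss] integrates to zero. *)
Lemma gauss_ibp (F f : R -> R) (n : nat) (C : R) : continuous f ->
  (forall x : R, is_derive x (1 : R) F (f x)) ->
  (forall x, `|F x| <= C * `|x| ^+ n) -> intgr leb (fun x => f x * gauss x) ->
  Ex leb (fun x => x * F x * gauss x) = Ex leb (fun x => f x * gauss x).
Proof.
move=> cf dF FC iF.
have cF := continuous_is_derive dF.
have ixF : intgr leb (fun x => x * F x * gauss x).
  apply: (@intgr_gauss_dom _ n.+1 C).
    apply: continuous_measurable_fun => x; apply: continuousM => //; exact: cF.
  by move=> x; rewrite normrM exprS mulrCA ler_wpM2l.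
apply/eqP; rewrite eq_sym -subr_eq0 -ExB//; apply/eqP.
have C0 : 0 <= C by have := FC 1; rewrite normr1 expr1n mulr1; apply: le_trans.
apply: (@Ex_derivative0 (fun x : R => f x * gauss x - x * F x * gauss x)
  (fun x => F x * gauss x) (C * (4 ^+ n.+1 * n.+1`!%:R + 1))).
- by have cg := continuous_gauss; solve_continuous.
- move=> x.
  apply: (is_derive_conv (@is_deriveM _ _ F gauss x 1 _ _ (dF x) (is_derive_gauss x))) => //.
  by rewrite /GRing.scale /=; ring.
- move=> x; rewrite normrM (ger0_norm (expR_ge0 _)) mulrA.
  apply: (@le_trans _ _ (C * (`|x| ^+ n.+1 * gauss x))).
    rewrite mulrA ler_wpM2r ?expR_ge0//.
    by rewrite exprS mulrCA ler_wpM2l.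
  rewrite ler_wpM2l//; apply: le_trans (normr_exp_le x _) _.
  rewrite ler_piMr//.
  by rewrite -[leRHS]expR0 ler_expR mulNr oppr_le0 divr_ge0 ?sqr_ge0.
- exact: intgrB.
Qed.

Definition gmoment (n : nat) : R := Ex leb (fun x => x ^+ n * gauss x).

Lemma intgr_gmoment n : intgr leb (fun x => x ^+ n * gauss x).
Proof.
apply: (@intgr_gauss_dom _ n 1).
  by apply: measurable_funX; exact: measurable_id.
by move=> x; rewrite mul1r normrX.
Qed.

Lemma gmomentS n : gmoment n.+2 = n.+1%:R * gmoment n.
Proof.
rewrite /gmoment -ExZ; last exact: intgr_gmoment.
have E x : n.+1%:R * (x ^+ n * gauss x) = n.+1%:R * x ^+ n * gauss x by rewrite mulrA.
rewrite (@eq_Ex _ _ _ leb _ _ E).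
have E2 : (fun x : R => x ^+ n.+2 * gauss x) =1 (fun x => x * x ^+ n.+1 * gauss x).
  by move=> x; rewrite -exprS.
rewrite (@eq_Ex _ _ _ leb _ _ E2).
apply: (@gauss_ibp (fun x => x ^+ n.+1) (fun x : R => n.+1%:R * x ^+ n) n.+1 1).
- by solve_continuous.
- move=> x; apply: (is_derive_conv (@is_deriveX _ _ id n.+1 x 1 1 (is_derive_id _ _))).
    by move=> y; rewrite exprfctE.
  by rewrite /GRing.scale /= mulr1.
- by move=> x; rewrite mul1r normrX.
- by apply: (@eq_intgr _ _ _ leb _ _ E); apply: intgrZ; exact: intgr_gmoment.
Qed.

Definition gcos (a : R) : R := Ex leb (fun x => cos (a * x) * gauss x).

Lemma intgr_gcos a : intgr leb (fun x => cos (a * x) * gauss x).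
Proof.
apply: (@intgr_gauss_dom _ 0 1).
  by apply: measurable_cos_comp; apply: measurable_funM; [exact: measurable_cst|exact: measurable_id].
by move=> x; rewrite mul1r expr0 ler_norml cos_geN1 cos_le1.
Qed.

Lemma is_derive_lin (a x : R) : is_derive x (1 : R) (fun x : R => a * x) a.
Proof.
apply: (is_derive_conv (@is_deriveZ _ _ _ id a x 1 1 (is_derive_id _ _))) => //.
by rewrite /GRing.scale /= mulr1.
Qed.

Lemma is_derive_cos_lin (a x : R) :
  is_derive x (1 : R) (fun x => cos (a * x)) (- (a * sin (a * x))).
Proof.
apply: (is_derive_conv (@is_derive1_comp _ cos (fun x => a * x) x _ _ (is_derive_cos _) (is_derive_lin a x))) => //.
by ring.
Qed.

Lemma is_derive_sin_lin (a x : R) :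
  is_derive x (1 : R) (fun x => sin (a * x)) (a * cos (a * x)).
Proof.
apply: (is_derive_conv (@is_derive1_comp _ sin (fun x => a * x) x _ _ (is_derive_sin _) (is_derive_lin a x))) => //.
by ring.
Qed.

(** Differentiation under the integral sign followed by [gauss_ibp] for [sin (a x)] yields the
    differential equation [y' = - a y], which determines the cosine transform up to its value at
    [0]. *)
Lemma is_derive_gcos (a : R) : is_derive a (1 : R) gcos (- a * gcos a).
Proof.
pose f (a x : R) := cos (a * x) * gauss x.
have df (b x : R) : is_derive b (1 : R) (f ^~ x) (- (x * sin (b * x)) * gauss x).
  have h : is_derive b (1 : R) (fun b => cos (b * x)) (- (x * sin (b * x))).
    rewrite (_ : (fun b => _) = (fun b => cos (x * b))); last by apply/funext => t; rewrite mulrC.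
    by rewrite (mulrC b); exact: is_derive_cos_lin.
  apply: (is_derive_conv (@is_deriveM _ _ _ (cst (gauss x)) b 1 _ _ h (is_derive_cst _ _ _))) => //.
  by rewrite /GRing.scale /=; ring.
have dom : intgr leb (fun x => `|x| * gauss x).
  apply: (@intgr_gauss_dom _ 1 1); first exact/measurableT_comp_normr/measurable_id.
  by move=> x; rewrite mul1r expr1 normr_id.
have ia : [set` `]a - 1, a + 1[] a by rewrite /= in_itv/= gtrBl ltrDl ltr01.
have h1 := @cvg_differentiation_under_integral R _ _ leb f setT measurableT a (a - 1) (a + 1) ia
  (fun x _ => intgr_gcos x) (fun b x _ _ => let: @DeriveDef _ _ _ _ _ _ _ h _ := df b x in h)
  (fun x => `|x| * gauss x) (fun x => mulr_ge0 (normr_ge0 _) (expR_ge0 _)) dom.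
have d1 b (x : R) : partial1of2 f b x = - (x * sin (b * x)) * gauss x.
  by rewrite partial1of2E; have := df b x; case.
have {}h1 := h1 (fun b x _ _ => _ : `|partial1of2 f b x| <= `|x| * gauss x).
have E : Ex leb (fun x => partial1of2 f a x) = - a * gcos a.
  rewrite (@eq_Ex _ _ _ leb _ (fun x : R => - 1 * (x * sin (a * x) * gauss x))); last first.
    by move=> x; rewrite d1; ring.
  have isin : intgr leb (fun x => a * cos (a * x) * gauss x).
    apply: (@eq_intgr _ _ _ leb _ _ _ (intgrZ a (intgr_gcos a))) => x.
    by rewrite mulrA.
  have ixsin : intgr leb (fun x => x * sin (a * x) * gauss x).
    apply: (@intgr_gauss_dom _ 1 1).
      by apply: continuous_measurable_fun; solve_continuous.
    by move=> x; rewrite mul1r expr1 normrM ler_piMr// ler_norml sin_geN1 sin_le1.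
  have sin1 (x : R) : `|sin (a * x)| <= 1 * `|x| ^+ 0.
    by rewrite mul1r expr0 ler_norml sin_geN1 sin_le1.
  have cc : continuous (fun x : R => a * cos (a * x)) by solve_continuous.
  have ibp := @gauss_ibp (fun x => sin (a * x)) (fun x => a * cos (a * x)) 0 1
    cc (is_derive_sin_lin a) sin1 isin.
  rewrite ExZ// ibp (@eq_Ex _ _ _ leb _ (fun x : R => a * (cos (a * x) * gauss x))); last first.
    by move=> x; rewrite mulrA.
  rewrite ExZ; last exact: intgr_gcos.
  by rewrite /gcos; ring.
have h2 : h^-1 *: (gcos (h + a) - gcos a) @[h --> 0^'] --> - a * gcos a.
  by rewrite -E; apply: h1 => b x; rewrite d1 normrM (ger0_norm (expR_ge0 _)) ler_wpM2r ?expR_ge0//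
    normrN normrM ler_piMr// ler_norml sin_geN1 sin_le1.
apply: DeriveDef.
  apply/cvg_ex; exists (- a * gcos a); under eq_fun do rewrite scaler1; exact: h2.
by rewrite /derive; apply/cvg_lim => //; under eq_fun do rewrite scaler1; exact: h2.
Qed.

Lemma gmoment0 : gmoment 0 = (normal_peak 1)^-1.
Proof.
have := Ex_normal_pdf 0 1.
rewrite (@eq_Ex _ _ _ leb _ (fun x : R => normal_peak 1 * (x ^+ 0 * gauss x))); last first.
  by move=> x; rewrite normal_pdf01 expr0 mul1r.
rewrite ExZ; last exact: intgr_gmoment.
move=> h; apply: (mulfI (x := normal_peak 1)); first by rewrite gt_eqF// normal_peak_gt0// oner_eq0.
by rewrite mulfV// gt_eqF// normal_peak_gt0// oner_eq0.
Qed.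

Lemma gcosE (a : R) : gcos a = (normal_peak 1)^-1 * gauss a.
Proof.
pose c (a : R) := gcos a * expR (a ^+ 2 / 2).
have dE (b : R) : is_derive b (1 : R) (fun a : R => expR (a ^+ 2 / 2)) (b * expR (b ^+ 2 / 2)).
  have h : is_derive b (1 : R) (fun t : R => ((2^-1)%:P * 'X ^+ 2 : {poly R}).[t])
   (((2^-1)%:P * 'X ^+ 2 : {poly R})^`().[b]) by exact: is_derive_poly.
  apply: (is_derive_conv (is_derive1_comp (is_derive_expR _) h)) => [x|].
    by rewrite /= !hornerE /=; congr expR; field.
  have -> : ((2^-1)%:P * 'X ^+ 2 : {poly R}).[b] = b ^+ 2 / 2.
    by rewrite !hornerE /=; field.
  by rewrite derivM !derivC mul0r add0r derivXn /= !hornerE /=; field.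
have dc (b : R) : is_derive b (1 : R) c 0.
  apply: (is_derive_conv (@is_deriveM _ _ gcos _ b 1 _ _ (is_derive_gcos b) (dE b))) => //.
  by rewrite /GRing.scale /=; ring.
have := is_derive_0_is_cst a 0 dc.
rewrite /c expr0n /= mul0r expR0 mulr1 => h.
have -> : gcos a = gcos a * expR (a ^+ 2 / 2) * gauss a.
  by rewrite -mulrA /gauss -expRD -mulrDl addrN mul0r expR0 mulr1.
rewrite h; congr (_ * _); rewrite -gmoment0 /gcos /gmoment.
by apply: eq_Ex => x; rewrite mul0r cos0 expr0.
Qed.

End GaussianCalculus.

(** * Laws of variables and of densities as weighted laws *)

Section LawTransfer.
Context (R : realType) d' (S : measurableType d').

Lemma wlaw_prob d (T : measurableType d) (P : probability T R) (Y : T -> S) (B : set S) : measurable_fun setT Y -> measurable B ->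
  wlaw P (fun=> 1) Y B = fine (P (Y @^-1` B)).
Proof.
move=> mY mB; rewrite /wlaw (@eq_Ex _ _ _ P _ (\1_(Y @^-1` B))); last first.
  by move=> x; rewrite mul1r !indicE.
rewrite /Ex /Rintegral integral_indic ?setIT//.
by rewrite -[_ @^-1` _]setTI; exact: mY.
Qed.

Lemma wlaw_density d2 (T2 : measurableType d2) (mu : {measure set T2 -> \bar R})
    (f : T2 -> R) (Y : T2 -> S) (B : set S) :
  wlaw mu f Y B = fine (\int[mu]_(x in Y @^-1` B) (f x)%:E)%E.
Proof.
rewrite /wlaw /Ex /Rintegral [in RHS]integral_mkcond; congr fine.
apply: eq_integral => x _; rewrite patchE indicE /=.
have -> : (x \in Y @^-1` B) = (Y x \in B) by apply/idP/idP; rewrite !inE.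
by case: (_ \in _); rewrite ?mulr1 ?mulr0.
Qed.

End LawTransfer.

(** * Moments and transforms of a standard normal variable *)

Section StandardNormal.
Context (R : realType) d (T : measurableType d) (P : probability T R).
Local Notation leb := (@lebesgue_measure R).

Definition std_normal (N : T -> R) : Prop := measurable_fun setT N /\
  forall A : set R, measurable A -> P (N @^-1` A) = normal_prob 0 1 A.

Variable N : T -> R.
Hypothesis hN : std_normal N.

Lemma std_normal_Ex (f : R -> R) : measurable_fun setT f ->
  intgr leb (fun x => f x * gauss x) ->
  intgr P (fun w => f (N w)) /\
  Ex P (fun w => f (N w)) = normal_peak 1 * Ex leb (fun x => f x * gauss x).
Proof.
move=> mf ifg; have [mN lN] := hN.
have W B : measurable B ->
    wlaw leb (normal_pdf 0 1) (idfun : measurableTypeR R -> R) B = wlaw P (fun=> 1) N B.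
  move=> mB; rewrite wlaw_prob// lN// wlaw_density /normal_prob.
  by rewrite preimage_id.
have E (x : R) : normal_peak 1 * (f x * gauss x) = normal_pdf 0 1 x * f x.
  by rewrite normal_pdf01; ring.
have i1 : intgr leb (fun x => normal_pdf 0 1 x * f (idfun x)).
  by apply: (@eq_intgr _ _ _ leb _ _ E); exact: intgrZ.
have m1 : measurable_fun setT (idfun : measurableTypeR R -> R) by exact: measurable_id.
have n0 (x : measurableTypeR R) : 0 <= normal_pdf 0 1 (x : R) := normal_pdf_ge0 0 1 x.
split.
  apply: (@eq_intgr _ _ _ P (fun w => 1 * f (N w))); first by move=> w; rewrite mul1r.
  apply: (wlaw_intgr (intgr_normal_pdf 0 1) m1 n0 (intgr_cst P 1) mN _ W) => //.
rewrite -ExZ// (@eq_Ex _ _ _ leb _ _ E).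
rewrite (wlaw_Ex (intgr_normal_pdf 0 1) m1 n0 (intgr_cst P 1) mN _ W)//.
by apply: eq_Ex => w; rewrite mul1r.
Qed.

Definition nmoment (n : nat) : R := Ex P (fun w => N w ^+ n).

Lemma nmomentE n : intgr P (fun w => N w ^+ n) /\ nmoment n = normal_peak 1 * gmoment R n.
Proof.
have := @std_normal_Ex (fun x => x ^+ n); apply; last exact: intgr_gmoment.
by apply: measurable_funX; exact: measurable_id.
Qed.

Lemma nmomentS n : nmoment n.+2 = n.+1%:R * nmoment n.
Proof. by rewrite !(nmomentE _).2 gmomentS mulrCA. Qed.

Lemma nmoment0 : nmoment 0 = 1.
Proof. by rewrite (nmomentE _).2 gmoment0 mulfV// gt_eqF// normal_peak_gt0// oner_eq0. Qed.

Lemma std_normal_cos (a : R) : Ex P (fun w => cos (a * N w)) = gauss a.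
Proof.
have mc : measurable_fun setT (fun x : R => cos (a * x)).
  by apply: continuous_measurable_fun; solve_continuous.
rewrite (std_normal_Ex mc (intgr_gcos a)).2 -/(gcos a) gcosE mulrA mulfV ?mul1r//.
by rewrite gt_eqF// normal_peak_gt0// oner_eq0.
Qed.

(** The factor [e^(- s x^2)] changes the Gaussian weight into another one, of exponent [1/2 + s],
    whose integral is known from [intgr_exp_sqr]. *)
Lemma std_normal_laplace (s : R) : 0 <= s ->
  Ex P (fun w => expR (- (s * N w ^+ 2))) = (Num.sqrt (1 + 2 * s))^-1.
Proof.
move=> s0; have t0 : 0 < 2^-1 + s by lra.
have mc : measurable_fun setT (fun x : R => expR (- (s * x ^+ 2))).
  by apply: continuous_measurable_fun; solve_continuous.
have [i1 e1] := intgr_exp_sqr t0.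
have E (x : R) : expR (- (2^-1 + s) * x ^+ 2) = expR (- (s * x ^+ 2)) * gauss x.
  by rewrite /gauss -expRD; congr expR; field.
rewrite (std_normal_Ex mc (@eq_intgr _ _ _ leb _ _ E i1)).2 -(@eq_Ex _ _ _ leb _ _ E) e1.
have e2 : 2 * (2^-1 + s) = 1 + 2 * s by field.
rewrite e2 /normal_peak expr1n invrK exprVn sqr_sqrtr; last by lra.
have q0 : 0 < 1 + 2 * s by lra.
have := pi_gt0 R; move: (pi : R) => p p0.
have -> : 1 * p *+ 2 = p *+ 2 by rewrite mul1r.
have -> : (1 + 2 * s)^-1 * p *+ 2 = (1 + 2 * s)^-1 * (p *+ 2) by rewrite mulrnAr.
rewrite sqrtrM ?invr_ge0 ?ltW// sqrtrV ?ltW// mulrCA mulVf ?mulr1//.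
by rewrite gt_eqF// sqrtr_gt0 mulrn_wgt0.
Qed.

Lemma nmoment_poly (s : seq (R * nat)) :
  intgr P (fun w => \sum_(q <- s) q.1 * N w ^+ q.2) /\
  Ex P (fun w => \sum_(q <- s) q.1 * N w ^+ q.2) = \sum_(q <- s) q.1 * nmoment q.2.
Proof.
have i q : intgr P (fun w => q.1 * N w ^+ q.2) by apply: intgrZ; exact: (nmomentE _).1.
split; first exact: (@intgr_sum _ _ _ P _ s (fun q w => q.1 * N w ^+ q.2)).
rewrite (@Ex_sum _ _ _ P _ s (fun q w => q.1 * N w ^+ q.2))//.
by apply: eq_bigr => q _; rewrite ExZ//; exact: (nmomentE _).1.
Qed.

(** The second Hermite polynomial of [N], that is a centered chi-square variable with one degree of
    freedom. *)
Definition chi (w : T) : R := N w ^+ 2 - 1.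

Lemma chi_moments :
  [/\ forall k, (k <= 4)%N -> intgr P (fun w => chi w ^+ k), Ex P chi = 0,
      Ex P (fun w => chi w ^+ 2) = 2, Ex P (fun w => chi w ^+ 3) = 8 &
      Ex P (fun w => chi w ^+ 4) = 60].
Proof.
have m0 := nmoment0; have m2 := nmomentS 0; have m4 := nmomentS 2.
have m6 := nmomentS 4; have m8 := nmomentS 6.
rewrite m0 mulr1 in m2; rewrite m2 mulr1 in m4; rewrite m4 in m6; rewrite m6 in m8.
have H1 := nmoment_poly [:: (1, 2%N); (- 1, 0%N)].
have H2 := nmoment_poly [:: (1, 4%N); (- 2, 2%N); (1, 0%N)].
have H3 := nmoment_poly [:: (1, 6%N); (- 3, 4%N); (3, 2%N); (- 1, 0%N)].
have H4 := nmoment_poly [:: (1, 8%N); (- 4, 6%N); (6, 4%N); (- 4, 2%N); (1, 0%N)].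
have E1 : (fun w => \sum_(q <- [:: (1, 2%N); (- 1, 0%N)]) q.1 * N w ^+ q.2) =
    chi.
  by apply/funext => w; rewrite !big_cons big_nil /chi /=; ring.
have E2 : (fun w => \sum_(q <- [:: (1, 4%N); (- 2, 2%N); (1, 0%N)]) q.1 * N w ^+ q.2) =
    (fun w => chi w ^+ 2).
  by apply/funext => w; rewrite !big_cons big_nil /chi /=; ring.
have E3 : (fun w => \sum_(q <- [:: (1, 6%N); (- 3, 4%N); (3, 2%N); (- 1, 0%N)]) q.1 * N w ^+ q.2) =
    (fun w => chi w ^+ 3).
  by apply/funext => w; rewrite !big_cons big_nil /chi /=; ring.
have E4 : (fun w => \sum_(q <- [:: (1, 8%N); (- 4, 6%N); (6, 4%N); (- 4, 2%N); (1, 0%N)]) q.1 * N w ^+ q.2) =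
    (fun w => chi w ^+ 4).
  by apply/funext => w; rewrite !big_cons big_nil /chi /=; ring.
rewrite E1 in H1; rewrite E2 in H2; rewrite E3 in H3; rewrite E4 in H4.
split.
- case=> [_|]; first exact: intgr_cst.
  case=> [_|]; first exact: H1.1.
  case=> [_|]; first exact: H2.1.
  case=> [_|]; first exact: H3.1.
  case=> [_|//]; exact: H4.1.
- by rewrite H1.2 !big_cons big_nil /= m2 m0; ring.
- by rewrite H2.2 !big_cons big_nil /= m4 m2 m0; ring.
- by rewrite H3.2 !big_cons big_nil /= m6 m4 m2 m0; ring.
- by rewrite H4.2 !big_cons big_nil /= m8 m6 m4 m2 m0; ring.
Qed.

End StandardNormal.

(** * Independence of Gaussian families *)

Section RealFubini.
Context (R : realType) d1 (T1 : measurableType d1) (P1 : probability T1 R)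
  d2 (T2 : measurableType d2) (P2 : probability T2 R).

(** The product bound gives integrability for the product measure by Tonelli, and Fubini then
    applies in both orders. *)
Lemma Ex_Fubini_dom (f : T1 -> T2 -> R) (g1 : T1 -> R) (g2 : T2 -> R) :
  measurable_fun setT (fun z : T1 * T2 => f z.1 z.2) ->
  (forall x y, `|f x y| <= g1 x * g2 y) ->
  (forall x, 0 <= g1 x) -> (forall y, 0 <= g2 y) -> intgr P1 g1 -> intgr P2 g2 ->
  intgr (P1 \x P2)%E (fun z => f z.1 z.2) /\
  Ex (P1 \x P2)%E (fun z => f z.1 z.2) = Ex P1 (fun x => Ex P2 (f x)) /\
  Ex P1 (fun x => Ex P2 (f x)) = Ex P2 (fun y => Ex P1 (f ^~ y)).
Proof.
move=> mf fg g10 g20 ig1 ig2.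
have m1 x : measurable_fun setT (f x).
  have := @measurableT_comp _ _ _ _ _ _ _ _ (pair x : T2 -> T1 * T2) mf.
  by apply; exact: measurable_pair1.
have m2 y : measurable_fun setT (f ^~ y).
  have := @measurableT_comp _ _ _ _ _ _ _ _ (pair^~ y : T1 -> T1 * T2) mf.
  by apply; exact: measurable_pair2.
have i1 x : intgr P2 (f x).
  by apply: (intgr_le (m1 x) (fg x)); exact: intgrZ.
have i2 y : intgr P1 (f ^~ y).
  apply: (@intgr_le _ _ _ P1 _ (fun x => g2 y * g1 x)) => //; last exact: intgrZ.
  by move=> x; rewrite mulrC.
have ip : intgr (P1 \x P2)%E (fun z => f z.1 z.2).
  apply/integrable12ltyP; first exact/measurable_EFinP.
  apply: (@le_lt_trans _ _ (\int[P1]_x (g1 x * Ex P2 g2)%:E)%E); last first.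
    rewrite EFin_Ex ?ltry//.
    apply: (@eq_intgr _ _ _ P1 _ _ (fun x => mulrC (Ex P2 g2) (g1 x))).
    exact: intgrZ.
  apply: ge0_le_integral => //.
  - by move=> x _; apply: integral_ge0 => y _; rewrite abse_ge0.
  - apply: (@measurable_fun_fubini_tonelli_F _ _ _ _ _ P2 (fun z => `|(f z.1 z.2)%:E|%E)).
      by apply: measurableT_comp => //; exact/measurable_EFinP.
    by move=> z; exact: abse_ge0.
  - apply/measurable_EFinP; apply: measurable_funM; first exact: intgr_meas ig1.
    exact: measurable_cst.
  - move=> x _; rewrite /=.
    rewrite EFin_Ex; last exact: intgr_norm.
    rewrite lee_fin -ExZ//; apply: le_Ex => //; [exact: intgr_norm|exact: intgrZ].
split=> //; split.
  rewrite /Ex /Rintegral -(integral12_prod_meas1 ip) /fubini_F /=; congr fine.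
  by apply: eq_integral => x _; rewrite -[RHS]EFin_Ex.
have := Fubini ip.
rewrite /Ex {1 3}/Rintegral => h.
transitivity (fine (\int[P1]_x \int[P2]_y (f x y)%:E))%E.
  by congr fine; apply: eq_integral => x _; rewrite -[LHS]EFin_Ex.
rewrite /= in h; rewrite h.
by congr fine; apply: eq_integral => y _; rewrite -[RHS]EFin_Ex.
Qed.

End RealFubini.

Section NormalMixture.
Context (R : realType) d (T : measurableType d) (P : probability T R).
Variable N : T -> R.
Hypothesis hN : std_normal P N.

(* [exp(-s N^2)] is the average of [cos(sqrt(2s) xi N)] over an independent
   standard normal [xi], realized here as a copy of [N] on a product space. *)
Lemma Ex_laplace_cos (V : T -> R) (K s : R) : measurable_fun setT V ->
  (forall w, `|V w| <= K) -> 0 <= s ->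
  Ex P (fun w => V w * expR (- (s * N w ^+ 2))) =
  Ex P (fun v => Ex P (fun w => V w * cos (Num.sqrt (2 * s) * N v * N w))).
Proof.
move=> mV VK s0; have [mN _] := hN.
set r := Num.sqrt (2 * s).
have r2 : r ^+ 2 = 2 * s by rewrite sqr_sqrtr// mulr_ge0.
have E w : V w * expR (- (s * N w ^+ 2)) =
    Ex P (fun v => V w * cos (r * N w * N v)).
  rewrite ExZ; last first.
    apply: (@intgr_bounded _ _ _ _ 1); first by solve_measurable.
    by move=> v; rewrite ler_norml cos_geN1 cos_le1.
  rewrite std_normal_cos// /gauss; congr (_ * expR _).
  by rewrite exprMn r2; field.
rewrite (@eq_Ex _ _ _ P _ _ E).
have H1 : measurable_fun setT (fun z : T * T => V z.1 * cos (r * N z.1 * N z.2)).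
  apply: measurable_funM; first exact: measurableT_comp measurable_fst.
  apply: measurable_cos_comp; apply: measurable_funM; last exact: measurableT_comp measurable_snd.
  by apply: measurable_funM; [exact: measurable_cst|exact: measurableT_comp measurable_fst].
have H2 w v : `|V w * cos (r * N w * N v)| <= `|V w| * 1.
  by rewrite normrM ler_wpM2l// ler_norml cos_geN1 cos_le1.
have H3 : intgr P (fun w => `|V w|).
  by apply: intgr_norm; apply: (@intgr_bounded _ _ _ P K).
have [_ [_ ->]] := Ex_Fubini_dom (f := fun w v => V w * cos (r * N w * N v)) H1 H2
  (fun w => normr_ge0 _) (fun=> ler01) H3 (intgr_cst P 1).
by apply: eq_Ex => v; apply: eq_Ex => w; congr (_ * cos _); ring.
Qed.

(** By [Ex_laplace_cos] the weighted cosine transform fixes the weighted Laplace transform of [N^2].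
    The cosine cannot see the sign of [N], and neither can [N^2]. *)
Lemma wlaw_cos_unique (V : T -> R) (K c : R) : measurable_fun setT V ->
  (forall w, `|V w| <= K) ->
  (forall t, Ex P (fun w => V w * cos (t * N w)) = c * gauss t) ->
  forall B, measurable B ->
  wlaw P V (fun w => N w ^+ 2) B = wlaw P (fun=> c) (fun w => N w ^+ 2) B.
Proof.
move=> mV VK Vc; have [mN _] := hN.
apply: laplace_unique.
- exact: (@intgr_bounded _ _ _ P K).
- by solve_measurable.
- by move=> w; rewrite sqr_ge0.
- exact: intgr_cst.
- by solve_measurable.
- by move=> w; rewrite sqr_ge0.
- move=> n; rewrite (Ex_laplace_cos mV VK (ler0n _ n)).
  have mc : measurable_fun setT (fun _ : T => c) by exact: measurable_cst.
  rewrite (Ex_laplace_cos mc (fun _ => lexx `|c|) (ler0n _ n)).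
  apply: eq_Ex => v; rewrite Vc ExZ ?std_normal_cos//.
  apply: (@intgr_bounded _ _ _ _ 1); first by solve_measurable.
  by move=> w; rewrite ler_norml cos_geN1 cos_le1.
Qed.

End NormalMixture.

Section GaussianFamily.
Context (R : realType) d (T : measurableType d) (P : probability T R).
Variables (N : nat -> T -> R) (s : pred nat).

(* Only the indices in [s] carry a standard normal variable: the families of
   the theorem are orthonormal on the support of the coefficients only. *)
Definition supported (a : nat -> R) : Prop := forall i, ~~ s i -> a i = 0.

(** The last clause encodes joint normality and independence at once: the real part of the
    characteristic function factorizes over the coordinates. *)
Definition gaussian_family : Prop :=
  [/\ forall i, measurable_fun setT (N i), forall i, s i -> std_normal P (N i) &
    forall m a, supported a ->
      Ex P (fun w => cos (\sum_(i < m) a i * N i w)) =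
      expR (- (\sum_(i < m) a i ^+ 2) / 2)].

Hypothesis hN : gaussian_family.

Definition lincomb (b : nat -> R) m (w : T) : R := \sum_(i < m) b i * N i w.

(** Independence of [U] from the variables of index at least [j], tested on cosines of linear
    combinations. This form is inductive: once [N_j^2] has been absorbed into [U], the same
    statement holds with [j + 1]. *)
Definition indep_future (j : nat) (U : T -> R) : Prop :=
  forall A, measurable A -> forall m b, (j < m)%N -> supported b ->
    (forall i, (i < j)%N -> b i = 0) ->
  Ex P (fun w => \1_A (U w) * cos (lincomb b m w)) =
  Ex P (fun w => \1_A (U w)) * expR (- (\sum_(i < m) b i ^+ 2) / 2).

Lemma measurable_lincomb b m : measurable_fun setT (lincomb b m).
Proof.
have [mN _ _] := hN; apply: measurable_sum => i.
by apply: measurable_funM; [exact: measurable_cst|exact: mN].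
Qed.

Lemma indep_futureS j U : indep_future j U -> indep_future j.+1 U.
Proof.
move=> h A mA m b jm sb b0; apply: h => //; first exact: ltnW.
by move=> i ij; apply: b0; exact: ltnW.
Qed.

Lemma indep_future_cst (r : R) : indep_future 0 (fun=> r).
Proof.
move=> A mA m b _ sb _; rewrite Ex_cst.
have [_ _ hc] := hN; rewrite -(hc m b sb) -ExZ//.
apply: (@intgr_bounded _ _ _ _ 1).
  by apply: measurable_cos_comp; exact: measurable_lincomb.
by move=> w; rewrite ler_norml cos_geN1 cos_le1.
Qed.

Section Step.
Variables (j : nat) (U : T -> R).
Hypotheses (sj : s j) (mU : measurable_fun setT U) (iU : indep_future j U).

Let mN : measurable_fun setT (N j). Proof. by have [mN _ _] := hN; exact: mN. Qed.

Let m2 : measurable_fun setT (fun w => N j w ^+ 2).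
Proof. exact: measurable_funX. Qed.

Let nN : std_normal P (N j). Proof. by have [_ nN _] := hN; exact: nN. Qed.

Let mV A b m : measurable A ->
  measurable_fun setT (fun w => \1_A (U w) * cos (lincomb b m w)).
Proof.
move=> mA; apply: measurable_funM; first exact: measurable_indic_comp.
by apply: measurable_cos_comp; exact: measurable_lincomb.
Qed.

Let V1 A b m w : `|\1_A (U w) * cos (lincomb b m w)| <= 1.
Proof. by rewrite normrM mulr_ile1 ?norm_indic_le1// ler_norml cos_geN1 cos_le1. Qed.

Let cos_step A b m t : measurable A -> (j < m)%N -> supported b ->
  (forall i, (i <= j)%N -> b i = 0) ->
  Ex P (fun w => \1_A (U w) * cos (lincomb b m w) * cos (t * N j w)) =
  Ex P (fun w => \1_A (U w)) * expR (- (\sum_(i < m) b i ^+ 2) / 2) * gauss t.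
Proof.
move=> mA jm sb b0.
have sp (u : R) : supported (fun i => b i + u * (i == j)%:R).
  move=> i si; rewrite sb// (_ : i == j = false) ?mulr0 ?addr0//.
  by apply/negbTE/eqP => ij; rewrite ij sj in si.
have sum1 (f : nat -> R) : \sum_(i < m) (i == j :> nat)%:R * f i = f j.
  rewrite (bigD1 (Ordinal jm))//= eqxx mul1r big1 ?addr0// => i ij.
  by rewrite (_ : (i == j :> nat) = false) ?mul0r//; apply/negbTE.
have lin u w : lincomb (fun i => b i + u * (i == j)%:R) m w = lincomb b m w + u * N j w.
  rewrite /lincomb -(sum1 (fun i => N i w)) mulr_sumr -big_split/=.
  by apply: eq_bigr => i _; ring.
have sq u : \sum_(i < m) (b i + u * (i == j :> nat)%:R) ^+ 2 = \sum_(i < m) b i ^+ 2 + u ^+ 2.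
  rewrite -[in RHS](sum1 (fun=> u ^+ 2)) -big_split/=; apply: eq_bigr => i _.
  have [->|_] := eqVneq (i : nat) j; last by rewrite mulr0 addr0 mul0r addr0.
  by rewrite b0// mulr1 mul1r !add0r expr0n add0r.
have hp u := @iU A mA m _ jm (sp u) _.
have {}hp u : Ex P (fun w => \1_A (U w) * cos (lincomb b m w + u * N j w)) =
    Ex P (fun w => \1_A (U w)) * (expR (- (\sum_(i < m) b i ^+ 2) / 2) * gauss u).
  rewrite -(@eq_Ex _ _ _ P _ _ (fun w => congr1 (fun z => \1_A (U w) * cos z) (lin u w))).
  rewrite hp ?sq; last by move=> v i ij; rewrite b0 ?(ltnW ij)// ltn_eqF// mulr0 addr0.
  by rewrite /gauss -expRD; congr (_ * expR _); field.
(* Product-to-sum formula: both cosines on the right are cosines of supported combinations starting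
   at [j], to which the independence of [U] applies. *)
have E w : \1_A (U w) * cos (lincomb b m w) * cos (t * N j w) =
    2^-1 * (\1_A (U w) * cos (lincomb b m w + t * N j w) +
            \1_A (U w) * cos (lincomb b m w + (- t) * N j w)).
  by rewrite mulNr cosB cosD; field.
rewrite (@eq_Ex _ _ _ P _ _ E).
have ib u : intgr P (fun w => \1_A (U w) * cos (lincomb b m w + u * N j w)).
  apply: (@intgr_bounded _ _ _ _ 1).
    apply: measurable_funM; first exact: measurable_indic_comp.
    apply: measurable_cos_comp; apply: measurable_funD; first exact: measurable_lincomb.
    by apply: measurable_funM => //; exact: measurable_cst.
  by move=> w; rewrite normrM mulr_ile1 ?norm_indic_le1// ler_norml cos_geN1 cos_le1.
rewrite ExZ; last exact: intgrD.
rewrite ExD// !hp.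
have -> : gauss (- t) = gauss t by rewrite /gauss sqrrN.
by field.
Qed.

(** With the weight [\1_A U] times the cosine of the future, [cos_step] is exactly the hypothesis of
    [wlaw_cos_unique]. *)
Let rect_step A B b m : measurable A -> measurable B -> (j < m)%N -> supported b ->
  (forall i, (i <= j)%N -> b i = 0) ->
  Ex P (fun w => \1_A (U w) * cos (lincomb b m w) * \1_B (N j w ^+ 2)) =
  Ex P (fun w => \1_A (U w)) * expR (- (\sum_(i < m) b i ^+ 2) / 2) *
  Ex P (fun w => \1_B (N j w ^+ 2)).
Proof.
move=> mA mB jm sb b0.
have := wlaw_cos_unique nN (mV b m mA) (V1 A b m)
  (fun t => cos_step t mA jm sb b0) mB.
rewrite /wlaw => ->; rewrite ExZ//.
apply: (@intgr_bounded _ _ _ _ 1); first exact: measurable_indic_comp.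
by move=> w; exact: norm_indic_le1.
Qed.

Let mUN : measurable_fun setT (fun w => (U w, N j w ^+ 2)).
Proof. exact: measurable_fun_pair. Qed.

Let rects := [set A `*` B | A in @measurable _ R & B in @measurable _ R].

Let rectsI : setI_closed rects.
Proof.
move=> _ _ [A mA [B mB <-]] [A' mA' [B' mB' <-]].
exists (A `&` A'); first exact: measurableI.
by exists (B `&` B'); [exact: measurableI|rewrite setXI].
Qed.

Let indicX (A B : set R) (x y : R) : \1_(A `*` B) (x, y) = \1_A x * \1_B y :> R.
Proof.
rewrite !indicE -natrM mulnb; congr (nat_of_bool _)%:R.
by apply/idP/andP; rewrite !inE.
Qed.

Let indep_rect A B : measurable A -> measurable B ->
  Ex P (fun w => \1_A (U w) * \1_B (N j w ^+ 2)) =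
  Ex P (fun w => \1_A (U w)) * Ex P (fun w => \1_B (N j w ^+ 2)).
Proof.
move=> mA mB.
have := @rect_step A B (fun=> 0) j.+1 mA mB (ltnSn j) (fun _ _ => erefl) (fun _ _ => erefl).
have l0 w : lincomb (fun=> 0) j.+1 w = 0 by rewrite /lincomb big1// => i _; rewrite mul0r.
rewrite (@eq_Ex _ _ _ P _ (fun w => \1_A (U w) * \1_B (N j w ^+ 2))); last first.
  by move=> w; rewrite l0 cos0 mulr1.
move=> ->; rewrite (_ : \sum_(i < j.+1) _ = 0); last by rewrite big1// => i _; rewrite expr0n.
by rewrite oppr0 mul0r expR0 mulr1.
Qed.

(** Rectangles generate the product sigma-algebra, so [rect_step] extends to every event of the pair
    [(U, N_j^2)], here weighted by the cosine of the future. *)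
Lemma indep_future_step (u : R * R -> R) : measurable_fun setT u ->
  indep_future j.+1 (fun w => u (U w, N j w ^+ 2)).
Proof.
move=> mu A mA m b jm sb b0.
have mcos : measurable_fun setT (fun w => cos (lincomb b m w)).
  by apply: measurable_cos_comp; exact: measurable_lincomb.
have icos : intgr P (fun w => cos (lincomb b m w)).
  by apply: (@intgr_bounded _ _ _ _ 1) => // w; rewrite ler_norml cos_geN1 cos_le1.
set c := expR (- (\sum_(i < m) b i ^+ 2) / 2).
have ec : Ex P (fun w => cos (lincomb b m w)) = Ex P (fun _ : T => c).
  by rewrite Ex_cst; have [_ _ hc] := hN; exact: hc.
have jm' := ltnW jm.
have W : wlaw P (fun w => cos (lincomb b m w)) (fun w => (U w, N j w ^+ 2)) (u @^-1` A) =
    wlaw P (fun=> c) (fun w => (U w, N j w ^+ 2)) (u @^-1` A).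
  apply: (wlaw_unique icos mUN (intgr_cst P c) mUN (G := rects)) => //.
  - exact: measurable_prod_measurableType.
  - move=> _ [A' mA' [B' mB' <-]]; rewrite /wlaw.
    rewrite (@eq_Ex _ _ _ P _ (fun w => \1_A' (U w) * cos (lincomb b m w) * \1_B' (N j w ^+ 2))); last first.
      by move=> w; rewrite indicX; ring.
    rewrite rect_step// [RHS](@eq_Ex _ _ _ P _ (fun w => c * (\1_A' (U w) * \1_B' (N j w ^+ 2)))); last first.
      by move=> w; rewrite indicX.
    rewrite ExZ ?indep_rect//; first by rewrite /c; ring.
    apply: (@intgr_bounded _ _ _ _ 1).
      by apply: measurable_funM; exact: measurable_indic_comp.
    by move=> w; rewrite normrM mulr_ile1 ?norm_indic_le1.
  - by rewrite -[_ @^-1` _]setTI; exact: mu.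
rewrite (@eq_Ex _ _ _ P _ (fun w => cos (lincomb b m w) * \1_(u @^-1` A) (U w, N j w ^+ 2))); last first.
  by move=> w; rewrite mulrC !indicE.
move: W; rewrite /wlaw => ->; rewrite ExZ 1?mulrC//.
apply: (@intgr_bounded _ _ _ _ 1); last by move=> w; exact: norm_indic_le1.
apply: (measurable_indic_comp mUN); by rewrite -[_ @^-1` _]setTI; exact: mu.
Qed.

(** Factorization on rectangles identifies the law of [(U, N_j^2)] with that of two independent
    copies on the product space, where Fubini computes the expectation. *)
Lemma indep_Ex (f g : R -> R) : measurable_fun setT f -> measurable_fun setT g ->
  intgr P (fun w => f (U w)) -> intgr P (fun w => g (N j w ^+ 2)) ->
  intgr P (fun w => f (U w) * g (N j w ^+ 2)) /\
  Ex P (fun w => f (U w) * g (N j w ^+ 2)) =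
  Ex P (fun w => f (U w)) * Ex P (fun w => g (N j w ^+ 2)).
Proof.
move=> mf mg iF iG.
pose Y (z : T * T) := (U z.1, N j z.2 ^+ 2).
have mY : measurable_fun setT Y.
  apply: measurable_fun_pair; first exact: measurableT_comp measurable_fst.
  exact: (measurableT_comp m2 measurable_snd).
have icst : intgr (P \x P)%E (fun _ : T * T => (1 : R)) by exact: intgr_cst.
have prodE (F G : T -> R) : measurable_fun setT F -> measurable_fun setT G ->
    intgr P F -> intgr P G ->
    intgr (P \x P)%E (fun z => F z.1 * G z.2) /\
    Ex (P \x P)%E (fun z => F z.1 * G z.2) = Ex P F * Ex P G.
  move=> mF mG hF hG.
  have H1 : measurable_fun setT (fun z : T * T => F z.1 * G z.2).
    by apply: measurable_funM; [exact: measurableT_comp measurable_fst|exact: measurableT_comp measurable_snd].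
  have H2 x y : `|F x * G y| <= `|F x| * `|G y| by rewrite normrM.
  have [i [-> _]] := Ex_Fubini_dom (f := fun x y => F x * G y) H1 H2
     (fun=> normr_ge0 _) (fun=> normr_ge0 _) (intgr_norm hF) (intgr_norm hG).
  split=> //.
  rewrite (@eq_Ex _ _ _ P _ (fun x => Ex P G * F x)); last by move=> x; rewrite ExZ// mulrC.
  by rewrite ExZ// mulrC.
have W C : measurable C -> wlaw (P \x P)%E (fun=> 1) Y C =
    wlaw P (fun=> 1) (fun w => (U w, N j w ^+ 2)) C.
  apply: (wlaw_unique icst mY (intgr_cst P 1) mUN (G := rects)) => //.
  - exact: measurable_prod_measurableType.
  - by rewrite !Ex_cst.
  - move=> _ [A' mA' [B' mB' <-]]; rewrite /wlaw.
    have mi1 : measurable_fun setT (fun w => \1_A' (U w) : R) by exact: measurable_indic_comp.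
    have mi2 : measurable_fun setT (fun w => \1_B' (N j w ^+ 2) : R) by exact: measurable_indic_comp.
    have b1 : intgr P (fun w => \1_A' (U w)).
      by apply: (@intgr_bounded _ _ _ _ 1) => // w; exact: norm_indic_le1.
    have b2 : intgr P (fun w => \1_B' (N j w ^+ 2)).
      by apply: (@intgr_bounded _ _ _ _ 1) => // w; exact: norm_indic_le1.
    have [_] := prodE _ _ mi1 mi2 b1 b2.
    rewrite -indep_rect// => h.
    transitivity (Ex (P \x P)%E (fun z => \1_A' (U z.1) * \1_B' (N j z.2 ^+ 2))).
      by apply: eq_Ex => z; rewrite /Y indicX mul1r.
    by rewrite h; apply: eq_Ex => w; rewrite indicX mul1r.
have mfU : measurable_fun setT (fun w => f (U w)) by exact: intgr_meas iF.
have mgN : measurable_fun setT (fun w => g (N j w ^+ 2)) by exact: intgr_meas iG.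
have [ip ep] := prodE _ _ mfU mgN iF iG.
pose fg (z : R * R) := f z.1 * g z.2.
have mfg : measurable_fun setT fg.
  by apply: measurable_funM; [exact: measurableT_comp measurable_fst|exact: measurableT_comp measurable_snd].
have ip' : intgr (P \x P)%E (fun z => 1 * fg (Y z)).
  by apply: (@eq_intgr _ _ _ _ _ _ (fun z => esym (mul1r _)) ip).
have p1 (x : T * T) : 0 <= (1 : R) by [].
have p2 (x : T) : 0 <= (1 : R) by [].
split.
  have := wlaw_intgr icst mY p1 (intgr_cst P 1) mUN p2 W mfg ip'.
  by apply: eq_intgr => w; rewrite mul1r.
rewrite -ep; have := wlaw_Ex icst mY p1 (intgr_cst P 1) mUN p2 W mfg ip'.
rewrite (@eq_Ex _ _ _ _ _ (fun z => f (U z.1) * g (N j z.2 ^+ 2))); last by move=> z; rewrite mul1r.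
by move=> ->; apply: eq_Ex => w; rewrite mul1r.
Qed.

End Step.
End GaussianFamily.

(** * Expectations of finite linear combinations *)

Section LinearCombinations.
Context (R : realType) d (T : measurableType d) (mu : {measure set T -> \bar R}).

Fixpoint all_intgr (s : seq (R * (T -> R))) : Prop :=
  if s is q :: s' then intgr mu q.2 /\ all_intgr s' else True.

Lemma Ex_comb s (f : T -> R) : all_intgr s ->
  (forall w, f w = \sum_(q <- s) q.1 * q.2 w) ->
  intgr mu f /\ Ex mu f = \sum_(q <- s) q.1 * Ex mu q.2.
Proof.
elim: s f => [|q s IH] f hs fE.
  have fE' w : 0 = f w by rewrite fE big_nil.
  split; first exact: (@eq_intgr _ _ _ _ _ _ fE' (intgr0 mu)).
  by rewrite big_nil -(@eq_Ex _ _ _ mu _ _ fE') Ex0.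
have [hq hs'] := hs.
have [i e] := IH (fun w => \sum_(q <- s) q.1 * q.2 w) hs' (fun=> erefl).
have fE' w : q.1 * q.2 w + \sum_(q <- s) q.1 * q.2 w = f w by rewrite fE big_cons.
split; first by apply: (@eq_intgr _ _ _ _ _ _ fE'); apply: intgrD => //; exact: intgrZ.
rewrite -(@eq_Ex _ _ _ mu _ _ fE') ExD//; last exact: intgrZ.
by rewrite big_cons e ExZ.
Qed.

End LinearCombinations.

(** * Finite sums of centered chi-square variables *)

Section PartialSums.
Context (R : realType) d (T : measurableType d) (P : probability T R).
Variables (N : nat -> T -> R) (s : pred nat).
Hypothesis hN : gaussian_family P N s.

Definition psum (a : nat -> R) m (w : T) : R := \sum_(i < m) a i * chi (N i) w.

Lemma psumS a m w : psum a m.+1 w = psum a m w + a m * chi (N m) w.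
Proof. by rewrite /psum big_ord_recr. Qed.

Lemma psum0 a w : psum a 0 w = 0.
Proof. by rewrite /psum big_ord0. Qed.

Lemma measurable_chi i : measurable_fun setT (chi (N i)).
Proof.
have [mN _ _] := hN; rewrite /chi; apply: measurable_funB; last exact: measurable_cst.
exact/measurable_funX/mN.
Qed.

Lemma measurable_psum a m : measurable_fun setT (psum a m).
Proof.
apply: measurable_sum => i; apply: measurable_funM; first exact: measurable_cst.
exact: measurable_chi.
Qed.

(** An index of [s] is absorbed by [indep_future_step]; outside [s] the coefficient vanishes and the
    sum does not change. *)
Lemma indep_future_psum a m j : supported s a -> (m <= j)%N ->
  indep_future P N s j (psum a m).
Proof.
move=> sa; elim: m j => [|m IH] j mj.
  have h0 : indep_future P N s j (fun=> 0).
    elim: j {mj} => [|j IHj]; [exact: indep_future_cst|exact: indep_futureS].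
  by rewrite (_ : psum a 0 = fun=> 0)//; apply/funext => w; exact: psum0.
suff h : indep_future P N s m.+1 (psum a m.+1).
  elim: j mj => // j IHj; rewrite leq_eqVlt => /predU1P[<-//|mj].
  exact/indep_futureS/IHj.
have [sm|sm] := boolP (s m); last first.
  rewrite (_ : psum a m.+1 = psum a m); first by apply: IH.
  by apply/funext => w; rewrite psumS sa// mul0r addr0.
rewrite (_ : psum a m.+1 = fun w => (fun z : R * R => z.1 + a m * (z.2 - 1)) (psum a m w, N m w ^+ 2)).
  apply: (@indep_future_step _ _ _ P N s hN m (psum a m) sm (measurable_psum a m) (IH m (leqnn m))
    (fun z : R * R => z.1 + a m * (z.2 - 1))).
  apply: measurable_funD; first exact: measurable_fst.
  apply: measurable_funM; first exact: measurable_cst.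
  by apply: measurable_funB; [exact: measurable_snd|exact: measurable_cst].
by apply/funext => w; rewrite psumS.
Qed.

Lemma indep_psum_chi a m j (f g : R -> R) : supported s a -> (m <= j)%N -> s j ->
  measurable_fun setT f -> measurable_fun setT g ->
  intgr P (fun w => f (psum a m w)) -> intgr P (fun w => g (chi (N j) w)) ->
  intgr P (fun w => f (psum a m w) * g (chi (N j) w)) /\
  Ex P (fun w => f (psum a m w) * g (chi (N j) w)) =
  Ex P (fun w => f (psum a m w)) * Ex P (fun w => g (chi (N j) w)).
Proof.
move=> sa mj sj mf mg i1 i2.
apply: (@indep_Ex _ _ _ P N s hN j (psum a m) sj (measurable_psum a m)
  (indep_future_psum sa mj) f (fun z => g (z - 1))) => //.
apply: (measurableT_comp mg); apply: measurable_funB; [exact: measurable_id|exact: measurable_cst].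
Qed.

(** Cumulants of independent summands add: [2 sum a^2], [8 sum a^3] and [48 sum a^4]. The square in
    the fourth moment is three times the squared variance. *)
Lemma psum_moments a m : supported s a ->
  [/\ forall k, (k <= 4)%N -> intgr P (fun w => psum a m w ^+ k), Ex P (psum a m) = 0,
      Ex P (fun w => psum a m w ^+ 2) = 2 * \sum_(i < m) a i ^+ 2,
      Ex P (fun w => psum a m w ^+ 3) = 8 * \sum_(i < m) a i ^+ 3 &
      Ex P (fun w => psum a m w ^+ 4) =
        48 * \sum_(i < m) a i ^+ 4 + 12 * (\sum_(i < m) a i ^+ 2) ^+ 2].
Proof.
move=> sa; elim: m => [|m [i1 e1 e2 e3 e4]].
  have E k w : psum a 0 w ^+ k = 0 ^+ k by rewrite psum0.
  have E0 k : Ex P (fun w => psum a 0 w ^+ k) = 0 ^+ k.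
    by rewrite (@eq_Ex _ _ _ P _ _ (E k)) Ex_cst.
  split.
  - by move=> k _; apply: (@eq_intgr _ _ _ P _ _ (fun w => esym (E k w))); exact: intgr_cst.
  - by have := E0 1%N; rewrite expr0n.
  - by rewrite E0 big_ord0 mulr0 expr0n.
  - by rewrite E0 big_ord0 mulr0 expr0n.
  - by rewrite E0 !big_ord0 !expr0n/= !mulr0 addr0.
have [sm|sm] := boolP (s m); last first.
  have E : psum a m.+1 = psum a m.
    by apply/funext => w; rewrite psumS sa// mul0r addr0.
  by rewrite E !big_ord_recr/= sa// !expr0n/= !addr0.
have [_ nN _] := hN.
have [j1 f1 f2 f3 f4] := chi_moments (nN m sm).
set X := chi (N m) in j1 f1 f2 f3 f4; set S := psum a m in i1 e1 e2 e3 e4.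
have cross p q : (p <= 4)%N -> (q <= 4)%N ->
    intgr P (fun w => S w ^+ p * X w ^+ q) /\
    Ex P (fun w => S w ^+ p * X w ^+ q) = Ex P (fun w => S w ^+ p) * Ex P (fun w => X w ^+ q).
  move=> p4 q4; apply: (@indep_psum_chi a m m (fun x => x ^+ p) (fun x => x ^+ q)) => //.
  - exact: i1.
  - exact: j1.
have z0 : Ex P (fun w => S w ^+ 0) = 1 by exact: Ex_cst.
have z1 : Ex P (fun w => S w ^+ 1) = 0 by exact: e1.
have y0 : Ex P (fun w => X w ^+ 0) = 1 by exact: Ex_cst.
have y1 : Ex P (fun w => X w ^+ 1) = 0 by exact: f1.
pose u p q : T -> R := fun w => S w ^+ p * X w ^+ q.
have ui p q : (p <= 4)%N -> (q <= 4)%N -> intgr P (u p q) by move=> p4 q4; have [] := cross p q p4 q4.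
have ue p q : (p <= 4)%N -> (q <= 4)%N -> Ex P (u p q) =
   Ex P (fun w => S w ^+ p) * Ex P (fun w => X w ^+ q) by move=> p4 q4; have [] := cross p q p4 q4.
set b := a m.
have [k1 l1] := @Ex_comb _ _ _ P [:: (1, u 1%N 0%N); (b, u 0%N 1%N)]
  (psum a m.+1)
  (conj (ui 1%N 0%N isT isT) (conj (ui 0%N 1%N isT isT) I))
  (fun w => ltac:(rewrite /u /S /X /b !big_cons big_nil /= psumS; ring)).
have [k2 l2] := @Ex_comb _ _ _ P [:: (1, u 2%N 0%N); (2 * b, u 1%N 1%N); (b ^+ 2, u 0%N 2%N)]
  (fun w => psum a m.+1 w ^+ 2)
  (conj (ui 2%N 0%N isT isT) (conj (ui 1%N 1%N isT isT) (conj (ui 0%N 2%N isT isT) I)))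
  (fun w => ltac:(rewrite /u /S /X /b !big_cons big_nil /= psumS; ring)).
have [k3 l3] := @Ex_comb _ _ _ P [:: (1, u 3%N 0%N); (3 * b, u 2%N 1%N); (3 * b ^+ 2, u 1%N 2%N); (b ^+ 3, u 0%N 3%N)]
  (fun w => psum a m.+1 w ^+ 3)
  (conj (ui 3%N 0%N isT isT) (conj (ui 2%N 1%N isT isT) (conj (ui 1%N 2%N isT isT) (conj (ui 0%N 3%N isT isT) I))))
  (fun w => ltac:(rewrite /u /S /X /b !big_cons big_nil /= psumS; ring)).
have [k4 l4] := @Ex_comb _ _ _ P [:: (1, u 4%N 0%N); (4 * b, u 3%N 1%N); (6 * b ^+ 2, u 2%N 2%N); (4 * b ^+ 3, u 1%N 3%N); (b ^+ 4, u 0%N 4%N)]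
  (fun w => psum a m.+1 w ^+ 4)
  (conj (ui 4%N 0%N isT isT) (conj (ui 3%N 1%N isT isT) (conj (ui 2%N 2%N isT isT) (conj (ui 1%N 3%N isT isT) (conj (ui 0%N 4%N isT isT) I)))))
  (fun w => ltac:(rewrite /u /S /X /b !big_cons big_nil /= psumS; ring)).
split.
- case=> [_|]; first exact: intgr_cst.
  case=> [_|]; first exact: k1.
  case=> [_|]; first exact: k2.
  case=> [_|]; first exact: k3.
  case=> [_|//]; exact: k4.
- by rewrite l1 !big_cons big_nil /= !ue// ?z0 ?z1 ?y0 ?y1; ring.
- by rewrite l2 !big_cons big_nil /= !ue// ?z0 ?z1 ?y0 ?y1 e2 f2 big_ord_recr /= -/b; ring.
- by rewrite l3 !big_cons big_nil /= !ue// ?z0 ?z1 ?y0 ?y1 e2 f2 e3 f3 big_ord_recr /= -/b; ring.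
- by rewrite l4 !big_cons big_nil /= !ue// ?z0 ?z1 ?y0 ?y1 e2 f2 e3 f3 e4 f4 !big_ord_recr /= -/b; ring.
Qed.

End PartialSums.

(** * The Gamma law as a halved chi-square law *)

Section GammaLaw.
Context (R : realType).
Local Notation leb := (@lebesgue_measure R).

(** Lebesgue measure equals [l] times its image under [x -> l x]; by uniqueness this has to be
    checked on intervals only. *)
Lemma ge0_integral_scale (l : R) (f : R -> \bar R) : 0 < l ->
  measurable_fun setT f -> (forall x, 0 <= f x)%E ->
  (\int[leb]_x f x = l%:E * \int[leb]_x f (l * x)%R)%E.
Proof.
move=> l0 mf f0.
pose h : measurableTypeR R -> measurableTypeR R := fun x : R => l * x.
have mh : measurable_fun setT h.
  by apply: measurable_funM; [exact: measurable_cst|exact: measurable_id].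
pose l' : {nonneg R} := NngNum (ltW l0).
pose m := mscale l' (pushforward leb h).
have mE A : measurable A -> leb A = m mh A.
  move=> mA; apply: lebesgue_measure_unique => // _ [[a b]] _ <-.
  have hE : h @^-1` `]a, b]%classic = `](a / l), (b / l)]%classic.
    rewrite predeqE => x; rewrite /h /= !in_itv /= ltr_pdivrMr// ler_pdivlMr//.
    by rewrite mulrC.
  transitivity (l%:E * leb (h @^-1` `]a, b]%classic))%E; last by [].
  rewrite hE.
  rewrite !lebesgue_measure_itv/= !lte_fin ltr_pM2r ?invr_gt0//.
  case: ifPn => ab; last by rewrite mule0.
  by rewrite -!EFinB -EFinM; congr EFin; field; rewrite gt_eqF.
rewrite (eq_measure_integral (m mh)); last by move=> A mA _; exact: mE.
rewrite ge0_integral_mscale//; congr (_ * _)%E.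
by rewrite ge0_integral_pushforward.
Qed.

Variable k : nat.
Hypothesis k0 : (0 < k)%N.
Let a : R := k%:R / 2.
Hypothesis pdf1 : (\int[leb]_x (gamma_pdf a x)%:E = 1)%E.

Lemma measurable_gamma_pdf : measurable_fun setT (gamma_pdf a : measurableTypeR R -> R).
Proof.
rewrite /gamma_pdf; apply: measurable_fun_ifT => /=.
- apply: measurable_fun_ltr; [exact: measurable_cst|exact: measurable_id].
- apply: measurable_funM; last exact: measurable_cst.
  apply: measurable_funM; first exact: measurable_powR.
  by apply: continuous_measurable_fun; solve_continuous.
- exact: measurable_cst.
Qed.

Lemma gamma_pdf_ge0 x : 0 <= gamma_pdf a x.
Proof.
rewrite /gamma_pdf; case: ifP => // x0.
rewrite !mulr_ge0 ?powR_ge0 ?expR_ge0// invr_ge0; apply: Rintegral_ge0 => y _.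
by rewrite mulr_ge0 ?powR_ge0 ?expR_ge0.
Qed.

Lemma intgr_gamma_pdf : intgr leb (gamma_pdf a).
Proof.
apply: ge0_intgr; [exact: measurable_gamma_pdf|exact: gamma_pdf_ge0|].
by rewrite pdf1 ltry.
Qed.

(** Change of variables [x -> (1 + t) x]. The absolute value changes nothing where the density is
    nonzero, and makes the variable nonnegative everywhere, as [laplace_unique] requires. *)
Lemma gamma_laplace (t : R) : 0 <= t ->
  Ex leb (fun x => gamma_pdf a x * expR (- (t * `|x|))) = (Num.sqrt (1 + t))^-1 ^+ k.
Proof.
move=> t0; have l0 : 0 < 1 + t by lra.
set l := 1 + t in l0 *.
have E x : gamma_pdf a x * expR (- (t * `|x|)) = l `^ (1 - a) * gamma_pdf a (l * x).
  rewrite /gamma_pdf pmulr_rgt0//; case: ifPn => x0; last by rewrite mulr0 mul0r.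
  rewrite (gtr0_norm x0) powRM ?ltW// !mulrA -powRD; last by rewrite (gt_eqF l0) implybT.
  rewrite (_ : 1 - a + (a - 1) = 0); last by ring.
  rewrite powRr0 mul1r mulrAC -(mulrA _ (expR _) (expR _)) -expRD.
  by congr (_ * expR _ / _); rewrite /l; ring.
have := @ge0_integral_scale l (fun x => (gamma_pdf a x)%:E) l0 _ _.
rewrite pdf1 => h.
have {}h : (1 = l%:E * \int[leb]_x (gamma_pdf a (l * x))%:E)%E.
  apply: h => [|x]; last by rewrite lee_fin gamma_pdf_ge0.
  by apply/measurable_EFinP; exact: measurable_gamma_pdf.
have mg : measurable_fun setT (fun x : measurableTypeR R => gamma_pdf a (l * x)).
  apply: (measurableT_comp measurable_gamma_pdf).
  by apply: measurable_funM; [exact: measurable_cst|exact: measurable_id].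
have i1 : intgr leb (fun x => gamma_pdf a (l * x)).
  apply: ge0_intgr => //; first by move=> x; exact: gamma_pdf_ge0.
  rewrite ltNge leye_eq; apply/negP => /eqP hy.
  by move: h; rewrite hy gt0_muley ?lte_fin.
rewrite (@eq_Ex _ _ _ leb _ _ E) ExZ//.
move: h; rewrite EFin_Ex// -EFinM => -[h].
have -> : Ex leb (fun x => gamma_pdf a (l * x)) = l^-1.
  by apply: (mulfI (x := l)); rewrite ?gt_eqF// mulfV ?gt_eqF// -h.
rewrite -powR_inv1 ?ltW// -powRD; last by rewrite (gt_eqF l0) implybT.
rewrite (_ : 1 - a + -1 = - (2^-1 * k%:R)); last by rewrite /a; field.
by rewrite powRN powRrM powR12_sqrt ?ltW// powR_mulrn ?sqrtr_ge0// exprVn.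
Qed.

Context d (T : measurableType d) (P : probability T R).
Variables (N : nat -> T -> R) (s : pred nat).
Hypothesis hN : gaussian_family P N s.
Hypothesis sk : forall i, (i < k)%N -> s i.

Definition head_ind (i : nat) : R := (i < k)%:R.

Lemma supported_head_ind : supported s head_ind.
Proof.
move=> i si; rewrite /head_ind; case ik : (i < k)%N => //; by rewrite sk in si.
Qed.

Lemma psum_head m w : (m <= k)%N -> psum N head_ind m w + m%:R = \sum_(i < m) N i w ^+ 2.
Proof.
elim: m => [|m IH] mk; first by rewrite psum0 big_ord0 addr0.
rewrite psumS big_ord_recr/= -(IH (ltnW mk)) /head_ind mk mul1r -natr1 /chi; ring.
Qed.

Lemma head_laplace (t : R) m : 0 <= t -> (m <= k)%N ->
  Ex P (fun w => expR (- (t * ((psum N head_ind m w + m%:R) / 2)))) =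
  (Num.sqrt (1 + t))^-1 ^+ m.
Proof.
move=> t0; elim: m => [|m IH] mk.
  rewrite (@eq_Ex _ _ _ P _ (fun=> 1)) ?Ex_cst//.
  by move=> w; rewrite psum0 addr0 mul0r mulr0 oppr0 expR0.
have sm : s m by exact: sk.
have [_ nN _] := hN.
have b1 (x : R) : 0 <= x -> `|expR (- (t * (x / 2)))| <= 1.
  move=> x0; rewrite ger0_norm ?expR_ge0// -expR0 ler_expR oppr_le0.
  by rewrite mulr_ge0// divr_ge0.
pose f (x : R) := expR (- (t * ((x + m%:R) / 2))).
pose g (z : R) := expR (- (t / 2 * (z + 1))).
have mf : measurable_fun setT f by rewrite /f; apply: continuous_measurable_fun; solve_continuous.
have mg : measurable_fun setT g by rewrite /g; apply: continuous_measurable_fun; solve_continuous.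
have i1 : intgr P (fun w => f (psum N head_ind m w)).
  apply: (@intgr_bounded _ _ _ _ 1); first exact/(measurableT_comp mf)/(measurable_psum hN).
  by move=> w; rewrite /f b1// psum_head 1?ltnW// sumr_ge0// => i _; rewrite sqr_ge0.
have gE w : g (chi (N m) w) = expR (- (t / 2 * N m w ^+ 2)).
  by rewrite /g /chi subrK.
have i2 : intgr P (fun w => g (chi (N m) w)).
  apply: (@intgr_bounded _ _ _ _ 1); first exact/(measurableT_comp mg)/(measurable_chi hN).
  by move=> w; rewrite gE -mulrA (mulrC 2^-1) b1// sqr_ge0.
have [_ e] := indep_psum_chi hN supported_head_ind (leqnn m) sm mf mg i1 i2.
rewrite (@eq_Ex _ _ _ P _ (fun w => f (psum N head_ind m w) * g (chi (N m) w))); last first.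
  by move=> w; rewrite /f /g -expRD psumS /head_ind mk mul1r -natr1; congr expR; field.
rewrite e IH 1?ltnW// (@eq_Ex _ _ _ P _ _ gE) std_normal_laplace ?divr_ge0//; last exact: nN.
by rewrite mulrC (_ : 2 * (t / 2) = t) ?exprS//; field.
Qed.

(** Half of a chi-square variable with [k] degrees of freedom has the Gamma law of parameter
    [k / 2]: both Laplace transforms equal [(1 + t)^(- k / 2)]. *)
Lemma gamma_law_psum (B : set R) : measurable B ->
  fine (gamma_law a B) = fine (P ((fun w => (psum N head_ind k w + k%:R) / 2) @^-1` B)).
Proof.
move=> mB.
have mZ : measurable_fun setT (fun w => (psum N head_ind k w + k%:R) / 2).
  apply: measurable_funM; last exact: measurable_cst.
  by apply: measurable_funD; [exact: (measurable_psum hN)|exact: measurable_cst].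
have mabs : measurable_fun setT (fun x : measurableTypeR R => `|x : R|).
  exact/measurableT_comp_normr/measurable_id.
rewrite -wlaw_prob//.
rewrite -(@laplace_unique _ _ _ leb _ _ P (gamma_pdf a) (fun x : R => `|x|) (fun=> 1)
  (fun w => (psum N head_ind k w + k%:R) / 2) intgr_gamma_pdf mabs (fun=> normr_ge0 _)
  (intgr_cst P 1) mZ)//.
- rewrite wlaw_density /gamma_law [in LHS]integral_mkcond [in RHS]integral_mkcond; congr fine.
  apply: eq_integral => x _; rewrite !patchE /=.
  have -> : (x \in (fun x0 : R => `|x0|) @^-1` B) = (`|x| \in B).
    by apply/idP/idP; rewrite !inE.
  have [x0|x0] := ltP 0 x; first by rewrite (gtr0_norm x0).
  by rewrite /gamma_pdf ltNge x0/=; case: ifP; case: ifP.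
- move=> w; rewrite divr_ge0// psum_head// sumr_ge0// => i _; exact: sqr_ge0.
- move=> n; rewrite gamma_laplace// -(head_laplace (ler0n _ n) (leqnn k)).
  by apply: eq_Ex => w; rewrite mul1r.
Qed.

End GammaLaw.

(** * Limits in mean square *)

Section L2Limits.
Context (R : realType) d (T : measurableType d) (P : probability T R).

(** Common pattern of passages to the limit: an arbitrarily small multiple of a fixed quantity plus
    a possibly huge multiple of a vanishing one. *)
Lemma cvg_of_eps_bound (a delta : nat -> R) (l K : R) :
  (forall e, 0 < e <= 1 -> exists C, forall n, `|a n - l| <= e * K + C * delta n) ->
  delta n @[n --> \oo] --> 0 -> a n @[n --> \oo] --> l.
Proof.
move=> h hd; apply/cvgrPdist_le => _ /posnumP[e].
pose K' := `|K| + 1; have K'0 : 0 < K' by rewrite ltr_wpDl.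
pose e' := Num.min 1 (e%:num / 2 / K').
have e'0 : 0 < e' by rewrite lt_min ltr01 !divr_gt0.
have e'1 : e' <= 1 by rewrite ge_min lexx.
have [C hC] := h e' ltac:(by rewrite e'0 e'1).
have e'K : e' * K <= e%:num / 2.
  apply: (@le_trans _ _ (e%:num / 2 / K' * K')); last by rewrite divfK// gt_eqF.
  apply: (@le_trans _ _ (e' * K')).
    apply: ler_wpM2l; first exact: ltW.
    by rewrite /K'; have := ler_norm K; lra.
  by apply: ler_wpM2r; [exact: ltW | rewrite /e' ge_min lexx orbT].
have hCd : C * delta n @[n --> \oo] --> 0.
  by rewrite -(mulr0 C); apply: cvgMr.
move/cvgrPdist_le : hCd => /(_ (e%:num / 2) _)[]// N _ hN.
exists N => // n Nn; rewrite distrC; apply: le_trans (hC n) _.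
have := hN n Nn; rewrite sub0r normrN => /(le_trans (ler_norm _)); lra.
Qed.

Definition L2lim (Y : nat -> T -> R) (Z : T -> R) : Prop :=
  [/\ forall k, measurable_fun setT (Y k), measurable_fun setT Z,
      forall k, intgr P (fun w => Y k w ^+ 2), intgr P (fun w => Z w ^+ 2) &
      Ex P (fun w => (Y k w - Z w) ^+ 2) @[k --> \oo] --> 0].

Lemma intgr_sqrD (f g : T -> R) : measurable_fun setT f -> measurable_fun setT g ->
  intgr P (fun w => f w ^+ 2) -> intgr P (fun w => g w ^+ 2) ->
  intgr P (fun w => (f w + g w) ^+ 2).
Proof.
move=> mf mg h1 h2.
apply: (@intgr_le _ _ _ P _ (fun w => 2 * f w ^+ 2 + 2 * g w ^+ 2)).
- by solve_measurable.
- by move=> w; rewrite ger0_norm ?sqr_ge0//; have := sqr_ge0 (f w - g w); lra.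
- by apply: intgrD; exact: intgrZ.
Qed.

Lemma intgr_sqrB (f g : T -> R) : measurable_fun setT f -> measurable_fun setT g ->
  intgr P (fun w => f w ^+ 2) -> intgr P (fun w => g w ^+ 2) ->
  intgr P (fun w => (f w - g w) ^+ 2).
Proof.
move=> mf mg h1 h2; apply: (intgr_sqrD mf (measurable_oppr_comp mg) h1).
by apply: (@eq_intgr _ _ _ P _ _ _ h2) => w; rewrite sqrrN.
Qed.

Lemma intgr_of_sqr (f : T -> R) : measurable_fun setT f ->
  intgr P (fun w => f w ^+ 2) -> intgr P f.
Proof.
move=> mf h; apply: (@intgr_le _ _ _ P _ (fun w => 1 + f w ^+ 2)) => //.
  by move=> w; rewrite ler_norml; have := sqr_ge0 (f w - 1); have := sqr_ge0 (f w + 1); have := sqr_ge0 (f w); nra.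
by apply: intgrD => //; exact: intgr_cst.
Qed.

(** Convergence of extended reals to [0] makes some mean square distance finite, hence [Z] square
    integrable. *)
Lemma L2_cvg_L2lim (Y : nat -> T -> R) (Z : T -> R) :
  (forall k, measurable_fun setT (Y k)) -> measurable_fun setT Z ->
  (forall k, intgr P (fun w => Y k w ^+ 2)) -> L2_cvg P Y Z -> L2lim Y Z.
Proof.
move=> mY mZ iY hL.
have mD k : measurable_fun setT (fun w => (Y k w - Z w) ^+ 2) by have mYk := mY k; solve_measurable.
have iZ : intgr P (fun w => Z w ^+ 2).
  have /fine_cvgP[[N _ hN] _] := hL.
  have i1 : intgr P (fun w => (Y N w - Z w) ^+ 2).
    apply: ge0_intgr => //; first by move=> w; exact: sqr_ge0.
    have := hN N (leqnn N); rewrite /= unlock ge0_fin_numE//.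
    by apply: integral_ge0 => w _; rewrite lee_fin sqr_ge0.
  apply: (@intgr_le _ _ _ P _ (fun w => 2 * (Y N w - Z w) ^+ 2 + 2 * Y N w ^+ 2)).
  - by apply: measurable_funX.
  - by move=> w; rewrite ger0_norm ?sqr_ge0//; have := sqr_ge0 (2 * Y N w - Z w); nra.
  - by apply: intgrD; exact: intgrZ.
split => //.
have iD k : intgr P (fun w => (Y k w - Z w) ^+ 2) by exact: intgr_sqrB.
move: hL; rewrite /L2_cvg.
rewrite (_ : (fun k => _) = (fun k => (Ex P (fun w => (Y k w - Z w) ^+ 2))%:E)).
  by move/fine_cvg.
by apply/funext => k; rewrite unlock EFin_Ex.
Qed.

Section Limit.
Variables (Y : nat -> T -> R) (Z : T -> R).
Hypothesis hL : L2lim Y Z.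

Let mY k : measurable_fun setT (Y k). Proof. by have [] := hL. Qed.
Let mZ : measurable_fun setT Z. Proof. by have [] := hL. Qed.
Let iY k : intgr P (fun w => Y k w ^+ 2). Proof. by have [] := hL. Qed.
Let iZ : intgr P (fun w => Z w ^+ 2). Proof. by have [] := hL. Qed.
Let iD k : intgr P (fun w => (Y k w - Z w) ^+ 2). Proof. exact: intgr_sqrB. Qed.
Let D0 : Ex P (fun w => (Y k w - Z w) ^+ 2) @[k --> \oo] --> 0.
Proof. by have [] := hL. Qed.

(** Trades a first-order error for a mean square one, in the shape that [cvg_of_eps_bound]
    expects. *)
Lemma normr_le_eps (e x : R) : 0 < e -> `|x| <= e + x ^+ 2 / e.
Proof.
move=> e0; have [h|h] := leP `|x| e.
  by apply: le_trans h _; rewrite lerDl divr_ge0 ?sqr_ge0 ?ltW.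
rewrite -(real_normK (num_real x)).
apply: (@le_trans _ _ (`|x| ^+ 2 / e)); last by rewrite lerDr ltW.
by rewrite ler_pdivlMr// expr2 ler_wpM2l// ltW.
Qed.

Lemma L2lim_lipschitz (f : R -> R) (K : R) : measurable_fun setT f ->
  (forall x y, `|f x - f y| <= K * `|x - y|) ->
  (forall k, intgr P (fun w => f (Y k w))) /\ intgr P (fun w => f (Z w)) /\
  Ex P (fun w => f (Y k w)) @[k --> \oo] --> Ex P (fun w => f (Z w)).
Proof.
move=> mf fK.
have K0 : 0 <= K by have := fK 1 0; rewrite subr0 normr1 mulr1; apply: le_trans.
have il (U : T -> R) : measurable_fun setT U -> intgr P (fun w => U w ^+ 2) ->
    intgr P (fun w => f (U w)).
  move=> mU iU; apply: (@intgr_le _ _ _ P _ (fun w => `|f 0| + K * `|U w|)).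
  - exact: measurableT_comp.
  - move=> w; have := fK (U w) 0; rewrite subr0.
    by have := ler_normD (f (U w) - f 0) (f 0); rewrite subrK; lra.
  - apply: intgrD; first exact: intgr_cst.
    by apply/intgrZ/intgr_norm; exact: intgr_of_sqr.
have iYf k := il _ (mY k) (iY k); have iZf := il _ mZ iZ.
split=> //; split=> //.
apply: (cvg_of_eps_bound (K := K)) D0 => e /andP[e0 e1]; exists (K / e) => n.
rewrite -ExB//.
have -> : e * K + K / e * Ex P (fun w => (Y n w - Z w) ^+ 2) =
    Ex P (fun w => e * K + K / e * (Y n w - Z w) ^+ 2).
  by rewrite ExD ?Ex_cst ?ExZ//; [exact: intgr_cst|exact: intgrZ].
apply: le_norm_Ex_le => [||w].
- exact: intgrB.
- by apply: intgrD; [exact: intgr_cst|exact: intgrZ].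
- apply: le_trans (fK _ _) _.
  have := ler_wpM2l K0 (normr_le_eps (Y n w - Z w) e0).
  by rewrite mulrDr (mulrC e) mulrA mulrAC.
Qed.

Lemma L2lim_sqr : Ex P (fun w => Y k w ^+ 2) @[k --> \oo] --> Ex P (fun w => Z w ^+ 2).
Proof.
apply: (cvg_of_eps_bound (K := Ex P (fun w => Z w ^+ 2))) D0 => e /andP[e0 e1].
exists (2 / e) => n; rewrite -ExB//.
have -> : e * Ex P (fun w => Z w ^+ 2) + 2 / e * Ex P (fun w => (Y n w - Z w) ^+ 2) =
    Ex P (fun w => e * Z w ^+ 2 + 2 / e * (Y n w - Z w) ^+ 2).
  by rewrite ExD ?ExZ//; exact: intgrZ.
apply: le_norm_Ex_le => [||w].
- exact: intgrB.
- by apply: intgrD; exact: intgrZ.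
- set x := Y n w; set z := Z w; set dd := x - z.
  have -> : x ^+ 2 - z ^+ 2 = dd ^+ 2 + 2 * (z * dd) by rewrite /dd; ring.
  have h1 : `|2 * (z * dd)| <= e * z ^+ 2 + dd ^+ 2 / e.
    have h : e * (e * z ^+ 2 + dd ^+ 2 / e) = (e * z) ^+ 2 + dd ^+ 2.
      by field; rewrite gt_eqF.
    rewrite -(ler_pM2l e0) h -{1}(ger0_norm (ltW e0)) -normrM ler_norml.
    have := sqr_ge0 (e * z - dd); have := sqr_ge0 (e * z + dd); nra.
  have h2 : dd ^+ 2 <= dd ^+ 2 / e.
    by rewrite ler_pdivlMr// ler_piMr// sqr_ge0.
  have := ler_normD (dd ^+ 2) (2 * (z * dd)).
  rewrite (ger0_norm (sqr_ge0 dd)) (mulrC 2 e^-1) -mulrA (mulrC e^-1) -mulrA (mulrC 2); lra.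
Qed.

Definition trunc4 (K : R) (x : R) : R := Num.min `|x| K ^+ 4.

Lemma trunc4_le (K x y : R) : 0 <= K -> trunc4 K x <= y ^+ 4 + 4 * K ^+ 3 * `|x - y|.
Proof.
move=> K0; rewrite /trunc4; set t := Num.min _ _.
have t0 : 0 <= t by rewrite le_min normr_ge0.
have tK : t <= K by rewrite ge_min lexx orbT.
have tx : t <= `|x| by rewrite ge_min lexx.
have -> : y ^+ 4 = `|y| ^+ 4.
  by rewrite -normrX ger0_norm// (exprM _ 2 2) sqr_ge0.
have y0 := normr_ge0 y.
have dxy : `|x| - `|y| <= `|x - y| by apply: lerB_dist.
have d0 := normr_ge0 (x - y).
set v := `|y| in y0 dxy *; set q := `|x - y| in dxy d0 *.
have [ty|yt] := leP t v.
  have : t ^+ 4 <= v ^+ 4 by rewrite lerXn2r.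
  have : 0 <= 4 * K ^+ 3 * q by rewrite !mulr_ge0// exprn_ge0.
  lra.
have -> : t ^+ 4 = v ^+ 4 + (t - v) * ((t + v) * (t ^+ 2 + v ^+ 2)) by ring.
rewrite lerD2l.
have b : (t + v) * (t ^+ 2 + v ^+ 2) <= 4 * K ^+ 3.
  have v2 : v ^+ 2 <= K ^+ 2 by rewrite lerXn2r ?nnegrE//; lra.
  have t2 : t ^+ 2 <= K ^+ 2 by rewrite lerXn2r ?nnegrE.
  have -> : 4 * K ^+ 3 = (2 * K) * (2 * K ^+ 2) by ring.
  by apply: ler_pM => //; rewrite ?addr_ge0 ?sqr_ge0//; lra.
have b0 : 0 <= (t + v) * (t ^+ 2 + v ^+ 2) by rewrite mulr_ge0 ?addr_ge0 ?sqr_ge0.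
rewrite (mulrC (4 * _)); apply: ler_pM => //; lra.
Qed.

(** A Fatou bound without almost sure convergence: the fourth power truncated at level [n] is
    Lipschitz with constant [4 n^3], so its expectation is controlled along the mean square limit;
    then [n] tends to infinity by monotone convergence. *)
Lemma L2lim_fourth (K : R) : (forall k, intgr P (fun w => Y k w ^+ 4)) ->
  (\forall k \near \oo, Ex P (fun w => Y k w ^+ 4) <= K) ->
  intgr P (fun w => Z w ^+ 4) /\ Ex P (fun w => Z w ^+ 4) <= K.
Proof.
move=> iY4 hK.
have m4 : measurable_fun setT (fun w => Z w ^+ 4) by exact: measurable_funX.
have z4 w : 0 <= Z w ^+ 4 by rewrite (exprM _ 2 2) sqr_ge0.
apply: ge0_intgr_le => //.
have mt n : measurable_fun setT (fun w => trunc4 n%:R (Z w)).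
  by apply/measurable_funX/measurable_minr_comp; [exact: measurableT_comp_normr|exact: measurable_cst].
have t0 n x : 0 <= trunc4 n x by rewrite /trunc4 (exprM _ 2 2) sqr_ge0.
have it (n : nat) : intgr P (fun w => trunc4 n%:R (Z w)).
  apply: (@intgr_bounded _ _ _ _ (n%:R ^+ 4)) => // w.
  rewrite ger0_norm// lerXn2r ?nnegrE ?le_min ?normr_ge0 ?ler0n// ge_min lexx orbT//.
have tK (n : nat) : Ex P (fun w => trunc4 n%:R (Z w)) <= K.
  have mabs : measurable_fun setT (fun x : R => `|x|) by exact/measurableT_comp_normr/measurable_id.
  apply/ler_addgt0Pr => e e0.
  pose A : R := 4 * n%:R ^+ 3; have A0 : 0 <= A by rewrite mulr_ge0// exprn_ge0.
  (* Makes the total error [A e' + (A / e') e'^2 = 2 A e'] at most [e]. *)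
  pose e' := e / (2 * (A + 1)); have e'0 : 0 < e' by rewrite divr_gt0// mulr_gt0// ltr_wpDl.
  have [k []] : exists k, Ex P (fun w => Y k w ^+ 4) <= K /\
      `|0 - Ex P (fun w => (Y k w - Z w) ^+ 2)| <= e' ^+ 2.
    have e2 : 0 < e' ^+ 2 by rewrite exprn_gt0.
    move/cvgrPdist_le : D0 => /(_ _ e2) h.
    have [k0 _ hk] := filterI hK h.
    by exists k0; exact: (hk k0 (leqnn _)).
  rewrite sub0r normrN => h1 /(le_trans (ler_norm _)) h2.
  have : Ex P (fun w => trunc4 n%:R (Z w)) <=
      Ex P (fun w => Y k w ^+ 4 + (A * e' + A / e' * (Y k w - Z w) ^+ 2)).
    apply: le_Ex => //.
      by apply: intgrD => //; apply: intgrD; [exact: intgr_cst|exact: intgrZ].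
    move=> w; apply: le_trans (trunc4_le (Z w) (Y k w) (ler0n _ n)) _.
    rewrite lerD2l distrC -/A; apply: le_trans (ler_wpM2l A0 (normr_le_eps _ e'0)) _.
    by rewrite le_eqVlt; apply/orP; left; apply/eqP; ring.
  rewrite ExD//; last by apply: intgrD; [exact: intgr_cst|exact: intgrZ].
  rewrite ExD ?Ex_cst ?ExZ//; [|exact: intgr_cst|exact: intgrZ].
  have h3 : A / e' * Ex P (fun w => (Y k w - Z w) ^+ 2) <= A * e'.
    apply: le_trans (ler_wpM2l (divr_ge0 A0 (ltW e'0)) h2) _.
    by rewrite le_eqVlt; apply/orP; left; apply/eqP; field; rewrite gt_eqF.
  have h4 : A * e' * 2 <= e.
    rewrite /e' (_ : A * _ * 2 = A / (A + 1) * e); last first.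
      by field; rewrite gt_eqF// ltr_wpDl.
    apply: ler_piMl; first exact: ltW.
    by rewrite ler_pdivrMr ?mul1r ?lerDl// ltr_wpDl.
  lra.
have cv : (\int[P]_w (trunc4 n%:R (Z w))%:E)%E @[n --> \oo] --> (\int[P]_w (Z w ^+ 4)%:E)%E.
  rewrite [X in _ --> X](_ : _ = \int[P]_w (limn (fun n => (trunc4 n%:R (Z w))%:E)))%E.
    apply: cvg_monotone_convergence => //.
    - by move=> n; exact/measurable_EFinP.
    - by move=> n w _; rewrite lee_fin.
    - move=> w _ m n mn; rewrite lee_fin lerXn2r ?nnegrE ?le_min ?normr_ge0 ?ler0n//.
      by rewrite !ge_min lexx/= ler_nat mn orbT.
  apply: eq_integral => w _; apply/esym/cvg_lim => //.
  apply: cvg_EFin; first exact: nearW.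
  apply: cvg_near_cst; near=> n.
  rewrite /= /trunc4 min_l; first by rewrite (exprM _ 2 2) real_normK ?num_real// -exprM.
  by near: n; exact: nbhs_infty_ger.
rewrite -(cvg_lim _ cv)//; apply: lime_le; first by apply/cvg_ex; eexists; exact: cv.
by near=> n; rewrite EFin_Ex// lee_fin.
Unshelve. all: by end_near.
Qed.

End Limit.

(* All powers are compared through [m = max(|y|, |x - y|/e)]. *)
Lemma pow_dist_le (e x y : R) : 0 < e <= 1 ->
  `|x ^+ 4 - y ^+ 4| <= 15 * e * (1 + y ^+ 4 + (x - y) ^+ 4 / e ^+ 4) /\
  `|x ^+ 3 - y ^+ 3| <= 15 * e * (1 + y ^+ 4 + (x - y) ^+ 4 / e ^+ 4).
Proof.
move=> /andP[e0 e1]; pose D := x - y.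
have p4 (z : R) : z ^+ 4 = `|z| ^+ 4.
  by rewrite -normrX ger0_norm// (exprM _ 2 2) sqr_ge0.
pose m := Num.max `|y| (`|D| / e).
have ym : `|y| <= m by rewrite le_max lexx.
have Dm : `|D| <= e * m.
  by rewrite -ler_pdivrMl// mulrC le_max lexx orbT.
have m0 : 0 <= m by rewrite le_max normr_ge0.
have m4 : m ^+ 4 <= y ^+ 4 + D ^+ 4 / e ^+ 4.
  rewrite (p4 y) (p4 D) -expr_div_n.
  have h1 : 0 <= `|y| ^+ 4 by rewrite exprn_ge0.
  have h2 : 0 <= (`|D| / e) ^+ 4 by rewrite exprn_ge0// divr_ge0// ltW.
  by rewrite /m; case: (leP `|y| (`|D| / e)) => _; rewrite ?lerDr ?lerDl.
have em0 : 0 <= e * m by rewrite mulr_ge0// ltW.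
have mul_le (a b u v : R) : `|a| <= u -> `|b| <= v -> `|a * b| <= u * v.
  by move=> h1 h2; rewrite normrM ler_pM.
have e2 : e ^+ 2 <= e by rewrite expr2 ler_piMr// ltW.
have e3 : e ^+ 3 <= e by rewrite exprS ler_piMr ?exprn_ile1 ?(ltW e0).
have e4 : e ^+ 4 <= e by rewrite exprS ler_piMr ?exprn_ile1 ?(ltW e0).
have pw (a : R) b n : `|a| <= b -> `|a ^+ n| <= b ^+ n.
  by move=> h; rewrite normrX lerXn2r ?nnegrE// (le_trans _ h).
have b1 := mul_le _ _ _ _ (pw _ _ 3%N ym) Dm.
have b2 := mul_le _ _ _ _ (pw _ _ 2%N ym) (pw _ _ 2%N Dm).
have b3 := mul_le _ _ _ _ ym (pw _ _ 3%N Dm).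
have b4 := pw _ _ 4%N Dm.
have c1 := mul_le _ _ _ _ (pw _ _ 2%N ym) Dm.
have c2 := mul_le _ _ _ _ ym (pw _ _ 2%N Dm).
have c3 := pw _ _ 3%N Dm.
have mm4 : 0 <= m ^+ 4 by rewrite exprn_ge0.
have mm3 : 0 <= m ^+ 3 by rewrite exprn_ge0.
have m34 : m ^+ 3 <= 1 + m ^+ 4.
  have [h|h] := leP m 1; first by apply: (@le_trans _ _ 1); rewrite ?exprn_ile1 ?lerDl.
  by rewrite [m ^+ 4]exprS (le_trans (ler_peMl mm3 (ltW h)))// lerDr.
have em4 := ler_wpM2r mm4 e2; have em4' := ler_wpM2r mm4 e3; have em4'' := ler_wpM2r mm4 e4.
have em3 := ler_wpM2r mm3 e2; have em3' := ler_wpM2r mm3 e3.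
(* [15 = 4 + 6 + 4 + 1], the binomial coefficients of [(y + D)^4 - y^4]; for the cube their sum is
   only [7]. *)
have k4 : 15 * e * m ^+ 4 <= 15 * e * (1 + y ^+ 4 + (x - y) ^+ 4 / e ^+ 4).
  apply: ler_wpM2l; first by rewrite mulr_ge0// ltW.
  by apply: le_trans m4 _; rewrite -/D; lra.
have k3 : 15 * e * m ^+ 3 <= 15 * e * (1 + y ^+ 4 + (x - y) ^+ 4 / e ^+ 4).
  apply: ler_wpM2l; first by rewrite mulr_ge0// ltW.
  by apply: le_trans m34 _; rewrite -/D; lra.
have em03 : 0 <= e * m ^+ 3 by rewrite mulr_ge0// ltW.
have r1 : m ^+ 3 * (e * m) = e * m ^+ 4 by ring.
have r2 : m ^+ 2 * (e * m) ^+ 2 = e ^+ 2 * m ^+ 4 by ring.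
have r3 : m * (e * m) ^+ 3 = e ^+ 3 * m ^+ 4 by ring.
have r4 : (e * m) ^+ 4 = e ^+ 4 * m ^+ 4 by ring.
have s1 : m ^+ 2 * (e * m) = e * m ^+ 3 by ring.
have s2 : m * (e * m) ^+ 2 = e ^+ 2 * m ^+ 3 by ring.
have s3 : (e * m) ^+ 3 = e ^+ 3 * m ^+ 3 by ring.
rewrite r1 in b1; rewrite r2 in b2; rewrite r3 in b3; rewrite r4 in b4.
rewrite s1 in c1; rewrite s2 in c2; rewrite s3 in c3.
split.
- apply: le_trans k4.
  have -> : x ^+ 4 - y ^+ 4 = 4 * (y ^+ 3 * D) + 6 * (y ^+ 2 * D ^+ 2) + 4 * (y * D ^+ 3) + D ^+ 4.
    by rewrite /D; ring.
  move: b1 b2 b3 b4; rewrite !ler_norml => /andP[? ?] /andP[? ?] /andP[? ?] /andP[? ?].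
  by apply/andP; split; lra.
- apply: le_trans k3.
  have -> : x ^+ 3 - y ^+ 3 = 3 * (y ^+ 2 * D) + 3 * (y * D ^+ 2) + D ^+ 3.
    by rewrite /D; ring.
  move: c1 c2 c3; rewrite !ler_norml => /andP[? ?] /andP[? ?] /andP[? ?].
  by apply/andP; split; lra.
Qed.

Lemma L4_cvg_pow (Y : nat -> T -> R) (Z : T -> R) :
  (forall k, measurable_fun setT (Y k)) -> measurable_fun setT Z ->
  (forall k, intgr P (fun w => Y k w ^+ 3)) -> (forall k, intgr P (fun w => Y k w ^+ 4)) ->
  intgr P (fun w => Z w ^+ 4) -> (forall k, intgr P (fun w => (Y k w - Z w) ^+ 4)) ->
  Ex P (fun w => (Y k w - Z w) ^+ 4) @[k --> \oo] --> 0 ->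
  intgr P (fun w => Z w ^+ 3) /\
  Ex P (fun w => Y k w ^+ 3) @[k --> \oo] --> Ex P (fun w => Z w ^+ 3) /\
  Ex P (fun w => Y k w ^+ 4) @[k --> \oo] --> Ex P (fun w => Z w ^+ 4).
Proof.
move=> mY mZ iY3 iY4 iZ4 iD D0.
have iZ3 : intgr P (fun w => Z w ^+ 3).
  apply: (@intgr_le _ _ _ P _ (fun w => 1 + Z w ^+ 4)).
  - exact: measurable_funX.
  - move=> w; have := sqr_ge0 (Z w ^+ 2 - Z w); have := sqr_ge0 (Z w ^+ 2 + Z w).
    have := sqr_ge0 (Z w ^+ 2 - 1); rewrite ler_norml; nra.
  - by apply: intgrD => //; exact: intgr_cst.
split=> //.
pose K := 15 * (1 + Ex P (fun w => Z w ^+ 4)).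
pose dom e n w := 15 * e * (1 + Z w ^+ 4 + (Y n w - Z w) ^+ 4 / e ^+ 4).
have i1 : intgr P (fun w => 1 + Z w ^+ 4) by apply: intgrD => //; exact: intgr_cst.
have domE e n w : dom e n w = 15 * e * (1 + Z w ^+ 4) + 15 * e / e ^+ 4 * (Y n w - Z w) ^+ 4.
  by rewrite /dom; ring.
have idom e n : intgr P (dom e n).
  apply: (@eq_intgr _ _ _ P _ _ (fun w => esym (domE e n w))).
  by apply: intgrD; exact: intgrZ.
have edom e n : Ex P (dom e n) = e * K + 15 * e / e ^+ 4 * Ex P (fun w => (Y n w - Z w) ^+ 4).
  rewrite (@eq_Ex _ _ _ P _ _ (domE e n)) ExD; [|exact: intgrZ|exact: intgrZ].
  by rewrite !ExZ// ExD ?Ex_cst// /K; [ring|exact: intgr_cst].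
split.
- apply: (cvg_of_eps_bound (K := K)) D0 => e e01; exists (15 * e / e ^+ 4) => n.
  rewrite -ExB// -edom; apply: le_norm_Ex_le => //; first exact: intgrB.
  by move=> w; have [] := pow_dist_le (Y n w) (Z w) e01.
- apply: (cvg_of_eps_bound (K := K)) D0 => e e01; exists (15 * e / e ^+ 4) => n.
  rewrite -ExB// -edom; apply: le_norm_Ex_le => //; first exact: intgrB.
  by move=> w; have [] := pow_dist_le (Y n w) (Z w) e01.
Qed.

End L2Limits.

(** * Expectations under equal laws *)

Section EqualLaws.
Context (R : realType) d1 (T1 : measurableType d1) (P1 : probability T1 R)
  d2 (T2 : measurableType d2) (P2 : probability T2 R)
  d (S : measurableType d) (Y1 : T1 -> S) (Y2 : T2 -> S).
Hypotheses (mY1 : measurable_fun setT Y1) (mY2 : measurable_fun setT Y2).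
Hypothesis lawE : forall B, measurable B -> fine (P1 (Y1 @^-1` B)) = fine (P2 (Y2 @^-1` B)).

Lemma law_Ex (f : S -> R) : measurable_fun setT f -> intgr P1 (fun w => f (Y1 w)) ->
  intgr P2 (fun w => f (Y2 w)) /\ Ex P1 (fun w => f (Y1 w)) = Ex P2 (fun w => f (Y2 w)).
Proof.
move=> mf i1.
have W B : measurable B -> wlaw P1 (fun=> 1) Y1 B = wlaw P2 (fun=> 1) Y2 B.
  by move=> mB; rewrite !wlaw_prob// lawE.
have E1 w : f (Y1 w) = 1 * f (Y1 w) by rewrite mul1r.
have E2 w : 1 * f (Y2 w) = f (Y2 w) by rewrite mul1r.
have i1' := @eq_intgr _ _ _ P1 _ _ E1 i1.
split.
  apply: (@eq_intgr _ _ _ P2 _ _ E2).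
  exact: (wlaw_intgr (intgr_cst P1 1) mY1 (fun=> ler01) (intgr_cst P2 1) mY2 (fun=> ler01) W).
rewrite (@eq_Ex _ _ _ P1 _ _ E1) -(@eq_Ex _ _ _ P2 _ _ E2).
exact: (wlaw_Ex (intgr_cst P1 1) mY1 (fun=> ler01) (intgr_cst P2 1) mY2 (fun=> ler01) W).
Qed.

End EqualLaws.

(** * From the isonormal process to Gaussian families *)

Section CenteredGaussian.
Context (R : realType).
Local Notation leb := (@lebesgue_measure R).

Lemma normal_prob_scale (s : R) (A : set R) : 0 < s -> measurable A ->
  normal_prob 0 s ((fun x => x / s) @^-1` A) = normal_prob 0 1 A.
Proof.
move=> s0 mA; have sn0 : s != 0 by rewrite gt_eqF.
have mB : measurable ((fun x : R => x / s) @^-1` A).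
  rewrite -[X in measurable X]setTI; apply: measurable_funM => //; exact: measurable_cst.
rewrite /normal_prob integral_mkcond [RHS]integral_mkcond.
have m0 : measurable_fun setT (fun x : R => (normal_pdf 0 s x)%:E).
  by apply/measurable_EFinP; exact: measurable_normal_pdf.
have m1 : measurable_fun setT ((fun x : R => (normal_pdf 0 s x)%:E) \_ ((fun x : R => x / s) @^-1` A)).
  by apply: (measurable_restrictT _ _).1 => //; apply: measurable_funTS; exact: m0.
rewrite (ge0_integral_scale s0); first last.
- by move=> x; rewrite patchE; case: ifP => // _; rewrite lee_fin normal_pdf_ge0.
- exact: m1.
rewrite -ge0_integralZl//; first last.
- by rewrite lee_fin ltW.
- by move=> x _; rewrite patchE; case: ifP => // _; rewrite lee_fin normal_pdf_ge0.
- apply: (measurableT_comp m1); apply: measurable_funM; [exact: measurable_cst|exact: measurable_id].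
apply: eq_integral => x _; rewrite !patchE.
have -> : (s * x \in (fun x : R => x / s) @^-1` A) = (x \in A).
  by apply/idP/idP; rewrite !inE /= mulrAC mulfV// mul1r.
case: ifP => _; last by rewrite mule0.
rewrite -EFinM; congr EFin.
rewrite /normal_pdf (negbTE sn0) oner_eq0 /normal_fun !subr0 mulrA; congr (_ * _).
  rewrite /normal_peak expr1n; have := pi_gt0 R; move: (pi : R) => p p0.
  rewrite -mulrnAr sqrtrM ?sqr_ge0// sqrtr_sqr gtr0_norm// invfM mulrA mulfV// !mul1r.
  by [].
by rewrite expr1n; congr expR; field.
Qed.

Context d (T : measurableType d) (P : probability T R).

(** For [s > 0] the variable [Z / s] is standard; for [s = 0] the law is the Dirac mass at [0] and
    the formulas are read off a constant. *)
Lemma centered_gaussian_std (Z : T -> R) : measurable_fun setT Z -> centered_gaussian P Z ->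
  exists s : R, [/\ 0 <= s, intgr P (fun w => Z w ^+ 2), Ex P (fun w => Z w ^+ 2) = s ^+ 2,
    Ex P (fun w => cos (Z w)) = expR (- s ^+ 2 / 2) & s = 1 -> std_normal P Z].
Proof.
move=> mZ [s [s0 hs]]; exists s.
have m2 : measurable_fun setT (fun x : R => x ^+ 2) by apply: measurable_funX; exact: measurable_id.
have mc : measurable_fun setT (fun x : R => cos x).
  by apply: continuous_measurable_fun; solve_continuous.
have [s00|sn0] := eqVneq s 0.
  have W B : measurable B -> fine (P ((fun=> 0 : R) @^-1` B)) = fine (P (Z @^-1` B)).
    move=> mB; rewrite hs// s00 eqxx diracE preimage_cst; case: ifP => _.
      by rewrite probability_setT.
    by rewrite measure0.
  have [i2 e2] := law_Ex (measurable_cst (0 : R)) mZ W m2 (intgr_cst P (0 ^+ 2)).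
  have [_ ec] := law_Ex (measurable_cst (0 : R)) mZ W mc (intgr_cst P (cos 0)).
  split=> //.
  - by rewrite -e2 s00; exact: (Ex_cst P (0 ^+ 2)).
  - by rewrite -ec s00 expr0n/= oppr0 mul0r expR0 -(cos0 R); exact: (Ex_cst P (cos 0)).
  - by rewrite s00 => /esym/eqP; rewrite oner_eq0.
have sp : 0 < s by rewrite lt0r sn0.
pose W w := Z w / s.
have mW : measurable_fun setT W by apply: measurable_funM => //; exact: measurable_cst.
have sW : std_normal P W.
  split=> // A mA; rewrite -(normal_prob_scale sp mA).
  have mB : measurable ((fun x : R => x / s) @^-1` A).
    rewrite -[X in measurable X]setTI; apply: measurable_funM => //; exact: measurable_cst.
  by have := hs _ mB; rewrite (negbTE sn0).
have ZW w : Z w = s * W w by rewrite /W mulrCA mulfV// mulr1.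
have ZW2 w : s ^+ 2 * W w ^+ 2 = Z w ^+ 2 by rewrite -exprMn -ZW.
have [i2 _] := nmomentE sW 2.
split=> //.
- by apply: (@eq_intgr _ _ _ P _ _ ZW2); exact: intgrZ.
- rewrite -(@eq_Ex _ _ _ P _ _ ZW2) ExZ// -/(nmoment P W 2) (nmomentS sW) (nmoment0 sW); ring.
- rewrite (@eq_Ex _ _ _ P _ (fun w => cos (s * W w))); first exact: std_normal_cos.
  by move=> w; rewrite ZW.
- move=> s1; split=> // A mA; rewrite hs// s1 oner_eq0//.
Qed.

End CenteredGaussian.

Section Isonormal.
Context (R : realType) d (T : measurableType d) (P : probability T R)
  (H : normedModType R) (ip : H -> H -> R) (X : H -> {RV P >-> R}).
Hypothesis hX : isonormal ip X.

Lemma isonormal_prod (g h : H) : intgr P (fun w => X g w * X h w) /\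
  Ex P (fun w => X g w * X h w) = ip g h.
Proof.
have mX a : measurable_fun setT (X a : T -> R) by exact: measurable_funPT.
have E2 a b := hX.2 a b.
have i2 a : intgr P (fun w => X a w ^+ 2).
  apply: ge0_intgr; [by apply: measurable_funX|by move=> w; exact: sqr_ge0|].
  have := E2 a a; rewrite unlock => /= h2; under eq_integral do rewrite expr2.
  by rewrite h2 ltry.
have i : intgr P (fun w => X g w * X h w).
  apply: (@intgr_le _ _ _ P _ (fun w => X g w ^+ 2 + X h w ^+ 2)).
  - exact: measurable_funM.
  - move=> w; rewrite ler_norml; have := sqr_ge0 (X g w - X h w); have := sqr_ge0 (X g w + X h w).
    by nra.
  - exact: intgrD.
split=> //; have := E2 g h; rewrite unlock => h2.
by rewrite /Ex /Rintegral /= h2.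
Qed.

Variables (e : nat -> H) (s : pred nat).
Hypothesis he : forall i j, s i -> s j -> ip (e i) (e j) = (i == j)%:R.

(** A linear combination of the [X (e i)] is centered Gaussian, so its cosine transform depends on
    its variance only, which orthonormality makes the sum of the squared coefficients. *)
Lemma isonormal_family : gaussian_family P (fun i => X (e i) : T -> R) s.
Proof.
have mX a : measurable_fun setT (X a : T -> R) by exact: measurable_funPT.
have var m (a : nat -> R) : supported s a ->
    Ex P (fun w => (\sum_(i < m) a i * X (e i) w) ^+ 2) = \sum_(i < m) a i ^+ 2.
  move=> sa.
  have E w : (\sum_(i < m) a i * X (e i) w) ^+ 2 =
      \sum_(i < m) \sum_(j < m) a i * a j * (X (e i) w * X (e j) w).
    rewrite expr2 mulr_suml; apply: eq_bigr => i _; rewrite mulr_sumr; apply: eq_bigr => j _.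
    by ring.
  have iij (i j : 'I_m) : intgr P (fun w => a i * a j * (X (e i) w * X (e j) w)).
    by apply: intgrZ; exact: (isonormal_prod _ _).1.
  have ii (i : 'I_m) : intgr P (fun w => \sum_(j < m) a i * a j * (X (e i) w * X (e j) w)).
    exact: (@intgr_sum _ _ _ P _ _ (fun (j : 'I_m) w => a i * a j * (X (e i) w * X (e j) w))).
  rewrite (@eq_Ex _ _ _ P _ _ E).
  rewrite (@Ex_sum _ _ _ P _ _ (fun (i : 'I_m) w => \sum_(j < m) a i * a j * (X (e i) w * X (e j) w)))//.
  apply: eq_bigr => i _.
  rewrite (@Ex_sum _ _ _ P _ _ (fun (j : 'I_m) w => a i * a j * (X (e i) w * X (e j) w)))//.
  rewrite (bigD1 i)//= big1 ?addr0 => [|j ji].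
    rewrite ExZ; last exact: (isonormal_prod _ _).1.
    rewrite (isonormal_prod _ _).2; have [si|/sa ->] := boolP (s i); last by rewrite !mul0r expr0n.
    by rewrite he// eqxx mulr1.
  rewrite ExZ; last exact: (isonormal_prod _ _).1.
  rewrite (isonormal_prod _ _).2; have [si|/sa ->] := boolP (s i); last by rewrite !mul0r.
  have [sj|/sa ->] := boolP (s j); last by rewrite mulr0 mul0r.
  by rewrite he// (_ : (i == j :> nat) = false) ?mulr0//; apply/negbTE; rewrite eq_sym.
split=> //.
- move=> i si; have gi := hX.1 1%N (fun=> 1) (fun=> e i).
  rewrite (_ : (fun w => _) = (X (e i) : T -> R)) in gi; last first.
    by apply/funext => w; rewrite big_ord1 mul1r.
  have [t [t0 i2 e2 _]] := centered_gaussian_std (mX (e i)) gi.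
  apply; move: e2; rewrite (@eq_Ex _ _ _ P _ (fun w => X (e i) w * X (e i) w))//.
  rewrite (isonormal_prod _ _).2 he// eqxx => /esym/eqP.
  by rewrite sqrp_eq1// => /eqP.
- move=> m a sa.
  have mS : measurable_fun setT (fun w => \sum_(i < m) a i * X (e i) w).
    by apply: measurable_sum => i; apply: measurable_funM => //; exact: measurable_cst.
  have [t [_ _ e2 -> _]] := centered_gaussian_std mS (hX.1 m (fun i => a i) (fun i => e i)).
  by rewrite -e2 var.
Qed.

End Isonormal.

(** * Moments of an element of the second chaos *)

Section ChaosLimit.
Context (R : realType) d (T : measurableType d) (P : probability T R).
Variables (N : nat -> T -> R) (s : pred nat).
Hypothesis hN : gaussian_family P N s.
Variables (c : nat -> R) (V : R) (F : T -> R).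
Hypotheses (sc : supported s c) (mF : measurable_fun setT F).
Hypothesis cV : \sum_(i < m) c i ^+ 2 @[m --> \oo] --> V.
Hypothesis cF : L2_cvg P (psum N c) F.

(** A tail is again a partial sum, with coefficients cut off below [k], so [psum_moments] covers
    it. *)
Lemma psum_tail k l w : (k <= l)%N ->
  psum N c l w - psum N c k w = psum N (fun i => (k <= i)%:R * c i) l w.
Proof.
move=> kl; rewrite -(subnKC kl); elim: (l - k)%N => [|m IH].
  rewrite addn0 subrr /psum big1// => i _; by rewrite leqNgt ltn_ord mul0r mul0r.
by rewrite addnS !psumS -IH leq_addr mul1r addrAC.
Qed.

Lemma supported_tail k : supported s (fun i => (k <= i)%:R * c i).
Proof. by move=> i /sc ->; rewrite mulr0. Qed.

Lemma sum_tail k l n : (k <= l)%N -> (0 < n)%N ->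
  \sum_(i < l) ((k <= i)%:R * c i) ^+ n = \sum_(i < l) c i ^+ n - \sum_(i < k) c i ^+ n.
Proof.
move=> kl n0; rewrite -(subnKC kl); elim: (l - k)%N => [|m IH].
  rewrite addn0 subrr big1// => i _; by rewrite leqNgt ltn_ord mul0r expr0n gtn_eqF.
by rewrite addnS !big_ord_recr/= IH leq_addr mul1r addrAC.
Qed.

Lemma sum_sqr_le m : \sum_(i < m) c i ^+ 2 <= V.
Proof.
rewrite -(cvg_lim _ cV)//; apply: nondecreasing_cvgn_le; last by apply/cvg_ex; exists V.
by apply/nondecreasing_seqP => n; rewrite big_ord_recr/= lerDl sqr_ge0.
Qed.

Lemma sum_fourth_le (a : nat -> R) m : \sum_(i < m) a i ^+ 4 <= (\sum_(i < m) a i ^+ 2) ^+ 2.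
Proof.
elim: m => [|m IH]; first by rewrite !big_ord0 expr0n.
rewrite !big_ord_recr/= sqrrD -(exprM _ 2 2); apply: lerD => //.
apply: le_trans IH _; rewrite lerDl mulrn_wge0// mulr_ge0 ?sqr_ge0//.
by apply: sumr_ge0 => i _; exact: sqr_ge0.
Qed.

Let i4 (a : nat -> R) m k : supported s a -> (k <= 4)%N -> intgr P (fun w => psum N a m w ^+ k).
Proof. by move=> sa; have [h _ _ _ _] := psum_moments hN m sa; exact: h. Qed.

Let mpsum (a : nat -> R) m : measurable_fun setT (psum N a m) := measurable_psum hN a m.

Lemma chaos_L2lim : L2lim P (psum N c) F.
Proof. by apply: L2_cvg_L2lim => // k; exact: i4. Qed.

Lemma chaos_L2lim_tail k : L2lim P (fun l w => psum N c (l + k) w - psum N c k w)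
  (fun w => F w - psum N c k w).
Proof.
have [_ _ h2 h3 h4] := chaos_L2lim.
have mc m := mpsum c m.
split.
- by move=> l; exact: measurable_funB.
- exact: measurable_funB.
- by move=> l; apply: intgr_sqrB.
- exact: intgr_sqrB.
- rewrite (_ : (fun l => _) = (fun l => Ex P (fun w => (psum N c (l + k) w - F w) ^+ 2))).
    by rewrite (cvg_shiftn k (fun m => Ex P (fun w => (psum N c m w - F w) ^+ 2))).
  by apply/funext => l; apply: eq_Ex => w; congr (_ ^+ 2); ring.
Qed.

(** Hypercontractivity by hand: as [sum a^4 <= (sum a^2)^2], the fourth moment of a finite tail is
    at most [48 + 12] times the square of its sum of squares, and [L2lim_fourth] carries the bound
    to the limit. *)
Lemma chaos_fourth k : intgr P (fun w => (F w - psum N c k w) ^+ 4) /\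
  Ex P (fun w => (F w - psum N c k w) ^+ 4) <= 60 * (V - \sum_(i < k) c i ^+ 2) ^+ 2.
Proof.
have E l w : psum N (fun i => (k <= i)%:R * c i) (l + k) w ^+ 4 =
    (psum N c (l + k) w - psum N c k w) ^+ 4 by rewrite psum_tail// leq_addl.
apply: (L2lim_fourth (chaos_L2lim_tail k)).
  by move=> l; apply: (@eq_intgr _ _ _ P _ _ (E l)); exact/i4/leqnn/supported_tail.
apply: nearW => l; rewrite -(@eq_Ex _ _ _ P _ _ (E l)).
have [_ _ _ _ ->] := psum_moments hN (l + k) (supported_tail k).
have h1 := sum_fourth_le (fun i => (k <= i)%:R * c i) (l + k).
have kl : (k <= l + k)%N by rewrite leq_addl.
have h2 := sum_tail kl (isT : 0 < 2)%N; rewrite h2 in h1 *.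
have h3 : 0 <= \sum_(i < l + k) c i ^+ 2 - \sum_(i < k) c i ^+ 2.
  by rewrite -h2; apply: sumr_ge0 => i _; exact: sqr_ge0.
have h4 := sum_sqr_le (l + k).
have h5 : (\sum_(i < l + k) c i ^+ 2 - \sum_(i < k) c i ^+ 2) ^+ 2 <=
    (V - \sum_(i < k) c i ^+ 2) ^+ 2.
  by rewrite lerXn2r ?nnegrE//; lra.
lra.
Qed.

(** The tails tend to zero in [L^4] by [chaos_fourth], hence the third and fourth moments of the
    partial sums converge to those of [F]. *)
Lemma chaos_moments :
  [/\ forall k, (k <= 4)%N -> intgr P (fun w => F w ^+ k), Ex P F = 0,
      Ex P (fun w => F w ^+ 2) = 2 * V,
      8 * \sum_(i < m) c i ^+ 3 @[m --> \oo] --> Ex P (fun w => F w ^+ 3) &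
      48 * \sum_(i < m) c i ^+ 4 + 12 * (\sum_(i < m) c i ^+ 2) ^+ 2 @[m --> \oo] -->
        Ex P (fun w => F w ^+ 4)].
Proof.
have mc m := mpsum c m.
have hL := chaos_L2lim; have [_ _ h2 h3 h4] := hL.
have iF4 : intgr P (fun w => F w ^+ 4).
  have := (chaos_fourth 0).1; apply: (@eq_intgr _ _ _ P) => w.
  by rewrite psum0 subr0.
have D0 : Ex P (fun w => (psum N c k w - F w) ^+ 4) @[k --> \oo] --> 0.
  have b0 : 60 * (V - \sum_(i < k) c i ^+ 2) ^+ 2 @[k --> \oo] --> 0.
    have cb : V - \sum_(i < k) c i ^+ 2 @[k --> \oo] --> V - V by apply: cvgB => //; exact: cvg_cst.
    rewrite -[X in _ --> X](_ : 60 * ((V - V) * (V - V)) = 0); last by rewrite subrr !mulr0.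
    by apply: cvgMr; under eq_fun do rewrite expr2; exact: cvgM.
  apply: (squeeze_cvgr _ (cvg_cst 0) b0); apply: nearW => k.
  have E w : (F w - psum N c k w) ^+ 4 = (psum N c k w - F w) ^+ 4 by ring.
  rewrite -(@eq_Ex _ _ _ P _ _ E) (chaos_fourth k).2 andbT; apply: Ex_ge0 => w.
  by rewrite (exprM _ 2 2) sqr_ge0.
have iD k : intgr P (fun w => (psum N c k w - F w) ^+ 4).
  by apply: (@eq_intgr _ _ _ P _ _ _ (chaos_fourth k).1) => w; ring.
have [i3 [e3 e4]] := L4_cvg_pow mc mF (fun k => i4 k sc (isT : 3 <= 4)%N)
  (fun k => i4 k sc (leqnn 4)) iF4 iD D0.
have i1 : intgr P F by exact: intgr_of_sqr.
split.
- case=> [_|]; first exact: intgr_cst.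
  case=> [_|]; first exact: i1.
  case=> [_|]; first exact: h3.
  case=> [_|]; first exact: i3.
  by case=> [_|//]; exact: iF4.
- have [|_ [_ h]] := @L2lim_lipschitz _ _ _ P _ _ hL id 1 (@measurable_id _ _ setT).
    by move=> x y; rewrite mul1r.
  apply/esym/(cvg_unique _ _ h) => //.
  rewrite (_ : (fun k => _) = cst 0); first exact: cvg_cst.
  by apply/funext => k; have [_ -> _ _ _] := psum_moments hN k sc.
- apply: (cvg_unique _ (L2lim_sqr hL)) => //.
  rewrite (_ : (fun k => _) = (fun k => 2 * \sum_(i < k) c i ^+ 2)); first exact: cvgMr.
  by apply/funext => k; have [_ _ -> _ _] := psum_moments hN k sc.
- move: e3; rewrite (_ : (fun k => Ex P _) = (fun k => 8 * \sum_(i < k) c i ^+ 3))//.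
  by apply/funext => k; have [_ _ _ -> _] := psum_moments hN k sc.
- move: e4; rewrite (_ : (fun k => Ex P _) =
    (fun k => 48 * \sum_(i < k) c i ^+ 4 + 12 * (\sum_(i < k) c i ^+ 2) ^+ 2))//.
  by apply/funext => k; have [_ _ _ _ ->] := psum_moments hN k sc.
Qed.

End ChaosLimit.

(** * Orthogonal series in the Hilbert space *)

Section OrthogonalSeries.
Context (R : realType) (H : completeNormedModType R) (ip : H -> H -> R).
Hypothesis hip : inner_product ip.

Lemma ipDl x y z : ip (x + y) z = ip x z + ip y z.
Proof. by have [_ h _] := hip; have := h 1 x y z; rewrite scale1r mul1r. Qed.

Lemma ip0l z : ip 0 z = 0.
Proof. by have := ipDl 0 0 z; rewrite addr0 => /eqP; rewrite addrC -subr_eq subrr => /eqP. Qed.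

Lemma ipZl a x z : ip (a *: x) z = a * ip x z.
Proof. by have [_ h _] := hip; have := h a x 0 z; rewrite !addr0 ip0l addr0. Qed.

Lemma ipC x y : ip x y = ip y x. Proof. by have [h _ _] := hip; exact: h. Qed.

Lemma ipxx x : ip x x = `|x| ^+ 2. Proof. by have [_ _ h] := hip; exact: h. Qed.

Lemma ipZr a x z : ip z (a *: x) = a * ip z x.
Proof. by rewrite ipC ipZl ipC. Qed.

Lemma ip_suml m (f : nat -> H) z : ip (\sum_(i < m) f i) z = \sum_(i < m) ip (f i) z.
Proof.
by elim: m => [|m IH]; rewrite ?big_ord0 ?ip0l// !big_ord_recr/= ipDl IH.
Qed.

(* Polarization: the inner product inherits continuity from the norm. *)
Lemma ip_polar x y : ip x y = (`|x + y| ^+ 2 - `|x| ^+ 2 - `|y| ^+ 2) / 2.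
Proof.
rewrite -!ipxx ipDl (ipC x (x + y)) (ipC y (x + y)) !ipDl (ipC y x); by field.
Qed.

Lemma cvg_ip (u : nat -> H) x z : u m @[m --> \oo] --> x -> ip (u m) z @[m --> \oo] --> ip x z.
Proof.
move=> ux; under eq_fun do rewrite ip_polar.
have sq (v : nat -> H) y : v m @[m --> \oo] --> y -> `|v m| ^+ 2 @[m --> \oo] --> `|y| ^+ 2.
  move=> vy; under eq_fun do rewrite expr2.
  by rewrite expr2; apply: cvgM; exact: cvg_norm.
rewrite ip_polar; apply: cvgMl; apply: cvgB; last exact: cvg_cst.
apply: cvgB; last exact: sq.
by apply: sq; apply: cvgD => //; exact: cvg_cst.
Qed.

Variables (e : nat -> H) (s : pred nat).
Hypothesis he : forall i j, s i -> s j -> ip (e i) (e j) = (i == j)%:R.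

Lemma ortho_norm (a : nat -> R) m : supported s a ->
  `|\sum_(i < m) a i *: e i| ^+ 2 = \sum_(i < m) a i ^+ 2.
Proof.
move=> sa; rewrite -ipxx (ip_suml m (fun i => a i *: e i)); apply: eq_bigr => i _.
rewrite ipC (ip_suml m (fun i => a i *: e i)) (bigD1 i)//= big1 ?addr0 => [|j ji].
  rewrite ipZl ipZr; have [si|/sa ->] := boolP (s i); last by rewrite !mul0r expr0n.
  by rewrite he// eqxx mulr1 expr2.
rewrite ipZl ipZr; have [si|/sa ->] := boolP (s i); last by rewrite mul0r mulr0.
have [sj|/sa ->] := boolP (s j); last by rewrite mul0r.
by rewrite he// (_ : (j == i :> nat) = false) ?mulr0//; exact/negbTE.
Qed.

Lemma sum_tailZ (V : lmodType R) (a : nat -> R) (v : nat -> V) k l : (k <= l)%N ->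
  \sum_(i < l) a i *: v i - \sum_(i < k) a i *: v i =
  \sum_(i < l) ((k <= i)%:R * a i) *: v i.
Proof.
move=> kl; rewrite -(subnKC kl); elim: (l - k)%N => [|m IH].
  by rewrite addn0 subrr big1// => i _; rewrite leqNgt ltn_ord mul0r scale0r.
by rewrite addnS !big_ord_recr/= -IH leq_addr mul1r addrAC.
Qed.

Lemma ortho_dist (a : nat -> R) k l : supported s a -> (k <= l)%N ->
  `|\sum_(i < l) a i *: e i - \sum_(i < k) a i *: e i| ^+ 2 =
  \sum_(i < l) a i ^+ 2 - \sum_(i < k) a i ^+ 2.
Proof.
move=> sa kl; rewrite (sum_tailZ a e kl) (ortho_norm l (supported_tail sa k)).
exact: sum_tail.
Qed.

Lemma sum_sqr_nd (a : nat -> R) : nondecreasing_seq (fun m => \sum_(i < m) a i ^+ 2).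
Proof. by apply/nondecreasing_seqP => n; rewrite big_ord_recr/= lerDl sqr_ge0. Qed.

Lemma ortho_cvg (a : nat -> R) (S : R) : supported s a ->
  \sum_(i < m) a i ^+ 2 @[m --> \oo] --> S -> cvgn (fun m => \sum_(i < m) a i *: e i).
Proof.
move=> sa hS; apply/cauchy_cvgP/cauchy_exP => eps eps0.
have e2 : 0 < eps ^+ 2 by rewrite exprn_gt0.
move/cvgrPdist_lt : (hS) => /(_ _ e2)[N _ hN].
exists (\sum_(i < N) a i *: e i); exists N => // k /= Nk; rewrite -ball_normE /= distrC.
rewrite -(ltr_pXn2r (ltn0Sn 1)) ?nnegrE ?(ltW eps0)// ortho_dist//.
apply: le_lt_trans (hN N (leqnn N)); apply: le_trans (ler_norm _); rewrite lerD2r.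
exact: (sum_sqr_le hS).
Qed.

(** Pythagoras, passed to the limit in [m] with [k] fixed. *)
Lemma ortho_lim_dist (a : nat -> R) (S : R) x k : supported s a ->
  \sum_(i < m) a i ^+ 2 @[m --> \oo] --> S -> \sum_(i < m) a i *: e i @[m --> \oo] --> x ->
  `|\sum_(i < k) a i *: e i - x| ^+ 2 = S - \sum_(i < k) a i ^+ 2.
Proof.
move=> sa hS hx.
have h1 : `|\sum_(i < m) a i *: e i - \sum_(i < k) a i *: e i| ^+ 2 @[m --> \oo] -->
    `|x - \sum_(i < k) a i *: e i| ^+ 2.
  under eq_fun do rewrite expr2.
  by rewrite expr2; apply: cvgM; apply: cvg_norm; apply: cvgB => //; exact: cvg_cst.
rewrite distrC; apply: (cvg_unique _ h1) => //.
apply: (@cvg_trans _ (\sum_(i < m) a i ^+ 2 - \sum_(i < k) a i ^+ 2 @[m --> \oo])).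
  by apply: near_eq_cvg; exists k => // m /= km; rewrite ortho_dist.
by apply: cvgB => //; exact: cvg_cst.
Qed.

Lemma ortho_lim_norm (a : nat -> R) (S : R) x : supported s a ->
  \sum_(i < m) a i ^+ 2 @[m --> \oo] --> S -> \sum_(i < m) a i *: e i @[m --> \oo] --> x ->
  ip x x = S.
Proof.
move=> sa hS hx; have := ortho_lim_dist 0 sa hS hx.
by rewrite !big_ord0 sub0r subr0 normrN ipxx.
Qed.

End OrthogonalSeries.

(** * Almost sure equality and variance *)

Section AlmostEverywhere.
Context (R : realType) d (T : measurableType d) (P : probability T R).

Lemma Ex_ae (f g : T -> R) : intgr P f -> measurable_fun setT g ->
  {ae P, forall w, f w = g w} -> intgr P g /\ Ex P f = Ex P g.
Proof.
move=> iF mg fg; have mf := intgr_meas iF.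
have E : ae_eq P setT (EFin \o f) (EFin \o g).
  by apply: filterS fg => w /= -> _.
have mF : measurable_fun setT (EFin \o f) by exact/measurable_EFinP.
have mG : measurable_fun setT (EFin \o g) by exact/measurable_EFinP.
have En : ae_eq P setT (fun w => `|(g w)%:E|%E) (fun w => `|(f w)%:E|%E).
  by apply: filterS fg => w /= -> _.
split.
  apply/integrableP; split=> //; have /integrableP[_] := iF.
  rewrite (_ : (\int[P]_w `|(EFin \o g) w| = \int[P]_w `|(EFin \o f) w|)%E)//.
  apply: ae_eq_integral => //; [exact: measurableT_comp mG|exact: measurableT_comp mF].
by rewrite /Ex /Rintegral; congr fine; exact: ae_eq_integral.
Qed.

Lemma RV_of_measurable (f : T -> R) : measurable_fun setT f ->
  exists g : {RV P >-> R}, forall w, g w = f w.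
Proof.
move=> mf; pose m := isMeasurableFun.Build _ _ _ _ f mf.
pose g : {mfun T >-> R} := HB.pack f m.
by exists g.
Qed.

Lemma variance_centered (Y : T -> R) (v : R) : intgr P (fun w => Y w ^+ 2) ->
  measurable_fun setT Y -> Ex P Y = v ->
  ('V_P[Y] = (Ex P (fun w => (Y w - v) ^+ 2))%:E)%E.
Proof.
move=> iY mY eY; have i1 := intgr_of_sqr mY iY.
have iB : intgr P (fun w => (Y w - v) ^+ 2).
  by apply: (intgr_sqrB mY (measurable_cst v) iY); exact: (intgr_cst P (v ^+ 2)).
rewrite -EFin_Ex// /variance unlock.
rewrite (_ : fine _ = v); last by rewrite unlock -eY.
by rewrite unlock; apply: eq_integral => w _; rewrite /= expr2.
Qed.

End AlmostEverywhere.

(** * The random series of the squares of c_i N_i *)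

Section Energy.
Context (R : realType) d (T : measurableType d) (P : probability T R).
Variables (N : nat -> T -> R) (s : pred nat).
Hypothesis hN : gaussian_family P N s.
Variables (c : nat -> R) (V : R).
Hypotheses (sc : supported s c) (cV : \sum_(i < m) c i ^+ 2 @[m --> \oo] --> V).

Let mN i : measurable_fun setT (N i). Proof. by have [] := hN. Qed.

(** Four times its limit is the squared norm of the Malliavin derivative of [F], and twice its limit
    is [Gamma_1 F]. *)
Definition energy m w : R := \sum_(i < m) (c i * N i w) ^+ 2.

Let eenergy w : \bar R := (\sum_(0 <= i <oo) ((c i * N i w) ^+ 2)%:E)%E.

Definition finite_energy : set T := [set w | (eenergy w < +oo)%E].

(** Where the series is infinite, [fine] returns [0]: the function is real-valued and measurable
    everywhere. *)
Definition total_energy w : R := fine (eenergy w).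

Lemma measurable_energy m : measurable_fun setT (energy m).
Proof.
apply: measurable_sum => i; apply: measurable_funX.
by apply: measurable_funM => //; exact: measurable_cst.
Qed.

Let measurable_eenergy : measurable_fun setT eenergy.
Proof.
apply: ge0_emeasurable_sum => [k w _ _|k _]; first by rewrite lee_fin sqr_ge0.
apply/measurable_EFinP; apply: measurable_funX.
by apply: measurable_funM => //; exact: measurable_cst.
Qed.

Lemma measurable_total_energy : measurable_fun setT total_energy.
Proof. by apply: (measurableT_comp _ measurable_eenergy); exact: fine_measurable. Qed.

Let eenergy_ge0 w : (0 <= eenergy w)%E.
Proof. by apply: nneseries_ge0 => n _ _; rewrite lee_fin sqr_ge0. Qed.

Lemma measurable_finite_energy : measurable finite_energy.
Proof.
rewrite (_ : finite_energy = setT `&` eenergy @^-1` [set` Interval (BLeft 0%E) (BLeft +oo%E)]).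
  by apply: measurable_eenergy => //; exact: emeasurable_itv.
rewrite setTI; apply/seteqP; split=> w /=; rewrite in_itv/= eenergy_ge0.
  by move=> ->.
by [].
Qed.

Lemma energy_le m w : finite_energy w -> energy m w <= total_energy w.
Proof.
move=> fw; rewrite -lee_fin /total_energy fineK; last by rewrite ge0_fin_numE.
rewrite /energy -sumEFin -(big_mkord xpredT (fun i => ((c i * N i w) ^+ 2)%:E)).
by apply: nneseries_lim_ge => n _ _; rewrite lee_fin sqr_ge0.
Qed.

Lemma energy_cvg w : finite_energy w -> energy m w @[m --> \oo] --> total_energy w.
Proof.
move=> fw; rewrite /total_energy.
have : (\sum_(0 <= i < m) ((c i * N i w) ^+ 2)%:E)%E @[m --> \oo] --> (fine (eenergy w))%:E.
  rewrite fineK; last by rewrite ge0_fin_numE.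
  by apply: is_cvg_nneseries => n _ _; rewrite lee_fin sqr_ge0.
move/fine_cvg; apply: cvg_trans; apply: near_eq_cvg; apply: nearW => m.
by rewrite /energy /= sumEFin/= big_mkord.
Qed.

Lemma energyE m w : energy m w = psum N (fun i => c i ^+ 2) m w + \sum_(i < m) c i ^+ 2.
Proof. by rewrite /energy /psum -big_split/=; apply: eq_bigr => i _; rewrite /chi; ring. Qed.

Lemma supported_sqr : supported s (fun i => c i ^+ 2).
Proof. by move=> i /sc ->; rewrite expr0n. Qed.

(** The second moment is [2 sum c^4 + (sum c^2)^2], which is at most three times the square of
    [sum c^2]. *)
Lemma energy_moments m : [/\ intgr P (energy m), Ex P (energy m) = \sum_(i < m) c i ^+ 2,
  intgr P (fun w => energy m w ^+ 2) & Ex P (fun w => energy m w ^+ 2) <= 3 * V ^+ 2].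
Proof.
have [ip e1 e2 _ _] := psum_moments hN m supported_sqr.
have i1 := ip 1%N isT; have i2 := ip 2%N isT.
set S := \sum_(i < m) c i ^+ 2.
have E1 w : psum N (fun i => c i ^+ 2) m w ^+ 1 + S = energy m w by rewrite energyE.
have E2 w : psum N (fun i => c i ^+ 2) m w ^+ 2 + (2 * S * psum N (fun i => c i ^+ 2) m w ^+ 1 + S ^+ 2)
   = energy m w ^+ 2 by rewrite energyE -/S expr1; ring.
have iS : intgr P (fun w => 2 * S * psum N (fun i => c i ^+ 2) m w ^+ 1 + S ^+ 2).
  by apply: intgrD; [exact: intgrZ|exact: intgr_cst].
split.
- by apply: (@eq_intgr _ _ _ P _ _ E1); apply: intgrD => //; exact: intgr_cst.
- by rewrite -(@eq_Ex _ _ _ P _ _ E1) ExD ?Ex_cst//; [rewrite e1 add0r|exact: intgr_cst].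
- by apply: (@eq_intgr _ _ _ P _ _ E2); exact: intgrD.
- have eS : Ex P (fun w => 2 * S * psum N (fun i => c i ^+ 2) m w ^+ 1 + S ^+ 2) = S ^+ 2.
    rewrite (ExD (intgrZ _ i1) (intgr_cst P _)) (ExZ _ i1) Ex_cst.
    by rewrite (_ : Ex P _ = 0) ?mulr0 ?add0r.
  rewrite -(@eq_Ex _ _ _ P _ _ E2) ExD// eS e2.
  have h1 := sum_fourth_le c m; rewrite -/S in h1.
  have -> : \sum_(i < m) (c i ^+ 2) ^+ 2 = \sum_(i < m) c i ^+ 4.
    by apply: eq_bigr => i _; rewrite -exprM.
  have S0 : 0 <= S by apply: sumr_ge0 => i _; exact: sqr_ge0.
  have SV : S <= V by exact: (sum_sqr_le cV).
  have : S ^+ 2 <= V ^+ 2 by rewrite lerXn2r ?nnegrE// (le_trans S0).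
  lra.
Qed.

Let energy_nd w : nondecreasing_seq (energy ^~ w).
Proof. by apply/nondecreasing_seqP => n; rewrite /energy big_ord_recr/= lerDl sqr_ge0. Qed.

Let integral_eenergy : (\int[P]_w eenergy w <= V%:E)%E.
Proof.
rewrite integral_nneseries//; first last.
- by move=> n w _; rewrite lee_fin sqr_ge0.
- move=> n; apply/measurable_EFinP; apply: measurable_funX.
  by apply: measurable_funM => //; exact: measurable_cst.
apply: lime_le; first by apply: is_cvg_nneseries => n _ _; apply: integral_ge0 => w _; rewrite lee_fin sqr_ge0.
apply: nearW => m; rewrite -ge0_integral_sum//; first last.
- by move=> n w _; rewrite lee_fin sqr_ge0.
- move=> n; apply/measurable_EFinP; apply: measurable_funX.
  by apply: measurable_funM => //; exact: measurable_cst.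
have [i1 e1 _ _] := energy_moments m.
under eq_integral do rewrite sumEFin big_mkord -/(energy m _).
by rewrite EFin_Ex// lee_fin e1; exact: (sum_sqr_le cV).
Qed.

(** The expectation of the series is at most [V]. *)
Lemma ae_finite_energy : {ae P, forall w, finite_energy w}.
Proof.
have iE : P.-integrable setT eenergy.
  apply/integrableP; split=> //.
  under eq_integral do rewrite gee0_abs//.
  by apply: le_lt_trans integral_eenergy _; rewrite ltry.
apply: filterS (integrable_ae measurableT iE) => w /(_ I).
by rewrite ge0_fin_numE.
Qed.

Lemma total_energy_ge0 w : 0 <= total_energy w. Proof. exact: fine_ge0. Qed.

(** Cut off outside [finite_energy], the partial energies converge and are dominated by
    [total_energy] at every point, as [Ex_dct] requires. *)
Let ienergy m w : R := energy m w * \1_finite_energy w.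

Let measurable_ind : measurable_fun setT (\1_finite_energy : T -> R).
Proof. by apply: measurable_indic; exact: measurable_finite_energy. Qed.

Let measurable_ienergy m : measurable_fun setT (ienergy m).
Proof. by apply: measurable_funM => //; exact: measurable_energy. Qed.

Let ienergy_ae m : {ae P, forall w, energy m w = ienergy m w}.
Proof.
by apply: filterS ae_finite_energy => w fw; rewrite /ienergy indicE mem_set// mulr1.
Qed.

Let energy_ge0 m w : 0 <= energy m w.
Proof. by apply: sumr_ge0 => i _; exact: sqr_ge0. Qed.

Let ienergy_le m w : 0 <= ienergy m w <= total_energy w.
Proof.
rewrite /ienergy indicE; case: (boolP (w \in finite_energy)) => [/set_mem fw|_].
  by rewrite mulr1 energy_ge0 energy_le.
by rewrite mulr0 lexx total_energy_ge0.
Qed.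

Let ienergy_cvg w : ienergy m w @[m --> \oo] --> total_energy w.
Proof.
rewrite /ienergy indicE; have [/set_mem fw|nw] := boolP (w \in finite_energy).
  by rewrite /=; under eq_fun do rewrite mulr1; exact: energy_cvg.
under eq_fun do rewrite mulr0.
rewrite /total_energy (_ : eenergy w = +oo%E); first exact: cvg_cst.
apply/eqP; rewrite -leye_eq leNgt; apply/negP => h; case/negP : nw; exact: mem_set.
Qed.

Lemma intgr_total_energy : [/\ intgr P total_energy, Ex P total_energy = V &
  intgr P (fun w => total_energy w ^+ 2)].
Proof.
have mt := measurable_total_energy.
have [i1 _] : intgr P total_energy /\ Ex P total_energy <= V.
  apply: ge0_intgr_le => //; first exact: total_energy_ge0.
  apply: le_trans integral_eenergy; apply: ge0_le_integral => //.
  - by move=> w _; rewrite lee_fin total_energy_ge0.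
  - exact/measurable_EFinP.
  - move=> w _; rewrite /total_energy; have := eenergy_ge0 w.
    by case: (eenergy w) => // r _; rewrite leey.
have [_ h1] := Ex_dct measurable_ienergy mt ienergy_cvg i1
  (fun m w => ltac:(have /andP[a b] := ienergy_le m w; by rewrite ger0_norm)).
split=> //.
- apply: (cvg_unique _ h1) => //.
  rewrite (_ : (fun n => _) = (fun m => \sum_(i < m) c i ^+ 2))//.
  apply/funext => m; have [j1 <- _ _] := energy_moments m.
  by have [_ ->] := Ex_ae j1 (measurable_ienergy m) (ienergy_ae m).
- have mt2 : measurable_fun setT (fun w => total_energy w ^+ 2) by exact: measurable_funX.
  have nn w : 0 <= total_energy w ^+ 2 by exact: sqr_ge0.
  suff h : (\int[P]_w (total_energy w ^+ 2)%:E <= (3 * V ^+ 2)%:E)%E.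
    exact: (ge0_intgr_le mt2 nn h).1.
  have cv : (\int[P]_w (ienergy m w ^+ 2)%:E)%E @[m --> \oo] --> (\int[P]_w (total_energy w ^+ 2)%:E)%E.
    rewrite [X in _ --> X](_ : _ = \int[P]_w (limn (fun m => (ienergy m w ^+ 2)%:E)))%E.
      apply: cvg_monotone_convergence => //.
      - by move=> n; apply/measurable_EFinP/measurable_funX.
      - by move=> n w _; rewrite lee_fin sqr_ge0.
      - move=> w _ m n mn; rewrite lee_fin lerXn2r ?nnegrE//.
        + by have /andP[] := ienergy_le m w.
        + by have /andP[] := ienergy_le n w.
        + by apply: ler_wpM2r; [rewrite indicE; case: (_ \in _)|exact: energy_nd].
    apply: eq_integral => w _; apply/esym/cvg_lim => //; apply: cvg_EFin; first exact: nearW.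
    rewrite expr2; rewrite (_ : _ \o _ = fun m => ienergy m w * ienergy m w).
      exact: cvgM.
    by apply/funext => m; rewrite /= expr2.
  rewrite -(cvg_lim _ cv)//; apply: lime_le; first by apply/cvg_ex; eexists; exact: cv.
  apply: nearW => m; have [_ _ j2 b2] := energy_moments m.
  have [j2' e2'] := @Ex_ae _ _ _ P _ (fun w => ienergy m w ^+ 2) j2
    (measurable_funX _ (measurable_ienergy m))
    ltac:(by apply: filterS (ienergy_ae m) => w /= ->).
  by rewrite EFin_Ex// lee_fin -e2'.
Qed.

Lemma energy_L1 : Ex P (fun w => total_energy w - energy m w) @[m --> \oo] --> 0.
Proof.
have [i1 e1 _] := intgr_total_energy.
rewrite (_ : (fun m => _) = (fun m => V - \sum_(i < m) c i ^+ 2)).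
  rewrite -[X in _ --> X](subrr V); apply: cvgB => //; exact: cvg_cst.
by apply/funext => m; have [j1 <- _ _] := energy_moments m; rewrite ExB// e1.
Qed.

Lemma energy_L2 : Ex P (fun w => (energy m w - total_energy w) ^+ 2) @[m --> \oo] --> 0.
Proof.
have mt := measurable_total_energy.
have [i1 e1 i2] := intgr_total_energy.
have md m : measurable_fun setT (fun w => (ienergy m w - total_energy w) ^+ 2).
  by apply/measurable_funX/measurable_funB.
have [_] := @Ex_dct _ _ _ P (fun m w => (ienergy m w - total_energy w) ^+ 2) (fun=> 0) _ md
  (measurable_cst (0 : R)) (fun w => ltac:(rewrite -[X in _ --> X](mulr0 (total_energy w - total_energy w)) -[X in _ * X](subrr (total_energy w));
    under eq_fun do rewrite expr2; apply: cvgM; apply: cvgB => //; exact: cvg_cst)) i2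
  (fun m w => ltac:(rewrite ger0_norm ?sqr_ge0//; have /andP[a b] := ienergy_le m w; nra)).
rewrite Ex0; apply: cvg_trans; apply: near_eq_cvg; apply: nearW => m.
have [_ _ j2 _] := energy_moments m.
have j : intgr P (fun w => (energy m w - total_energy w) ^+ 2).
  by apply: intgr_sqrB => //; exact: measurable_energy.
apply/esym; apply: (Ex_ae j (md m) _).2.
by apply: filterS (ienergy_ae m) => w /= ->.
Qed.

End Energy.

(** * Quadratic polynomials as smooth functionals *)

Section QuadraticForms.
Context (R : realType) (m : nat).

(** The family is stable under partial derivatives, so the condition on all iterated derivatives
    reduces to differentiability and growth of its members. *)
Definition quadratic (a : R) (b q : 'I_m -> R) (x : 'rV[R]_m) : R :=
  a + \sum_i b i * x 0 i + \sum_i q i * x 0 i ^+ 2.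

Lemma sum_delta (f : 'I_m -> R) j : \sum_i f i * (i == j)%:R = f j.
Proof.
rewrite (bigD1 j)//= eqxx mulr1 big1 ?addr0// => i /negbTE ->.
by rewrite mulr0.
Qed.

Lemma partial_quadratic j a b q :
  partial_derive j (quadratic a b q) =
  quadratic (b j) (fun i => 2 * q j * (i == j)%:R) (fun=> 0).
Proof.
apply/funext => x; rewrite /partial_derive /derive; apply: cvg_lim => //.
set L := quadratic (b j) _ _ x.
have LE : L = b j + 2 * q j * x 0 j.
  rewrite /L /quadratic [X in _ + X]big1 ?addr0 => [|i _]; last by rewrite mul0r.
  congr (_ + _); rewrite -(sum_delta (fun i => 2 * q j * x 0 i) j).
  by apply: eq_bigr => i _; rewrite mulrAC.
have cL : L + h * q j @[h --> 0^'] --> L.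
  rewrite -[X in _ --> X]addr0 -[X in _ + X](mul0r (q j)); apply: cvgD; first exact: cvg_cst.
  by apply: cvgMl; apply: cvg_within_filter; exact: cvg_id.
apply: cvg_trans cL; apply: near_eq_cvg; near=> h.
have h0 : h != 0 by near: h; exact: nbhs_dnbhs_neq.
have eb : \sum_i b i * (h *: delta_mx 0 j + x) 0 i = h * b j + \sum_i b i * x 0 i.
  rewrite -(sum_delta b j) mulr_sumr -big_split/=; apply: eq_bigr => i _.
  by rewrite !mxE eqxx/=; ring.
have eq : \sum_i q i * (h *: delta_mx 0 j + x) 0 i ^+ 2 =
    h ^+ 2 * q j + 2 * h * (q j * x 0 j) + \sum_i q i * x 0 i ^+ 2.
  have -> : h ^+ 2 * q j = h ^+ 2 * \sum_i q i * (i == j)%:R by rewrite sum_delta.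
  have -> : q j * x 0 j = \sum_i q i * x 0 i * (i == j)%:R by rewrite (sum_delta (fun i => q i * x 0 i)).
  rewrite !mulr_sumr -!big_split/=.
  by apply: eq_bigr => i _; rewrite !mxE eqxx/=; case: (i == j) => /=; ring.
rewrite /= /quadratic eb eq LE /GRing.scale/=; field.
Unshelve. all: by end_near.
Qed.

Lemma quadratic_differentiable a b q x : differentiable (quadratic a b q) x.
Proof.
have dc i : differentiable (fun y : 'rV[R]_m => y 0 i : R) x by exact: differentiable_coord.
have ds (f : 'I_m -> 'rV[R]_m -> R) : (forall i, differentiable (f i) x) ->
    differentiable (fun y => \sum_i f i y) x.
  move=> df; rewrite (_ : (fun y => _) = \sum_i f i); first exact: differentiable_sum.
  by apply/funext => y; rewrite fct_sumE.
apply: differentiableD; first apply: differentiableD.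
- exact: differentiable_cst.
- by apply: ds => i; apply: differentiableM => //; exact: differentiable_cst.
- apply: ds => i; apply: differentiableM; first exact: differentiable_cst.
  exact: (@differentiableX _ _ (fun y : 'rV[R]_m => y 0 i) 1).
Qed.

Lemma coord_le_norm (x : 'rV[R]_m) i : `|x 0 i| <= `|x|.
Proof.
rewrite [leRHS]/Num.Def.normr /= mx_normrE; apply/bigmax_geP; right => /=.
by exists (ord0, i).
Qed.

Lemma quadratic_growth a b q : exists (C : R) (k : nat),
  forall x, `|quadratic a b q x| <= C * (1 + `|x|) ^+ k.
Proof.
exists (`|a| + \sum_i `|b i| + \sum_i `|q i|), 2%N => x.
set t := 1 + `|x|; have t1 : 1 <= t by rewrite lerDl.
have t0 : 0 <= t by apply: le_trans t1.
have xt i : `|x 0 i| <= t by apply: le_trans (coord_le_norm x i) _; rewrite lerDr.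
have t2 : t <= t ^+ 2 by rewrite expr2 ler_peMl.
rewrite !mulrDl; apply: le_trans (ler_normD _ _) _; apply: lerD.
  apply: le_trans (ler_normD _ _) _; apply: lerD.
    by rewrite ler_peMr// (le_trans t1).
  apply: le_trans (ler_norm_sum _ _ _) _; rewrite mulr_suml; apply: ler_sum => i _.
  by rewrite normrM; apply: ler_wpM2l => //; exact: le_trans (xt i) t2.
apply: le_trans (ler_norm_sum _ _ _) _; rewrite mulr_suml; apply: ler_sum => i _.
rewrite normrM; apply: ler_wpM2l => //.
by rewrite normrX lerXn2r ?nnegrE.
Qed.

Lemma smooth_quadratic a b q : smooth_poly_growth (quadratic a b q).
Proof.
move=> s /=.
have [a' [b' [q' ->]]] : exists a' b' q',
    foldr (@partial_derive R m) (quadratic a b q) s = quadratic a' b' q'.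
  elim: s => [|j s [a' [b' [q' IH]]]] /=; first by exists a, b, q.
  rewrite IH partial_quadratic; by do 3 eexists.
by split; [move=> x; exact: quadratic_differentiable|exact: quadratic_growth].
Qed.

End QuadraticForms.

(** * The Gamma operator on the second chaos *)

Section GammaOperator.
Context (R : realType) d (T : measurableType d) (P : probability T R)
  (H : completeNormedModType R) (ip : H -> H -> R) (X : H -> {RV P >-> R}).
Hypotheses (hip : inner_product ip) (hX : isonormal ip X).
Variables (e : nat -> H) (c : nat -> R) (F : {RV P >-> R}) (V : R).
Hypothesis hF : second_chaos_series ip X e c F.
Hypotheses (cV : \sum_(i < m) c i ^+ 2 @[m --> \oo] --> V) (c0 : c 0%N != 0).

Definition nonzero (a : nat -> R) : pred nat := fun i => a i != 0.

Lemma supported_nonzero (a : nat -> R) : supported (nonzero a) a.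
Proof. by move=> i; rewrite /nonzero negbK => /eqP. Qed.

Let N i : T -> R := X (e i).
Let s := nonzero c.

Let he i j : s i -> s j -> ip (e i) (e j) = (i == j)%:R.
Proof. exact: hF.1. Qed.

Lemma second_chaos_family : gaussian_family P N s.
Proof. exact: (isonormal_family hX he). Qed.

Let hN := second_chaos_family.
Let sc : supported s c. Proof. exact: supported_nonzero. Qed.
Let fe : set T := finite_energy N c.

(** The indicator makes the sum of squares converge for every [w], so [chaos_derivative] is a
    genuine limit everywhere. *)
Let coef w i : R := 2 * c i * N i w * \1_fe w.

Let s_coef w : supported s (coef w).
Proof. by move=> i /sc ci; rewrite /coef ci mulr0 !mul0r. Qed.

Let coef_sqr w m : \sum_(i < m) coef w i ^+ 2 = 4 * energy N c m w * \1_fe w.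
Proof.
rewrite /energy mulrAC mulr_sumr; apply: eq_bigr => i _.
by rewrite /coef indicE; case: (w \in fe) => /=; ring.
Qed.

Let coef_cvg w : \sum_(i < m) coef w i ^+ 2 @[m --> \oo] --> 4 * total_energy N c w * \1_fe w.
Proof.
under eq_fun do rewrite coef_sqr.
rewrite indicE; have [/set_mem fw|_] := boolP (w \in fe).
  by rewrite mulr1; under eq_fun do rewrite mulr1; apply: cvgMr; exact: energy_cvg.
by rewrite mulr0; under eq_fun do rewrite mulr0; exact: cvg_cst.
Qed.

(* The almost sure limit of [D F_m = sum_(i < m) 2 c_i X(e_i) e_i]. *)
Definition chaos_derivative w : H := limn (fun m => \sum_(i < m) coef w i *: e i).
Let D := chaos_derivative.

Let D_cvg w : \sum_(i < m) coef w i *: e i @[m --> \oo] --> D w.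
Proof. exact: (ortho_cvg hip he (@s_coef w) (@coef_cvg w)). Qed.

Let D_norm w : ip (D w) (D w) = 4 * total_energy N c w * \1_fe w.
Proof. exact: (ortho_lim_norm hip he (@s_coef w) (@coef_cvg w) (@D_cvg w)). Qed.

Let measurable_ind : measurable_fun setT (\1_fe : T -> R).
Proof. by apply: measurable_indic; exact: (measurable_finite_energy hN). Qed.

Let measurable_D h : measurable_fun setT (fun w => ip (D w) h).
Proof.
apply: (@measurable_fun_cvg _ _ _ _ (fun m w => \sum_(i < m) coef w i * ip (e i) h)).
  move=> m; apply: measurable_sum => i; apply: measurable_funM; last exact: measurable_cst.
  by do 2 apply: measurable_funM => //; exact: measurable_cst.
move=> w _; have := cvg_ip hip (z := h) (@D_cvg w).
apply: cvg_trans; apply: near_eq_cvg; apply: nearW => m.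
rewrite (ip_suml hip m (fun i => coef w i *: e i)); apply: eq_bigr => i _.
by rewrite (ipZl hip).
Qed.

Let DF k w : H := \sum_(i < k) (2 * c i * N i w) *: e i.

(** Value of [|DF k - D|^2]: four times the energy of the tail where the energy is finite, and all
    of [|DF k|^2] on the null set where [D] is [0]. *)
Let gap k w : R := 4 * (total_energy N c w - energy N c k w) * \1_fe w +
  4 * energy N c k w * (1 - \1_fe w).

Let DF_dist k w : `|DF k w - D w| ^+ 2 = gap k w.
Proof.
have [fw|nw] := boolP (w \in fe).
  have h := ortho_lim_dist hip he k (@s_coef w) (@coef_cvg w) (@D_cvg w).
  rewrite coef_sqr indicE fw !mulr1 in h.
  rewrite /gap indicE fw subrr mulr0 addr0 mulr1 mulrBr -h; congr (`|_ - _| ^+ 2).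
  by apply: eq_bigr => i _; rewrite /coef indicE fw mulr1.
have D0 : D w = 0.
  apply: cvg_lim => //; rewrite (_ : (fun m => _) = cst 0); first exact: cvg_cst.
  by apply/funext => m; rewrite big1// => i _; rewrite /coef indicE (negbTE nw) mulr0 scale0r.
rewrite D0 subr0 /gap indicE (negbTE nw) mulr0 add0r subr0 mulr1.
have sa : supported s (fun i => 2 * c i * N i w) by move=> i /sc ->; rewrite mulr0 mul0r.
rewrite (ortho_norm hip he k sa) /energy mulr_sumr; apply: eq_bigr => i _; ring.
Qed.

Let gap_cvg : exists2 g : nat -> R, (forall k, intgr P (gap k) /\ Ex P (gap k) = g k) &
  g k @[k --> \oo] --> 0.
Proof.
have [i1 e1 _] := intgr_total_energy hN sc cV.
exists (fun k => 4 * Ex P (fun w => total_energy N c w - energy N c k w)); last first.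
  by rewrite -[X in _ --> X](mulr0 4); apply: cvgMr; exact: (energy_L1 hN sc cV).
move=> k; have [j1 _ _ _] := energy_moments hN sc cV k.
have iB : intgr P (fun w => total_energy N c w - energy N c k w) by exact: intgrB.
have mgap : measurable_fun setT (gap k).
  apply: measurable_funD; apply: measurable_funM => //.
  - by apply: measurable_funM; [exact: measurable_cst|exact: intgr_meas iB].
  - by apply: measurable_funM; [exact: measurable_cst|exact: intgr_meas j1].
  - by apply: measurable_funB => //; exact: measurable_cst.
rewrite -ExZ//.
have [? ->] := @Ex_ae _ _ _ P _ _ (intgrZ 4 iB) mgap
  ltac:(apply: filterS (ae_finite_energy hN sc cV) => w fw;
    by rewrite /gap indicE (mem_set fw) subrr mulr0 addr0 mulr1).
by [].
Qed.

(** The factor [r] treats together [F] itself, with [r = 1], and its image under the pseudo-inverse,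
    with [r = - 1/2]. The approximating functionals are the partial sums, quadratic in finitely many
    [X (e i)]. *)
Lemma chaos_malliavin (r : R) (G : {RV P >-> R}) : (forall w, G w = r * F w) ->
  malliavin_derivative ip X G (fun w => r *: D w).
Proof.
move=> GE; split.
  move=> h; rewrite (_ : (fun w => _) = (fun w => r * ip (D w) h)).
    by apply: measurable_funM; [exact: measurable_cst|exact: measurable_D].
  by apply/funext => w; rewrite (ipZl hip).
exists (fun k w => r * psum N c k w), (fun k w => r *: DF k w).
split.
- move=> k; exists k, (quadratic (- \sum_(i < k) r * c i) (fun=> 0) (fun i => r * c i)), (fun i => e i).
  split.
  + exact: smooth_quadratic.
  + move=> w; rewrite /quadratic [X in _ + X + _]big1 ?addr0 => [|i _]; last by rewrite mul0r.
    rewrite /psum mulr_sumr -sumrN -big_split/=; apply: eq_bigr => i _.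
    by rewrite (_ : gauss_vec X _ w 0 i = N i w) ?mxE// /chi; ring.
  + move=> w; rewrite /DF scaler_sumr; apply: eq_bigr => i _.
    rewrite partial_quadratic /quadratic [X in _ + _ + X]big1 ?addr0 => [|j _]; last by rewrite mul0r.
    rewrite add0r scalerA; congr (_ *: _).
    rewrite (bigD1 i)//= eqxx mulr1 big1 ?addr0 => [|j /negbTE ->]; last by rewrite mulr0 mul0r.
    by rewrite (_ : gauss_vec X _ w 0 i = N i w) ?mxE//; ring.
- have hL : L2_cvg P (psum N c) F := hF.2.
  have [mY mF iY iF hc] := L2_cvg_L2lim (fun k => measurable_psum hN c k) (measurable_funPT F)
    (fun k => ltac:(by have [h _ _ _ _] := psum_moments hN k sc; exact: h)) hL.
  have iB k : intgr P (fun w => (psum N c k w - F w) ^+ 2) by exact: intgr_sqrB.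
  have E k w : r ^+ 2 * (psum N c k w - F w) ^+ 2 = (r * psum N c k w - G w) ^+ 2.
    by rewrite GE; ring.
  rewrite /L2_cvg (_ : (fun k => _) = fun k => (r ^+ 2 * Ex P (fun w => (psum N c k w - F w) ^+ 2))%:E).
    by apply: cvg_EFin; [exact: nearW|rewrite -[X in _ --> X](mulr0 (r ^+ 2)); exact: cvgMr].
  apply/funext => k; rewrite unlock -ExZ// (@eq_Ex _ _ _ P _ _ (E k)) -EFin_Ex//.
  by apply: (@eq_intgr _ _ _ P _ _ (E k)); exact: intgrZ.
- have [g hg g0] := gap_cvg.
  rewrite (_ : (fun k => _) = fun k => (r ^+ 2 * g k)%:E).
    by apply: cvg_EFin; [exact: nearW|rewrite -[X in _ --> X](mulr0 (r ^+ 2)); exact: cvgMr].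
  apply/funext => k; have [ig <-] := hg k; rewrite unlock -ExZ// -EFin_Ex; last exact: intgrZ.
  apply: eq_integral => w _; congr EFin.
  by rewrite -scalerBr normrZ exprMn DF_dist real_normK ?num_real.
Qed.

(** On the second chaos the pseudo-inverse is multiplication by [- 1/2]; the decomposition of [F]
    has [F] in order two and [0] in all other orders. *)
Lemma chaos_OU (G : {RV P >-> R}) : (forall w, G w = - 2^-1 * F w) -> OU_pseudo_inverse X F G.
Proof.
move=> GE.
have [Z hZ] := @RV_of_measurable _ _ _ P (fun=> 0) (measurable_cst (0 : R)).
have n1 : `|e 0%N| = 1.
  have := he c0 c0; rewrite (ipxx hip) eqxx => /eqP.
  by rewrite sqrp_eq1// => /eqP.
have hE i : c i != 0 -> `|e i| = 1.
  by move=> ci; have := he ci ci; rewrite (ipxx hip) eqxx => /eqP; rewrite sqrp_eq1// => /eqP.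
have cvg_const (Y : nat -> T -> R) (W : T -> R) k : (forall m w, (k <= m)%N -> Y m w = W w) -> L2_cvg P Y W.
  move=> YW; rewrite /L2_cvg.
  apply: (@cvg_trans _ (cst (0 : \bar R) @ \oo)%E); last exact: cvg_cst.
  apply: near_eq_cvg; exists k => // m /= km; rewrite unlock.
  by rewrite integral0_eq// => w _; rewrite /= YW// subrr expr0n.
exists (fun p => if p == 2%N then F else Z); split.
- move=> p; case: eqP => [->|_].
  (* A unit vector is required at every index; where [c j] vanishes, [e 0] is substituted, which is
     normalized because [c 0] is nonzero. *)
  + exists (fun k => k), (fun k j => c j), (fun k j => if c j != 0 then e j else e 0%N); split.
      by move=> k j; case: ifPn => // /hE.
    apply: cvg_trans hF.2; apply: near_eq_cvg; apply: nearW => m; congr ('E_P[_])%E.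
    apply/funext => w; congr ((_ - _) ^+ 2); apply: eq_bigr => i _.
    have [->|ci] := eqVneq (c i) 0; first by rewrite !mul0r.
    congr (_ * _).
    have -> : hermite R 2 = 'X ^+ 2 - 1.
      by rewrite /= mulr1 -polyC1 derivC subr0 derivX expr2.
    by rewrite !hornerE.
  + exists (fun k => 0%N), (fun _ _ => 0), (fun _ _ => e 0%N); split=> //.
    by apply: (cvg_const _ _ 0%N) => m w _; rewrite big_ord0 hZ.
- apply: (cvg_const _ _ 3%N) => m w m3.
  rewrite (big_cat_nat (leq0n 3) m3)//= big_nat_recr//= big_nat_recr//= big_nat_recr//= big_geq//= !hZ.
  rewrite big_nat_cond big1 ?addr0 ?add0r// => p /andP[/andP[p3 _] _].
  by rewrite gtn_eqF// hZ.
- apply: (cvg_const _ _ 3%N) => m w m3.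
  rewrite (big_cat_nat (isT : 1 <= 3)%N m3)//= big_nat_recr//= big_nat_recr//= big_geq//= !hZ.
  rewrite big_nat_cond big1 ?addr0 ?add0r ?mulr0 ?add0r ?GE ?mulNr// => p /andP[/andP[p3 _] _].
  by rewrite gtn_eqF// hZ mulr0.
Qed.

(** The pairing of [D] with [D / 2] is half of the squared norm [4 total_energy]. *)
Lemma chaos_gamma (Gam : {RV P >-> R}) : (forall w, Gam w = 2 * total_energy N c w) ->
  gamma_operator ip X 1 F Gam.
Proof.
move=> GE.
have [LF hLF] := @RV_of_measurable _ _ _ P (fun w => - 2^-1 * F w)
  (measurable_funM (measurable_cst _) (measurable_funPT F)).
exists F, LF, D, (fun w => - 2^-1 *: D w); split.
- exact: aeW.
- by rewrite (_ : D = fun w => 1 *: D w); [apply: chaos_malliavin => w; rewrite mul1r|apply/funext => w; rewrite scale1r].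
- exact: chaos_OU.
- exact: chaos_malliavin.
- apply: filterS (ae_finite_energy hN sc cV) => w fw.
  rewrite GE scaleNr opprK (ipZr hip) D_norm indicE (mem_set fw) mulr1; by field.
Qed.

(** Since [c^2 N^2 - c (N^2 - 1) = (c^2 - c) (N^2 - 1) + c^2], the variable [Gam - 2 F] minus its
    mean [2 V] lies in the second chaos with coefficients [2 (c_i^2 - c_i)]. *)
Lemma chaos_gamma_variance (Gam : {RV P >-> R}) (Q : R) : (forall w, Gam w = 2 * total_energy N c w) ->
  \sum_(i < m) (c i ^+ 2 - c i) ^+ 2 @[m --> \oo] --> Q ->
  ('V_P[fun w => (Gam w - 2 * F w)%R] = (8 * Q)%:E)%E.
Proof.
move=> GE cQ.
pose b i := 2 * (c i ^+ 2 - c i).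
have sb : supported s b by move=> i /sc ci; rewrite /b ci expr0n subrr mulr0.
have bQ : \sum_(i < m) b i ^+ 2 @[m --> \oo] --> 4 * Q.
  rewrite (_ : (fun m => _) = (fun m => 4 * \sum_(i < m) (c i ^+ 2 - c i) ^+ 2)); first exact: cvgMr.
  by apply/funext => m; rewrite mulr_sumr; apply: eq_bigr => i _; rewrite /b; ring.
have [mc mF ic iF hc] := L2_cvg_L2lim (fun k => measurable_psum hN c k) (measurable_funPT F)
    (fun k => ltac:(by have [h _ _ _ _] := psum_moments hN k sc; exact: h)) hF.2.
have [i1 e1 i2] := intgr_total_energy hN sc cV.
have mt := intgr_meas i1.
pose Y w := 2 * total_energy N c w - 2 * F w - 2 * V.
have mY : measurable_fun setT Y.
  apply: measurable_funB; last exact: measurable_cst.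
  by apply: measurable_funB; apply: measurable_funM => //; exact: measurable_cst.
have iY2 : intgr P (fun w => Y w ^+ 2).
  have h1 : intgr P (fun w => (total_energy N c w - F w) ^+ 2) by exact: intgr_sqrB.
  have h2 : intgr P (fun w => (total_energy N c w - F w - V) ^+ 2).
    apply: intgr_sqrB => //; [exact: measurable_funB|exact: (intgr_cst P (V ^+ 2))].
  by apply: (@eq_intgr _ _ _ P _ _ _ (intgrZ 4 h2)) => w; rewrite /Y; ring.
have cvgY : L2_cvg P (psum N b) Y.
  (* [12 = 4 * 3]: the difference is [2 (p - q + r)], and the square of a sum of three terms is at
     most three times the sum of their squares. *)
  pose bd m := 12 * Ex P (fun w => (energy N c m w - total_energy N c w) ^+ 2) +
    12 * Ex P (fun w => (psum N c m w - F w) ^+ 2) + 12 * (V - \sum_(i < m) c i ^+ 2) ^+ 2.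
  have bd0 : bd m @[m --> \oo] --> 0.
    rewrite -[X in _ --> X](_ : 12 * 0 + 12 * 0 + 12 * ((V - V) * (V - V)) = 0); last by ring.
    apply: cvgD; first by apply: cvgD; apply: cvgMr => //; exact: (energy_L2 hN sc cV).
    apply: cvgMr; under eq_fun do rewrite expr2.
    by apply: cvgM; apply: cvgB => //; exact: cvg_cst.
  have ib m : intgr P (fun w => psum N b m w ^+ 2).
    by have [h _ _ _ _] := psum_moments hN m sb; exact: h.
  have mb m : measurable_fun setT (psum N b m) by exact: (measurable_psum hN).
  have iD m : intgr P (fun w => (psum N b m w - Y w) ^+ 2) by exact: intgr_sqrB.
  rewrite /L2_cvg (_ : (fun m => _) = fun m => (Ex P (fun w => (psum N b m w - Y w) ^+ 2))%:E); last first.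
    by apply/funext => m; rewrite unlock -EFin_Ex.
  apply: cvg_EFin; first exact: nearW.
  apply: (squeeze_cvgr _ (cvg_cst 0) bd0); apply: nearW => m /=.
  rewrite Ex_ge0/=; last by move=> w; exact: sqr_ge0.
  have [j1 _ j2 _] := energy_moments hN sc cV m.
  have k1 : intgr P (fun w => (energy N c m w - total_energy N c w) ^+ 2).
    by apply: intgr_sqrB => //; exact: intgr_meas j1.
  have k2 : intgr P (fun w => (psum N c m w - F w) ^+ 2) by exact: intgr_sqrB.
  rewrite /bd; set SV := V - _.
  have -> : 12 * Ex P (fun w => (energy N c m w - total_energy N c w) ^+ 2) +
      12 * Ex P (fun w => (psum N c m w - F w) ^+ 2) + 12 * SV ^+ 2 = Ex P (fun w => 12 * (energy N c m w - total_energy N c w) ^+ 2 +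
     12 * (psum N c m w - F w) ^+ 2 + 12 * SV ^+ 2).
    rewrite ExD ?Ex_cst//; [|by apply: intgrD; exact: intgrZ|exact: intgr_cst].
    by rewrite ExD ?ExZ//; exact: intgrZ.
  apply: le_Ex => //.
    by apply: intgrD; [by apply: intgrD; exact: intgrZ|exact: intgr_cst].
  move=> w.
  have -> : psum N b m w = 2 * energy N c m w - 2 * psum N c m w - 2 * \sum_(i < m) c i ^+ 2.
    rewrite energyE /psum /b !mulr_sumr -!sumrN -!big_split/=.
    by rewrite mulr_sumr -!big_split/=; apply: eq_bigr => i _; ring.
  set x := energy N c m w; set y := total_energy N c w; set u := psum N c m w; set v := F w.
  have -> : 2 * x - 2 * u - 2 * (\sum_(i < m) c i ^+ 2) - Y w = 2 * ((x - y) - (u - v) + SV).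
    by rewrite /Y /SV -/y -/v; ring.
  move: (x - y) (u - v) SV => p q r.
  have := sqr_ge0 (p + q); have := sqr_ge0 (p - r); have := sqr_ge0 (q + r); nra.
have [_ eY0 eY2 _ _] := chaos_moments hN sb mY bQ cvgY.
have E w : Gam w - 2 * F w = Y w + 2 * V by rewrite GE /Y; ring.
have iY : intgr P Y by exact: intgr_of_sqr.
rewrite (_ : (fun w => _) = (fun w => Y w + 2 * V)); last exact/funext.
rewrite (@variance_centered _ _ _ P _ (2 * V)).
- congr EFin; rewrite (@eq_Ex _ _ _ P _ (fun w => Y w ^+ 2)); first by rewrite eY2; ring.
  by move=> w; rewrite addrK.
- by apply: intgr_sqrD => //; exact: (intgr_cst P ((2 * V) ^+ 2)).
- by apply: measurable_funD => //; exact: measurable_cst.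
- by rewrite ExD ?Ex_cst ?eY0 ?add0r//; exact: intgr_cst.
Qed.

End GammaOperator.

(** * Mean value estimates and the class of test functions *)

Section RealFunctions.
Context (R : realType).
Implicit Types f h : R -> R.
Local Notation leb := (@lebesgue_measure R).

(** The mean value theorem without an order on [x] and [y], with the bounds on the intermediate
    point that Taylor estimates call for. *)
Lemma mvt_sqr f f' (x y : R) : (forall x : R, is_derive x (1 : R) f (f' x)) ->
  exists z, [/\ z ^+ 2 <= x ^+ 2 + y ^+ 2, `|z| <= `|x| + `|y|, `|z - x| <= `|y - x| &
    f y - f x = f' z * (y - x)].
Proof.
move=> df.
have cf (a b : R) : {within `[a, b], continuous f}.
  by apply: continuous_subspaceT; exact: continuous_is_derive df.
have H (a b z : R) : a <= z <= b -> [/\ z ^+ 2 <= a ^+ 2 + b ^+ 2, `|z| <= `|a| + `|b|,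
    `|z - a| <= `|b - a| & `|z - b| <= `|b - a|].
  move=> /andP[az zb]; split.
  - have [z0|z0] := leP 0 z.
      have : z ^+ 2 <= b ^+ 2 by rewrite lerXn2r ?nnegrE// (le_trans z0).
      by have := sqr_ge0 a; lra.
    have : (- z) ^+ 2 <= (- a) ^+ 2 by rewrite lerXn2r ?nnegrE; lra.
    by rewrite !sqrrN; have := sqr_ge0 b; lra.
  - have := ler_norm b; have := ler_norm (- a); rewrite normrN ler_norml.
    by have := normr_ge0 b; have := normr_ge0 a; lra.
  - rewrite !ger0_norm; lra.
  - by rewrite (ger0_norm (_ : 0 <= b - a)) ?ler_norml; lra.
have [xy|yx|->] := ltgtP x y.
- have [z] := MVT xy (fun u _ => df u) (cf x y); rewrite in_itv/= => /andP[xz zy] e.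
  exists z; have [] := H x y z ltac:(by rewrite !ltW) => h1 h2 h3 _.
  by split.
- have [z] := MVT yx (fun u _ => df u) (cf y x); rewrite in_itv/= => /andP[yz zx] e.
  exists z; have [] := H y x z ltac:(by rewrite !ltW) => h1 h2 _ h4.
  rewrite (addrC (x ^+ 2)) (addrC `|x|) (distrC y); split => //.
  by rewrite -opprB e; ring.
- exists y; rewrite !subrr mulr0 normr0; split => //; first by rewrite lerDl sqr_ge0.
  by rewrite lerDl.
Qed.

Lemma cvg_harmonic_dnbhs : (harmonic : nat -> R) @ \oo --> (0 : R)^'.
Proof.
move=> A hA; suff : \forall n \near \oo, A (harmonic n) by [].
have h : \forall n \near \oo, (harmonic n != 0 :> R -> A (harmonic n)) := @cvg_harmonic R _ hA.
by apply: filterS h => n; apply; rewrite gt_eqF// harmonic_gt0.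
Qed.

(** Sequential form of differentiability, suited to dominated convergence. *)
Lemma difference_quotient_cvg f (x : R) : derivable f x 1 ->
  (f (x + harmonic n) - f x) / harmonic n @[n --> \oo] --> derive1 f x.
Proof.
move=> df.
have : (fun t => t^-1 *: (f (t + x) - f x)) @ (0 : R)^' --> derive1 f x.
  suff : cvg ((fun t => t^-1 *: (f (t + x) - f x)) @ (0 : R)^') by [].
  move: df; rewrite /derivable; set g1 := (fun t : R => _); set g2 := (fun t : R => _).
  by rewrite (_ : g1 = g2)// funeqE => t; rewrite /g1 /g2 /= [t%:A](mulr1).
move=> h; have := cvg_comp _ _ cvg_harmonic_dnbhs h.
apply: cvg_trans; apply: near_eq_cvg; apply: nearW => n /=.
by rewrite (addrC x) mulrC.
Qed.

Lemma class_H2_is_derive h (x : R) : class_H2 h -> is_derive x (1 : R) h (derive1 h x).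
Proof. by move=> [dh _ _ _ _]; rewrite derive1E; exact: DeriveDef. Qed.

Lemma class_H2_lipschitz h : class_H2 h -> forall x y, `|h x - h y| <= `|x - y|.
Proof.
move=> hh x y; have [_ _ _ b _] := hh.
have [z [_ _ _ ->]] := mvt_sqr y x (fun u => class_H2_is_derive u hh).
by rewrite normrM ler_piMl.
Qed.

(* [h'(y) - h'(x)] is the limit of the integrals over [x, y] of the difference
   quotients of [h'], which are dominated by the Lipschitz constant of [h'] and
   eventually at most [1 + o(1)] almost everywhere. *)
Lemma class_H2_derive_lipschitz h : class_H2 h ->
  forall x y, `|derive1 h x - derive1 h y| <= `|x - y|.
Proof.
move=> hh; have [_ ch [K hK] _ ae1] := hh; set g := derive1 h in ch hK ae1 *.
suff H x y : x < y -> `|g y - g x| <= y - x.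
  move=> x y; have [xy|yx|->] := ltgtP x y; last by rewrite !subrr.
    by rewrite distrC (distrC x) (gtr0_norm (_ : 0 < y - x)) ?subr_gt0// H.
  by rewrite (gtr0_norm (_ : 0 < x - y)) ?subr_gt0// H.
move=> xy.
have gK u v : `|g u - g v| <= K * `|u - v| by exact: (hK (u, v)).
pose q n u := (g (u + harmonic n) - g u) / harmonic n.
have cq n : continuous (q n).
  apply: contM; last exact: cont_cst.
  apply: contD; last exact: contN.
  by apply: (cont_comp (g := g)) => //; apply: contD; [exact: cont_id|exact: cont_cst].
(* The maximum with [1] has limit exactly [1] almost everywhere, whereas [|q n u|] alone converges
   to an unspecified value at most [1]. *)
pose W n u := Num.max `|q n u| 1.
pose D : set (measurableTypeR R) := `[x, y]%classic.
have mD : measurable D by exact: measurable_itv.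
have mq n : measurable_fun setT (q n) by exact: continuous_measurable_fun.
have mW n : measurable_fun setT (fun u : measurableTypeR R => W n (u : R)).
  apply: measurable_maxr; last exact: measurable_cst.
  by apply: measurableT_comp_normr; exact: mq.
have qK n u : `|q n u| <= K.
  rewrite /q normrM normfV (gtr0_norm (harmonic_gt0 n)) ler_pdivrMr ?harmonic_gt0//.
  by have := gK (u + harmonic n) u; rewrite (addrC u) addrK (gtr0_norm (harmonic_gt0 n)).
have K0 : 0 <= K by apply: le_trans (qK 0%N 0).
have muD : leb D = (y - x)%:E by rewrite /D lebesgue_measure_itv/= lte_fin xy.
have cstD (r : R) : (\int[leb]_(u in D) r%:E = (r * (y - x))%:E)%E.
  rewrite (_ : \int[leb]_(u in D) r%:E = r%:E * leb D)%E; last exact: integral_cst.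
  by rewrite muD EFinM.
have cvgW : {ae leb, forall u, D u -> (fun n => (W n u)%:E) @ \oo --> (1 : R)%:E}.
  have af : Filter (nbhs (almost_everywhere leb)) by exact: (ae_filter_ringOfSetsType leb).
  apply: filterS ae1 => u [du b1] _; apply: cvg_EFin; first exact: nearW.
  have /cvgrPdist_le hd := difference_quotient_cvg du.
  apply/cvgrPdist_le => e e0; apply: filterS (hd e e0) => n /=.
  rewrite -/(q n u) /W distrC => hn.
  have w1 : 1 <= Num.max `|q n u| 1 by rewrite le_max lexx orbT.
  rewrite distrC ger0_norm ?subr_ge0//; case: (leP `|q n u| 1) => _; first by rewrite subrr ltW.
  by have := ler_normD (q n u - derive1 g u) (derive1 g u); rewrite subrK; lra.
have iK1 : leb.-integrable D (cst (K + 1)%:E).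
  apply/integrableP; split; first exact: measurable_cst.
  rewrite (_ : (fun x => _) = cst (K + 1)%:E); first by rewrite cstD ltry.
  by apply/funext => u; rewrite /= ger0_norm//; lra.
have WK : {ae leb, forall (u : measurableTypeR R) n, D u -> (`|(W n u)%:E| <= cst (K + 1)%:E u)%E}.
  apply: aeW => u n _; rewrite /= lee_fin ger0_norm ?le_max ?ler01 ?orbT//.
  by rewrite ge_max; have := qK n u; lra.
have mWD n : measurable_fun D (fun u => (W n u)%:E).
  by apply/measurable_EFinP; apply: measurable_funTS; exact: mW.
have [_ _ cW] := @dominated_convergence _ _ _ leb D mD (fun n u => (W n u)%:E) (cst 1%:E)
  (cst (K + 1)%:E) mWD (measurable_cst _) cvgW iK1 WK.
rewrite cstD mul1r in cW.
(* A primitive of [q n]: the integral of the difference quotients of [h'] is a difference of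
   quotients of [h], which tends to [g y - g x]. *)
pose G n u := (h (u + harmonic n) - h u) / harmonic n.
have dG n (u : R) : is_derive u (1 : R) (G n) (q n u).
  have d1 := class_H2_is_derive (u + harmonic n) hh.
  have d2 := class_H2_is_derive u hh.
  have ds : is_derive u (1 : R) (fun u : R => u + harmonic n) 1.
    by rewrite -[X in is_derive _ _ _ X]addr0; exact: is_deriveD.
  have dc := @is_derive1_comp _ h (fun u : R => u + harmonic n) u _ _ d1 ds.
  have db := @is_deriveB _ _ _ _ _ _ _ _ _ dc d2.
  apply: (is_derive_conv (@is_deriveZ _ _ _ _ (harmonic n)^-1 u 1 _ db)).
    by move=> v; rewrite /G /GRing.scale /= mulrC.
  by rewrite /q /GRing.scale /= mulr1 mulrC.
have ftc n : (\int[leb]_(u in D) (q n u)%:E = (G n y - G n x)%:E)%E.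
  rewrite (@continuous_FTC2 _ (q n) (G n) _ _ xy)//.
  - by apply: continuous_subspaceT; exact: cq.
  - have cG := continuous_is_derive (dG n).
    split; first by move=> u _; case: (dG n u).
      by apply: cvg_at_right_filter; exact: cG.
    by apply: cvg_at_left_filter; exact: cG.
  - by move=> u _; rewrite derive1E; case: (dG n u).
have le n : (`|G n y - G n x|%:E <= \int[leb]_(u in D) (W n u)%:E)%E.
  have mqD : measurable_fun D (fun u : measurableTypeR R => (q n u)%:E).
    by apply/measurable_EFinP; apply: measurable_funTS; exact: mq.
  rewrite (_ : (`|_|)%:E = `|\int[leb]_(u in D) (q n u)%:E|%E); last by rewrite ftc.
  apply: le_trans (le_abse_integral _ mD mqD) _.
  apply: ge0_le_integral => //.
  - exact: measurableT_comp mqD.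
  - by move=> u _; rewrite lee_fin le_max lexx.
have cG : `|G n y - G n x|%:E @[n --> \oo] --> `|g y - g x|%:E.
  apply: cvg_EFin; first exact: nearW; apply: cvg_norm; apply: cvgB.
    by apply: difference_quotient_cvg; case: hh.
  by apply: difference_quotient_cvg; case: hh.
rewrite -lee_fin -(cvg_lim _ cG)// -(cvg_lim _ cW)//; apply: lee_lim.
- by apply/cvg_ex; eexists; exact: cG.
- by apply/cvg_ex; eexists; exact: cW.
- exact: nearW.
Qed.

(** Heine's theorem with only [y] confined to the compact interval; [x] is merely close to [y]. *)
Lemma uniform_modulus f (M e : R) : continuous f -> 0 < e ->
  exists2 dl, 0 < dl & forall x y, `|y| <= M -> `|x - y| < dl -> `|f x - f y| <= e.
Proof.
move=> cf e0.
have /compact_near_coveringP nc := @segment_compact R (- M) M.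
have := nc R (0 : R)^'+ (fun i y => forall x, `|x - y| < i -> `|f x - f y| <= e) _ _.
case.
  move=> y _; have /cvgrPdist_lt := cf y => /(_ (e / 2) ltac:(by rewrite divr_gt0)).
  rewrite -filter_from_ballE => -[/= dl dl0 hd].
  have d2 : 0 < dl / 2 by rewrite divr_gt0.
  exists (ball y (dl / 2), [set i | i < dl / 2]) => /=.
    by split; [exact: nbhsx_ballx|exact: nbhs_right_lt].
  move=> [y' i] /= [hy' hi] x xy; rewrite -ball_normE/= in hy'.
  have h1 : `|f y - f y'| < e / 2 by apply: hd; rewrite -ball_normE/=; lra.
  have h2 : `|f y - f x| < e / 2.
    apply: hd; rewrite -ball_normE/=; have := ler_distD y' y x; rewrite (distrC y' x); lra.
  by have := ler_distD (f y) (f x) (f y'); rewrite (distrC (f x) (f y)); lra.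
move=> dl /= dl0 hd.
exists (dl / 2); first by rewrite divr_gt0.
move=> x y yM xy; apply: (hd (dl / 2)) => //=.
- by rewrite sub0r normrN gtr0_norm; lra.
- lra.
- by rewrite in_itv/= -ler_norml.
Unshelve. all: by end_near.
Qed.

(** If [|y| > M] the oscillation [2 B] is absorbed by [e y^2]; if [x] and [y] are far apart, by the
    term in [C]; otherwise continuity is uniform. Mean square closeness thus yields convergence in
    law. *)
Lemma bounded_continuous_le f (B e : R) : continuous f -> (forall x, `|f x| <= B) -> 0 < e ->
  exists2 C, 0 <= C & forall x y, `|f x - f y| <= e * (1 + y ^+ 2) + C * (x - y) ^+ 2.
Proof.
move=> cf fB e0.
have B0 : 0 <= B by apply: le_trans (fB 0).
have f2B x y : `|f x - f y| <= 2 * B.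
  by apply: le_trans (ler_normB _ _) _; have := fB x; have := fB y; lra.
pose M := 1 + 2 * B / e.
have M1 : 1 <= M by rewrite lerDl divr_ge0 ?mulr_ge0// ltW.
have [dl dl0 hd] := uniform_modulus M cf e0.
have dl2 : 0 <= 2 * B / dl ^+ 2 by rewrite divr_ge0 ?sqr_ge0// mulr_ge0.
exists (2 * B / dl ^+ 2) => //.
move=> x y; have C0 : 0 <= 2 * B / dl ^+ 2 * (x - y) ^+ 2.
  by rewrite mulr_ge0 ?sqr_ge0.
have y0 : 0 <= e * y ^+ 2 by rewrite mulr_ge0 ?sqr_ge0// ltW.
have [yM|My] := leP `|y| M; last first.
  have My2 : M <= y ^+ 2.
    rewrite -(real_normK (num_real y)); apply: (le_trans (ltW My)).
    by rewrite expr2 ler_peMl// (le_trans M1)// ltW.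
  have : 2 * B <= e * y ^+ 2.
    apply: le_trans (ler_wpM2l (ltW e0) My2).
    rewrite /M mulrDr mulrCA mulfV ?gt_eqF// !mulr1; lra.
  by have := f2B x y; lra.
have [xy|xy] := ltP `|x - y| dl.
  by have := hd x y yM xy; lra.
have : 2 * B <= 2 * B / dl ^+ 2 * (x - y) ^+ 2.
  have p : 0 < dl ^+ 2 by rewrite exprn_gt0.
  rewrite mulrAC ler_pdivlMr//; apply: ler_wpM2l; first by rewrite mulr_ge0.
  by rewrite -(real_normK (num_real (x - y))) lerXn2r ?nnegrE// ltW.
by have := f2B x y; lra.
Qed.

End RealFunctions.

(** * Convergence of the coefficients *)

Section Rounding.
Context (R : realType).
Implicit Types c : nat -> R.

Lemma sum_sqr_shift_cvg c (V : R) : \sum_(i < m) c i ^+ 2 @[m --> \oo] --> V ->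
  cvgn (fun m => \sum_(i < m) (c i ^+ 2 - c i) ^+ 2).
Proof.
move=> cV; apply: nondecreasing_is_cvgn.
  by apply/nondecreasing_seqP => n; rewrite big_ord_recr/= lerDl sqr_ge0.
exists (2 * V ^+ 2 + 2 * V) => _ [m _ <-].
have h1 := sum_fourth_le c m; have h2 := sum_sqr_le cV m.
have S0 : 0 <= \sum_(i < m) c i ^+ 2 by apply: sumr_ge0 => i _; exact: sqr_ge0.
have h3 : (\sum_(i < m) c i ^+ 2) ^+ 2 <= V ^+ 2 by rewrite lerXn2r ?nnegrE// (le_trans S0).
have : \sum_(i < m) (c i ^+ 2 - c i) ^+ 2 <= \sum_(i < m) (2 * c i ^+ 4 + 2 * c i ^+ 2).
  by apply: ler_sum => i _; have := sqr_ge0 (c i ^+ 2 + c i); lra.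
by rewrite big_split/= -!mulr_sumr; lra.
Qed.

Lemma sorted_coef_le c i j : sorted_coef c -> (i <= j)%N -> `|c j| <= `|c i|.
Proof.
move=> sc; elim: j => [|j IH]; first by rewrite leqn0 => /eqP ->.
rewrite leq_eqVlt => /predU1P[->//|ij].
by apply: le_trans (IH ij); have [] := sc j.
Qed.

(* If [sum_i c_i^2 (1 - c_i)^2] is small, every [c_i] is close to [0] or [1];
   by monotonicity those close to [1] come first. *)
Lemma sorted_coef_rounding c (V Q r : R) : sorted_coef c ->
  \sum_(i < m) c i ^+ 2 @[m --> \oo] --> V ->
  \sum_(i < m) (c i ^+ 2 - c i) ^+ 2 @[m --> \oo] --> Q ->
  Q <= r ^+ 2 -> 0 <= r <= 1 ->
  exists k : nat, `|V - k%:R| <= (32 * V + 4) * r /\ forall i, (i < k)%N -> `|1 - c i| <= 2 * r.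
Proof.
move=> sc cV cQ Qr /andP[r0 r1].
have c_to0 : c i ^+ 2 @[i --> \oo] --> 0.
  have h : \sum_(i < m.+1) c i ^+ 2 - \sum_(i < m) c i ^+ 2 @[m --> \oo] --> V - V.
    apply: cvgB => //.
    by have := cV; rewrite -(cvg_shiftS (fun m => \sum_(i < m) c i ^+ 2)).
  move: h; rewrite subrr; apply: cvg_trans; apply: near_eq_cvg; apply: nearW => m /=.
  by rewrite big_ord_recr/= addrAC subrr add0r.
have ex : exists i, `|c i| < 2^-1.
  move/cvgrPdist_lt : c_to0 => /(_ (2^-1 ^+ 2) ltac:(by rewrite exprn_gt0))[i _ hi].
  exists i; have := hi i (leqnn i); rewrite /= sub0r normrN normrX.
  by rewrite ltr_pXn2r ?nnegrE.
(* The value [1/2] separates [0] from [1]; sorting turns the first index below it into a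
   threshold. *)
case: (ex_minnP ex) => k ck kmin; exists k.
have big i : (i < k)%N -> 2^-1 <= `|c i|.
  by move=> ik; rewrite leNgt; apply/negP => /kmin; rewrite leqNgt ik.
have small i : (k <= i)%N -> `|c i| < 2^-1.
  by move=> ki; apply: le_lt_trans ck; exact: sorted_coef_le.
pose f i := (c i ^+ 2 - c i) ^+ 2.
have fQ m : \sum_(i < m) f i <= Q.
  rewrite -(cvg_lim _ cQ)//; apply: nondecreasing_cvgn_le; last by apply/cvg_ex; exists Q.
  by apply/nondecreasing_seqP => n; rewrite big_ord_recr/= lerDl sqr_ge0.
have f1 i : f i <= r ^+ 2.
  apply: le_trans Qr; apply: le_trans (fQ i.+1); rewrite big_ord_recr/= lerDr.
  by apply: sumr_ge0 => j _; exact: sqr_ge0.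
have near1 i : (i < k)%N -> `|1 - c i| <= 2 * r.
  move=> ik; rewrite -(ler_pXn2r (ltn0Sn 1)) ?nnegrE ?mulr_ge0// real_normK ?num_real//.
  have h1 : 2^-1 ^+ 2 <= c i ^+ 2.
    by rewrite -(real_normK (num_real (c i))) lerXn2r ?nnegrE// big.
  have := f1 i; rewrite /f (_ : (c i ^+ 2 - c i) ^+ 2 = c i ^+ 2 * (1 - c i) ^+ 2); last by ring.
  have := ler_wpM2r (sqr_ge0 (1 - c i)) h1; rewrite exprVn exprMn; lra.
split=> //.
have tail i : (k <= i)%N -> c i ^+ 2 <= 4 * f i.
  move=> /small ci; have c1 : 2^-1 ^+ 2 <= (1 - c i) ^+ 2.
    by rewrite lerXn2r ?nnegrE//; move: ci; rewrite ltr_norml; lra.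
  rewrite /f (_ : (c i ^+ 2 - c i) ^+ 2 = c i ^+ 2 * (1 - c i) ^+ 2); last by ring.
  by have := ler_wpM2l (sqr_ge0 (c i)) c1; rewrite exprVn; lra.
have head i : (i < k)%N -> `|c i ^+ 2 - 1| <= 8 * r.
  move=> ik; have h := near1 i ik.
  rewrite (_ : c i ^+ 2 - 1 = - (1 - c i) * (2 - (1 - c i))); last by ring.
  rewrite normrM normrN; have h2 : `|2 - (1 - c i)| <= 4.
    by apply: le_trans (ler_normB _ _) _; rewrite ger0_norm//; lra.
  have -> : 8 * r = (2 * r) * 4 by ring.
  by apply: ler_pM.
have V0 : 0 <= V by apply: le_trans (sum_sqr_le cV 0); rewrite big_ord0.
have r2 : r ^+ 2 <= r by rewrite expr2 ler_piMr.
have k4V : k%:R <= 4 * V.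
  have h : k%:R * 4^-1 <= \sum_(i < k) c i ^+ 2.
    rewrite mulr_natl -[k in _ *+ k]card_ord -sumr_const; apply: ler_sum => i _.
    rewrite -(real_normK (num_real (c i))).
    have := lerXn2r 2 (_ : 2^-1 \in Num.nneg) (_ : `|c i| \in Num.nneg) (big i (ltn_ord i)).
    by rewrite !nnegrE exprVn => /(_ ltac:(by []) ltac:(by [])); lra.
  by have := sum_sqr_le cV k; lra.
(* The head contributes [k (8 r)], at most [32 V r] as [k <= 4 V]; the tail contributes
   [4 r^2 <= 4 r]. *)
have bnd m : (k <= m)%N -> `|\sum_(i < m) c i ^+ 2 - k%:R| <= (32 * V + 4) * r.
  move=> km.
  have hk : `|\sum_(i < k) c i ^+ 2 - k%:R| <= k%:R * (8 * r).
    rewrite -[in X in `|_ - X|](card_ord k) -sumr_const -sumrB.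
    apply: le_trans (ler_norm_sum _ _ _) _; rewrite -[k in k%:R]card_ord mulr_natl -sumr_const.
    by apply: ler_sum => i _; exact: head.
  have ht : 0 <= \sum_(i < m) c i ^+ 2 - \sum_(i < k) c i ^+ 2 <= 4 * r ^+ 2.
    have := sum_tail c km (isT : 0 < 2)%N => <-.
    rewrite sumr_ge0/=; last by move=> i _; exact: sqr_ge0.
    apply: (@le_trans _ _ (\sum_(i < m) 4 * f i)).
      apply: ler_sum => i _; case: (leqP k i) => [ki|_]; first by rewrite mul1r; exact: tail.
      by rewrite mul0r expr0n mulr_ge0// sqr_ge0.
    by rewrite -mulr_sumr; have := fQ m; lra.
  have hkr := ler_wpM2r r0 k4V.
  have -> : \sum_(i < m) c i ^+ 2 - k%:R = (\sum_(i < k) c i ^+ 2 - k%:R) +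
    (\sum_(i < m) c i ^+ 2 - \sum_(i < k) c i ^+ 2) by ring.
  apply: le_trans (ler_normD _ _) _; case/andP: ht => t0 t1; rewrite (ger0_norm t0); lra.
have cN : `|\sum_(i < m) c i ^+ 2 - k%:R| @[m --> \oo] --> `|V - k%:R|.
  by apply: cvg_norm; apply: cvgB => //; exact: cvg_cst.
rewrite -(cvg_lim _ cN)//; apply: limr_le; first by apply/cvg_ex; eexists; exact: cN.
by exists k => // m /= km; exact: bnd.
Qed.

(** The integer given by rounding depends on [n] and on the precision. Two integers within [1/4] of
    [V] coincide, so a single [k] serves, and arbitrary precision gives [V = k]. *)
Lemma sorted_coef_integer (c : nat -> nat -> R) (V : R) (Q : nat -> R) :
  (forall n, sorted_coef (c n)) ->
  (forall n, \sum_(i < m) c n i ^+ 2 @[m --> \oo] --> V) ->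
  (forall n, \sum_(i < m) (c n i ^+ 2 - c n i) ^+ 2 @[m --> \oo] --> Q n) ->
  Q n @[n --> \oo] --> 0 ->
  exists k : nat, V = k%:R /\ forall e, 0 < e -> exists n0 : nat, forall n, (n0 <= n)%N ->
    forall i, (i < k)%N -> `|1 - c n i| <= e.
Proof.
move=> sc cV cQ Q0.
have V0 : 0 <= V by apply: le_trans (sum_sqr_le (cV 0%N) 0); rewrite big_ord0.
have H e : 0 < e -> exists n0 : nat, forall n, (n0 <= n)%N ->
    exists k : nat, `|V - k%:R| <= e /\ forall i, (i < k)%N -> `|1 - c n i| <= e.
  move=> e0; pose r := Num.min 1 (e / (32 * V + 4)).
  have d0 : 0 < 32 * V + 4 by lra.
  have r0 : 0 < r by rewrite lt_min ltr01 divr_gt0.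
  have r1 : r <= 1 by rewrite ge_min lexx.
  have re : (32 * V + 4) * r <= e by rewrite mulrC -ler_pdivlMr// ge_min lexx orbT.
  have r2 : 0 < r ^+ 2 by rewrite exprn_gt0.
  move/cvgrPdist_le : Q0 => /(_ _ r2)[n0 _ hn0]; exists n0 => n nn.
  have := hn0 n nn; rewrite /= sub0r normrN => /(le_trans (ler_norm _)) Qr.
  have [|k [h1 h2]] := sorted_coef_rounding (sc n) (cV n) (cQ n) Qr; first by rewrite ltW.
  exists k; split; first exact: le_trans re.
  move=> i /h2; have : 0 <= V * r by rewrite mulr_ge0// ltW.
  by move=> ? /le_trans; apply; lra.
have [n0 /(_ n0 (leqnn n0))[k [hk _]]] := H 4^-1 ltac:(by []).
have uniq k' : `|V - k'%:R| <= 4^-1 -> k' = k.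
  move=> hk'; have : `|k'%:R - k%:R : R| < 1.
    by have := ler_distD V k'%:R k%:R; rewrite (distrC _ V); lra.
  have [kk|kk|->//] := ltngtP k' k.
    by rewrite distrC -natrB ?(ltnW kk)// normr_nat ltrn1 ltnS leqn0 subn_eq0 leqNgt kk.
  by rewrite -natrB ?(ltnW kk)// normr_nat ltrn1 ltnS leqn0 subn_eq0 leqNgt kk.
exists k; split.
  apply/eqP; rewrite -subr_eq0 -normr_eq0 eq_le normr_ge0 andbT; apply/ler_addgt0Pr => e e0.
  have [n1 /(_ n1 (leqnn n1))[k' [h1 _]]] := H (Num.min e 4^-1) ltac:(by rewrite lt_min e0 invr_gt0 ltr0n).
  move: h1; rewrite le_min => /andP[h1 h2]; rewrite -(uniq _ h2) add0r//.
move=> e e0; have [n1 h] := H (Num.min e 4^-1) ltac:(by rewrite lt_min e0 invr_gt0 ltr0n).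
exists n1 => n /h[k' []]; rewrite le_min => /andP[_ h2] h3 i; rewrite -(uniq _ h2) => /h3.
by rewrite le_min => /andP[].
Qed.

End Rounding.

(** * The sine minus its cubic Taylor polynomial *)

Section SinRemainder.
Context (R : realType).
Implicit Types t x y u : R.

Lemma cos_lipschitz u : `|1 - cos u| <= `|u|.
Proof.
have [z [_ _ _ e]] := mvt_sqr u 0 (fun x => is_derive_cos x).
have := e; rewrite cos0 sub0r mulrN mulNr opprK => ->.
by rewrite normrM ler_piMl// ler_norml sin_geN1 sin_le1.
Qed.

(** A quadratic bound, below the true cubic order: it gives [|sinr2 t x| <= t^4 x^2] and thus keeps
    every remainder within reach of fourth moments. *)
Lemma sin_dist u : `|u - sin u| <= u ^+ 2.
Proof.
have df x : is_derive x (1 : R) (fun x => x - sin x) (1 - cos x).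
  by exact: is_deriveB.
have [z [_ _ zu e]] := mvt_sqr 0 u df.
rewrite sin0 !subr0 in zu e; rewrite e normrM.
apply: (@le_trans _ _ (`|u| * `|u|)); last by rewrite -expr2 real_normK ?num_real.
by apply: ler_wpM2r => //; apply: le_trans (cos_lipschitz z) zu.
Qed.

(** The remainder in the lower bound; [sinr1] and [sinr2] are its first and second derivatives in
    [x]. *)
Definition sinr t x := sin (t * x) - t * x + t ^+ 3 / 6 * x ^+ 3.
Definition sinr1 t x := t * cos (t * x) - t + t ^+ 3 / 2 * x ^+ 2.
Definition sinr2 t x := t ^+ 2 * (t * x - sin (t * x)).

Lemma is_derive_cubic (a b x : R) :
  is_derive x (1 : R) (fun x => a * x + b * x ^+ 3) (a + 3 * b * x ^+ 2).
Proof.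
pose p : {poly R} := a *: 'X + b *: 'X^3.
apply: (is_derive_conv (is_derive_poly p x)); first by move=> y; rewrite /p !hornerE.
by rewrite /p derivD !derivZ derivX derivXn !hornerE/=; ring.
Qed.

Lemma is_derive_sinr t x : is_derive x (1 : R) (sinr t) (sinr1 t x).
Proof.
apply: (is_derive_conv (@is_deriveD _ _ _ _ _ _ _ _ _ (is_derive_sin_lin t x)
  (is_derive_cubic (- t) (t ^+ 3 / 6) x))).
  by move=> y; rewrite addrfctE /sinr; ring.
by rewrite /sinr1; field.
Qed.

Lemma is_derive_sinr1 t x : is_derive x (1 : R) (sinr1 t) (sinr2 t x).
Proof.
pose p : {poly R} := (t ^+ 3 / 2) *: 'X^2 - t%:P.
have hp : is_derive x (1 : R) (fun x => t ^+ 3 / 2 * x ^+ 2 - t) (t ^+ 3 * x).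
  apply: (is_derive_conv (is_derive_poly p x)); first by move=> y; rewrite /p !hornerE.
  by rewrite /p derivB derivC !derivZ derivXn !hornerE/=; field.
have hc := @is_deriveZ _ _ _ _ t x 1 _ (is_derive_cos_lin t x).
apply: (is_derive_conv (@is_deriveD _ _ _ _ _ _ _ _ _ hc hp)).
  by move=> y; rewrite addrfctE /sinr1 /= /GRing.scale /=; ring.
by rewrite /sinr2 /GRing.scale /=; ring.
Qed.

Lemma sinr1_dist t x y : 0 <= t ->
  `|sinr1 t y - sinr1 t x| <= t ^+ 4 * (x ^+ 2 + y ^+ 2) * `|y - x|.
Proof.
move=> t0; have [z [z2 _ _ ->]] := mvt_sqr x y (is_derive_sinr1 t).
rewrite normrM; apply: ler_wpM2r => //; rewrite /sinr2 normrM ger0_norm ?sqr_ge0//.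
apply: le_trans (ler_wpM2l (sqr_ge0 t) (sin_dist (t * z))) _.
rewrite (_ : t ^+ 2 * (t * z) ^+ 2 = t ^+ 4 * z ^+ 2); last by ring.
by apply: ler_wpM2l => //; exact: exprn_ge0.
Qed.

Lemma sinr1_le t x : 0 <= t -> `|sinr1 t x| <= t ^+ 4 * `|x| ^+ 3.
Proof.
move=> t0; have := sinr1_dist 0 x t0.
have -> : sinr1 t 0 = 0 by rewrite /sinr1 mulr0 cos0; ring.
rewrite !subr0 expr0n add0r => /le_trans; apply.
by rewrite -(real_normK (num_real x)) -mulrA -exprSr.
Qed.

Lemma sinr_dist t x y : 0 <= t ->
  `|sinr t y - sinr t x| <= t ^+ 4 * (`|x| + `|y|) ^+ 3 * `|y - x|.
Proof.
move=> t0; have [z [_ zn _ ->]] := mvt_sqr x y (is_derive_sinr t).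
rewrite normrM; apply: ler_wpM2r => //; apply: le_trans (sinr1_le z t0) _.
by apply: ler_wpM2l; rewrite ?exprn_ge0// lerXn2r ?nnegrE// addr_ge0.
Qed.

Lemma sinr_le t x : 0 <= t -> `|sinr t x| <= t ^+ 4 * x ^+ 4.
Proof.
move=> t0; have := sinr_dist 0 x t0.
have -> : sinr t 0 = 0 by rewrite /sinr mulr0 sin0; ring.
rewrite !subr0 normr0 add0r -mulrA -exprSr => /le_trans; apply.
by rewrite -normrX ger0_norm// (exprM _ 2 2) sqr_ge0.
Qed.

(** The term linear in [y] stays explicit because its expectation vanishes when [x] is the head and
    [y] the tail; the rest is of order two in [y]. *)
Lemma sinr_taylor t x y : 0 <= t ->
  `|sinr t (x + y) - sinr t x - sinr1 t x * y| <= t ^+ 4 * (4 * (x ^+ 2 * y ^+ 2) + 2 * y ^+ 4).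
Proof.
move=> t0; have [z [z2 _ zx e]] := mvt_sqr x (x + y) (is_derive_sinr t).
rewrite e addrAC subrr add0r -mulrBl normrM.
rewrite addrAC subrr add0r in zx.
apply: le_trans (ler_wpM2r (normr_ge0 y) (sinr1_dist x z t0)) _.
have y2 : `|z - x| * `|y| <= y ^+ 2.
  by rewrite -(real_normK (num_real y)) expr2; apply: ler_wpM2r.
have p0 : 0 <= t ^+ 4 * (x ^+ 2 + z ^+ 2) by rewrite mulr_ge0 ?exprn_ge0// addr_ge0 ?sqr_ge0.
apply: (@le_trans _ _ (t ^+ 4 * (x ^+ 2 + z ^+ 2) * y ^+ 2)).
  by rewrite -[leLHS]mulrA; exact: ler_wpM2l.
rewrite -mulrA; apply: ler_wpM2l; first exact: exprn_ge0.
have : x ^+ 2 + z ^+ 2 <= 4 * x ^+ 2 + 2 * y ^+ 2 by have := sqr_ge0 (x - y); lra.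
move/(ler_wpM2r (sqr_ge0 y)); lra.
Qed.

Lemma continuous_sinr1 t : continuous (sinr1 t).
Proof. exact: continuous_is_derive (is_derive_sinr1 t). Qed.

End SinRemainder.

(** * Comparison of the head and the tail *)

Section HeadTail.
Context (R : realType) d (T : measurableType d) (P : probability T R).
Variables (N : nat -> T -> R) (s : pred nat).
Hypothesis hN : gaussian_family P N s.
Variables (c : nat -> R) (k : nat) (F : T -> R).
Hypotheses (sc : supported s c) (sk : forall i, (i < k)%N -> s i).
Hypotheses (mF : measurable_fun setT F).
Hypothesis cV : \sum_(i < m) c i ^+ 2 @[m --> \oo] --> (k%:R : R).
Hypothesis cF : L2_cvg P (psum N c) F.
Variable om : R.
Hypothesis hom : forall i, (i < k)%N -> `|1 - c i| <= om.
Hypothesis om0 : 0 <= om.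

Let A : T -> R := psum N c k.
Let G : T -> R := psum N (@head_ind R k) k.
Let Tm m w : R := psum N c m w - A w.
Let theta : R := k%:R - \sum_(i < k) c i ^+ 2.
Let sh := @supported_head_ind R k s sk.
Let mA : measurable_fun setT A := measurable_psum hN c k.
Let mG : measurable_fun setT G := measurable_psum hN (@head_ind R k) k.
Let mP m : measurable_fun setT (psum N c m) := measurable_psum hN c m.
Let nN i : s i -> std_normal P (N i). Proof. by have [_ h _] := hN; exact: h. Qed.
Let iP m j : (j <= 4)%N -> intgr P (fun w => psum N c m w ^+ j).
Proof. by have [h _ _ _ _] := psum_moments hN m sc; exact: h. Qed.
Let iG j : (j <= 4)%N -> intgr P (fun w => G w ^+ j).
Proof. by have [h _ _ _ _] := psum_moments hN k sh; exact: h. Qed.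

Lemma head_tail_cross (g : R -> R) m : (k <= m)%N -> measurable_fun setT g ->
  intgr P (fun w => g (A w)) ->
  intgr P (fun w => g (A w) * Tm m w) /\ Ex P (fun w => g (A w) * Tm m w) = 0.
Proof.
move=> km mg ig; rewrite /Tm -(subnKC km); elim: (m - k)%N => [|j [i1 e1]].
  have E w : 0 = g (A w) * (psum N c (k + 0) w - A w) by rewrite addn0 subrr mulr0.
  split; first by apply: (@eq_intgr _ _ _ P _ _ E); exact: intgr0.
  by rewrite -(@eq_Ex _ _ _ P _ _ E) Ex0.
have E w : g (A w) * (psum N c (k + j) w - A w) + c (k + j)%N * (g (A w) * chi (N (k + j)) w) =
   g (A w) * (psum N c (k + j.+1) w - A w) by rewrite addnS psumS; ring.
have [i2 e2] : intgr P (fun w => c (k + j)%N * (g (A w) * chi (N (k + j)) w)) /\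
    Ex P (fun w => c (k + j)%N * (g (A w) * chi (N (k + j)) w)) = 0.
  have [sj|/sc cj] := boolP (s (k + j)%N); last first.
    have E0 w : 0 = c (k + j)%N * (g (A w) * chi (N (k + j)) w) by rewrite cj mul0r.
    split; first by apply: (@eq_intgr _ _ _ P _ _ E0); exact: intgr0.
    by rewrite -(@eq_Ex _ _ _ P _ _ E0) Ex0.
  have [h e0 _ _ _] := chi_moments (nN sj).
  have [i3 e3] := @indep_psum_chi _ _ _ P N s hN c k (k + j)%N g id sc (leq_addr _ _) sj mg
    (@measurable_id _ _ setT) ig (h 1%N isT).
  split; first exact: intgrZ.
  rewrite ExZ// e3 (_ : Ex P (fun w => id (chi (N (k + j)) w)) = 0) ?mulr0//.
split; first by apply: (@eq_intgr _ _ _ P _ _ E); exact: intgrD.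
by rewrite -(@eq_Ex _ _ _ P _ _ E) ExD// e1 e2 addr0.
Qed.

Let tau m : R := \sum_(i < m) c i ^+ 2 - \sum_(i < k) c i ^+ 2.

Let tau_bounds m : (k <= m)%N -> 0 <= tau m <= theta.
Proof.
move=> km; rewrite /tau /theta subr_ge0 (sum_sqr_nd c km)/= lerD2r.
exact: (sum_sqr_le cV).
Qed.

Let TmE m w : (k <= m)%N -> Tm m w = psum N (fun i => (k <= i)%:R * c i) m w.
Proof. exact: psum_tail. Qed.

(** The mixed moment comes from [(A + T)^4 + (A - T)^4 = 2 A^4 + 12 A^2 T^2 + 2 T^4]: reversing the
    signs of the tail coefficients makes [A - T] a partial sum too, so [psum_moments] evaluates
    every term. *)
Lemma tail_moments m : (k <= m)%N -> [/\ intgr P (fun w => Tm m w ^+ 2),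
  Ex P (fun w => Tm m w ^+ 2) = 2 * tau m, intgr P (fun w => Tm m w ^+ 4),
  Ex P (fun w => Tm m w ^+ 4) <= 60 * tau m ^+ 2 &
  intgr P (fun w => A w ^+ 2 * Tm m w ^+ 2) /\
  Ex P (fun w => A w ^+ 2 * Tm m w ^+ 2) = 4 * (\sum_(i < k) c i ^+ 2) * tau m].
Proof.
move=> km; pose tl i := (k <= i)%:R * c i; pose fl i := (1 - 2 * (k <= i)%:R) * c i.
have stl : supported s tl by exact: supported_tail.
have sfl : supported s fl by move=> i /sc ci; rewrite /fl ci mulr0.
have E n w : psum N tl m w ^+ n = Tm m w ^+ n by rewrite TmE.
have [it _ t2 _ t4] := psum_moments hN m stl.
have [ic _ _ _ c4] := psum_moments hN m sc.
have [ia _ _ _ a4] := psum_moments hN k sc.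
have [jf _ _ _ f4] := psum_moments hN m sfl.
have s2 := sum_tail c km (isT : 0 < 2)%N; have s4 := sum_tail c km (isT : 0 < 4)%N.
rewrite -/tl in s2 s4.
have fl2 : \sum_(i < m) fl i ^+ 2 = \sum_(i < m) c i ^+ 2.
  by apply: eq_bigr => i _; rewrite /fl; case: (k <= i)%N => /=; ring.
have fl4 : \sum_(i < m) fl i ^+ 4 = \sum_(i < m) c i ^+ 4.
  by apply: eq_bigr => i _; rewrite /fl; case: (k <= i)%N => /=; ring.
have flE w : psum N fl m w = A w - Tm m w.
  have h : psum N fl m w = psum N c m w - 2 * psum N tl m w.
    by rewrite /psum mulr_sumr -sumrB; apply: eq_bigr => i _; rewrite /fl /tl; ring.
  by rewrite h -TmE// /Tm; ring.
have E12 w : 12^-1 * ((psum N c m w ^+ 4 + psum N fl m w ^+ 4) -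
    (2 * A w ^+ 4 + 2 * psum N tl m w ^+ 4)) = A w ^+ 2 * Tm m w ^+ 2.
  rewrite flE -TmE// (_ : psum N c m w = A w + Tm m w); last by rewrite /Tm; ring.
  by field.
have i1 := intgrD (ic 4%N isT) (jf 4%N isT).
have i2 := intgrD (intgrZ 2 (ia 4%N isT)) (intgrZ 2 (it 4%N isT)).
split.
- exact: (@eq_intgr _ _ _ P _ _ (E 2%N) (it 2%N isT)).
- by rewrite -(@eq_Ex _ _ _ P _ _ (E 2%N)) t2 s2.
- exact: (@eq_intgr _ _ _ P _ _ (E 4%N) (it 4%N isT)).
- rewrite -(@eq_Ex _ _ _ P _ _ (E 4%N)) t4; have := sum_fourth_le tl m.
  by rewrite s2 -/(tau m); lra.
- split; first by apply: (@eq_intgr _ _ _ P _ _ E12); apply: intgrZ; exact: intgrB.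
  rewrite -(@eq_Ex _ _ _ P _ _ E12) ExZ; last exact: intgrB.
  rewrite ExB// ExD; [|exact: (ic 4%N)|exact: (jf 4%N)].
  rewrite ExD; [|by apply: intgrZ; exact: (ia 4%N)|by apply: intgrZ; exact: (it 4%N)].
  rewrite !ExZ; [|exact: (it 4%N)|exact: (ia 4%N)].
  rewrite c4 f4 fl2 fl4 t4 s2 s4 a4.
  by rewrite /tau; field.
Qed.

(** Controls the head: [|A - G| <= om Q] and [|A| + |G| <= (k + 1) Q]. *)
Let Q w : R := \sum_(i < k) `|chi (N i) w|.

Let Q_ge0 w : 0 <= Q w. Proof. by apply: sumr_ge0. Qed.

Let mchi i : measurable_fun setT (chi (N i)) := measurable_chi hN i.

Let Q_head : intgr P Q /\ Ex P Q <= 2 * k%:R.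
Proof.
have h (i : 'I_k) : intgr P (fun w => `|chi (N i) w|) /\ Ex P (fun w => `|chi (N i) w|) <= 2.
  have [ic _ e2 _ _] := chi_moments (nN (sk (ltn_ord i))).
  have i1 := ic 1%N isT; have i2 := ic 2%N isT; split; first exact: intgr_norm i1.
  have b : 2 = Ex P (fun w => 1 + 2^-1 * chi (N i) w ^+ 2).
    by rewrite ExD ?Ex_cst ?ExZ ?e2//; [field|exact: intgr_cst|exact: intgrZ].
  rewrite b; apply: le_Ex; first exact: intgr_norm i1.
    by apply: intgrD; [exact: intgr_cst|exact: intgrZ].
  move=> w; rewrite -(real_normK (num_real (chi (N i) w))).
  have := sqr_ge0 (`|chi (N i) w| - 1); lra.
split; first exact: (@intgr_sum _ _ _ P _ _ (fun (i : 'I_k) w => `|chi (N i) w|) (fun i => (h i).1)).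
rewrite (@Ex_sum _ _ _ P _ _ (fun (i : 'I_k) w => `|chi (N i) w|) (fun i => (h i).1)).
by rewrite mulr_natr -[k in _ *+ k]card_ord -sumr_const; apply: ler_sum => i _; exact: (h i).2.
Qed.

(** Iterating [(a + b)^4 <= 8 (a^4 + b^4)] costs at most [8^k], and each [chi] has fourth moment
    [60]. *)
Let Q4_bound : R := 8 ^+ k * (60 * k%:R).

Let Q_fourth : intgr P (fun w => Q w ^+ 4) /\ Ex P (fun w => Q w ^+ 4) <= Q4_bound.
Proof.
have Qle w : Q w ^+ 4 <= 8 ^+ k * \sum_(i < k) chi (N i) w ^+ 4.
  rewrite /Q; elim: k => [|j IH]; first by rewrite !big_ord0 expr0n mulr0.
  rewrite !big_ord_recr/=.
  have p4 (a b : R) : (a + b) ^+ 4 <= 8 * (a ^+ 4 + b ^+ 4).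
    have : (a + b) ^+ 2 <= 2 * (a ^+ 2 + b ^+ 2) by have := sqr_ge0 (a - b); lra.
    have h0 : 0 <= (a + b) ^+ 2 by exact: sqr_ge0.
    move=> h1; have h2 : ((a + b) ^+ 2) ^+ 2 <= (2 * (a ^+ 2 + b ^+ 2)) ^+ 2.
      by rewrite lerXn2r ?nnegrE// (le_trans h0).
    rewrite (exprM _ 2 2); apply: le_trans h2 _.
    by have := sqr_ge0 (a ^+ 2 - b ^+ 2); lra.
  apply: le_trans (p4 _ _) _; rewrite [8 ^+ j.+1]exprS -mulrA; apply: ler_wpM2l => //.
  rewrite mulrDr; apply: lerD => //.
  rewrite -normrX ger0_norm; last by rewrite (exprM _ 2 2) sqr_ge0.
  apply: ler_peMl; first by rewrite (exprM _ 2 2) sqr_ge0.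
  by rewrite exprn_ege1// ler1n.
have h (i : 'I_k) : intgr P (fun w => chi (N i) w ^+ 4) /\ Ex P (fun w => chi (N i) w ^+ 4) = 60.
  by have [ic _ _ _ e4] := chi_moments (nN (sk (ltn_ord i))); split=> //; exact: ic.
have isum := @intgr_sum _ _ _ P _ (index_enum 'I_k) (fun (i : 'I_k) w => chi (N i) w ^+ 4) (fun i => (h i).1).
have mQ4 : measurable_fun setT (fun w => Q w ^+ 4).
  apply: measurable_funX; apply: measurable_sum => i; exact: measurableT_comp_normr.
have i4 : intgr P (fun w => Q w ^+ 4).
  apply: (@intgr_le _ _ _ P _ (fun w => 8 ^+ k * \sum_(i < k) chi (N i) w ^+ 4)) => //.
    by move=> w; rewrite ger0_norm// exprn_ge0.
  exact: intgrZ.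
split=> //; apply: le_trans (le_Ex i4 (intgrZ _ isum) Qle) _.
rewrite ExZ// (@Ex_sum _ _ _ P _ _ (fun (i : 'I_k) w => chi (N i) w ^+ 4) (fun i => (h i).1)).
rewrite /Q4_bound (eq_bigr (fun=> 60)); last by move=> i _; exact: (h i).2.
by rewrite sumr_const card_ord -[60 *+ k]mulr_natr.
Qed.

Let head_dist w : `|A w - G w| <= om * Q w.
Proof.
rewrite /A /G /psum -sumrB mulr_sumr; apply: le_trans (ler_norm_sum _ _ _) _.
apply: ler_sum => i _; rewrite /head_ind ltn_ord -mulrBl normrM; apply: ler_wpM2r => //.
by rewrite distrC; exact: hom.
Qed.

Let c_le i : `|c i| <= k%:R.
Proof.
have h : c i ^+ 2 <= k%:R.
  apply: le_trans (sum_sqr_le cV i.+1); rewrite big_ord_recr/= lerDr.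
  by apply: sumr_ge0 => j _; exact: sqr_ge0.
rewrite -(ler_pXn2r (ltn0Sn 1)) ?nnegrE// real_normK ?num_real//; apply: le_trans h _.
by rewrite -natrX ler_nat; case: (k) => // j; rewrite expnS expn1 leq_pmulr.
Qed.

Let head_size w : `|G w| + `|A w| <= (k%:R + 1) * Q w.
Proof.
rewrite addrC mulrDl mul1r; apply: lerD.
  rewrite mulr_sumr; apply: le_trans (ler_norm_sum _ _ _) _; apply: ler_sum => i _.
  by rewrite normrM; apply: ler_wpM2r.
apply: le_trans (ler_norm_sum _ _ _) _; apply: ler_sum => i _.
by rewrite normrM /head_ind ltn_ord normr1 mul1r.
Qed.

Lemma lipschitz_intgr (h : R -> R) (U : T -> R) : measurable_fun setT h ->
  (forall x y, `|h x - h y| <= `|x - y|) -> measurable_fun setT U ->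
  intgr P (fun w => U w ^+ 2) -> intgr P (fun w => h (U w)).
Proof.
move=> mh hl mU iU; apply: (@intgr_le _ _ _ P _ (fun w => `|h 0| + `|U w|)).
- exact: measurableT_comp.
- move=> w; have := hl (U w) 0; rewrite subr0.
  by have := ler_normD (h (U w) - h 0) (h 0); rewrite subrK; lra.
- by apply: intgrD; [exact: intgr_cst|apply: intgr_norm; exact: intgr_of_sqr].
Qed.

(* The first order term [E(h'(A) T)] of the expansion of [h(A + T)] vanishes by
   independence, so the tail only costs its variance. *)
Lemma Ex_class_H2_dist (h : R -> R) : class_H2 h ->
  intgr P (fun w => h (F w)) /\
  `|Ex P (fun w => h (F w)) - Ex P (fun w => h (G w))| <= 2 * theta + 2 * k%:R * om.
Proof.
move=> hh; have dh := fun x => class_H2_is_derive x hh.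
have hl := class_H2_lipschitz hh; have hl' := class_H2_derive_lipschitz hh.
have [_ ch' _ b1 _] := hh.
have mh : measurable_fun setT h by apply: continuous_measurable_fun; exact: continuous_is_derive dh.
have mh' : measurable_fun setT (derive1 h) by exact: continuous_measurable_fun.
have iL (U : T -> R) := @lipschitz_intgr h U mh hl.
have ihP m : intgr P (fun w => h (psum N c m w)) by apply: iL => //; exact: iP.
have ihG : intgr P (fun w => h (G w)) by apply: iL => //; exact: iG.
have [|_ [ihF hF]] := @L2lim_lipschitz _ _ _ P _ _ (chaos_L2lim hN sc mF cF) h 1 mh.
  by move=> x y; rewrite mul1r.
split=> //.
have hc : `|Ex P (fun w => h (psum N c m w)) - Ex P (fun w => h (G w))| @[m --> \oo] -->
    `|Ex P (fun w => h (F w)) - Ex P (fun w => h (G w))|.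
  by apply: cvg_norm; apply: cvgB => //; exact: cvg_cst.
rewrite -(cvg_lim _ hc)//; apply: limr_le; first by apply/cvg_ex; eexists; exact: hc.
exists k => // m /= km.
have [it2 et2 _ _ _] := tail_moments km; have /andP[_ tt] := tau_bounds km.
have id' : intgr P (fun w => derive1 h (A w)).
  by apply: (@intgr_bounded _ _ _ P 1) => //; exact: measurableT_comp.
have [ix ex] := head_tail_cross km mh' id'.
have E w : h (psum N c m w) - h (G w) =
    (h (psum N c m w) - h (A w) - derive1 h (A w) * Tm m w) + (derive1 h (A w) * Tm m w) + (h (A w) - h (G w)).
  by ring.
have ia : intgr P (fun w => h (psum N c m w) - h (A w)) by apply: intgrB => //; exact: (ihP k).
have ir : intgr P (fun w => h (psum N c m w) - h (A w) - derive1 h (A w) * Tm m w) by exact: intgrB.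
have ig : intgr P (fun w => h (A w) - h (G w)) by apply: intgrB => //; exact: (ihP k).
rewrite -ExB// (@eq_Ex _ _ _ P _ _ E) ExD//; last exact: intgrD.
rewrite ExD// ex addr0; apply: le_trans (ler_normD _ _) _; apply: lerD.
  apply: (@le_trans _ _ (Ex P (fun w => Tm m w ^+ 2))); last by rewrite et2; lra.
  apply: le_norm_Ex_le => // w.
  have [z [_ _ zx e]] := mvt_sqr (A w) (psum N c m w) dh.
  rewrite e -mulrBl normrM -(real_normK (num_real (Tm m w))) expr2; apply: ler_wpM2r => //.
  by apply: le_trans (hl' _ _) _; rewrite /Tm.
have [iq eq] := Q_head.
apply: (@le_trans _ _ (Ex P (fun w => om * Q w))).
  apply: le_norm_Ex_le => //; first exact: intgrZ.
  by move=> w; apply: le_trans (hl _ _) _; exact: head_dist.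
by rewrite ExZ// mulrC; apply: ler_wpM2r.
Qed.

(** Centering removes the linear Taylor term. *)
Lemma Ex_sinr (t : R) (U : T -> R) : 0 <= t -> measurable_fun setT U ->
  intgr P (fun w => U w ^+ 4) -> intgr P (fun w => U w ^+ 3) -> intgr P U -> Ex P U = 0 ->
  intgr P (fun w => sinr t (U w)) /\
  Ex P (fun w => sinr t (U w)) = Ex P (fun w => sin (t * U w)) + t ^+ 3 / 6 * Ex P (fun w => U w ^+ 3).
Proof.
move=> t0 mU i4 i3 i1 e1.
have isin : intgr P (fun w => sin (t * U w)).
  apply: (@intgr_bounded _ _ _ P 1) => [|w]; last by rewrite ler_norml sin_geN1 sin_le1.
  by apply: measurable_sin_comp; apply: measurable_funM => //; exact: measurable_cst.
have i := intgrD (intgrB isin (intgrZ t i1)) (intgrZ (t ^+ 3 / 6) i3).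
split=> //; rewrite ExD; [|by apply: intgrB => //; exact: intgrZ|exact: intgrZ].
by rewrite ExB//; [rewrite !ExZ// e1 mulr0 subr0|exact: intgrZ].
Qed.

(** [136 = 4 * 4 + 2 * 60] collects [E[A^2 T^2]] and [E[T^4]] in [sinr_taylor]; the second summand
    pays for replacing [A] by [G]. *)
Definition sin_const : R := 136 * k%:R + (k%:R + 1) ^+ 3 * Q4_bound.

Lemma sin_const_ge0 : 0 <= sin_const.
Proof. by rewrite addr_ge0// !mulr_ge0 ?exprn_ge0 ?addr_ge0. Qed.

(** The remainder undergoes the same head and tail comparison as the test functions of the upper
    bound. Its size is then proportional to [theta + om], so [t] can be fixed independently of
    [n]. *)
Lemma Ex_sin_gap (t : R) : 0 <= t ->
  `|Ex P (fun w => sin (t * F w)) - Ex P (fun w => sin (t * G w)) +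
    t ^+ 3 / 6 * (Ex P (fun w => F w ^+ 3) - 8 * k%:R)| <= t ^+ 4 * (sin_const * (theta + om)).
Proof.
move=> t0.
have eG3 : Ex P (fun w => G w ^+ 3) = 8 * k%:R.
  have [_ _ _ -> _] := psum_moments hN k sh; congr (_ * _).
  rewrite (eq_bigr (fun=> 1)) ?sumr_const ?card_ord// => i _.
  by rewrite /head_ind ltn_ord expr1n.
have [iF eF0 _ e3 _] := chaos_moments hN sc mF cV cF.
have eG0 : Ex P G = 0 by have [_ h _ _ _] := psum_moments hN k sh.
have eP0 m : Ex P (psum N c m) = 0 by have [_ h _ _ _] := psum_moments hN m sc.
have [iRG eRG] := Ex_sinr t0 mG (iG (isT : 4 <= 4)%N) (iG (isT : 3 <= 4)%N) (iG (isT : 1 <= 4)%N) eG0.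
have HP m := Ex_sinr t0 (mP m) (iP m (isT : 4 <= 4)%N) (iP m (isT : 3 <= 4)%N) (iP m (isT : 1 <= 4)%N) (eP0 m).
have ms : measurable_fun setT (fun x : R => sin (t * x)).
  by apply: continuous_measurable_fun; solve_continuous.
have [|_ [_ hsin]] := @L2lim_lipschitz _ _ _ P _ _ (chaos_L2lim hN sc mF cF) (fun x => sin (t * x)) t ms.
  move=> x y; have [z [_ _ _ ->]] := mvt_sqr y x (is_derive_sin_lin t).
  by rewrite !normrM (ger0_norm t0) -mulrA; apply: ler_wpM2l => //; rewrite ler_piMl// ler_norml cos_geN1 cos_le1.
have hc : `|Ex P (fun w => sinr t (psum N c m w)) - Ex P (fun w => sinr t (G w))| @[m --> \oo] -->
    `|Ex P (fun w => sin (t * F w)) - Ex P (fun w => sin (t * G w)) +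
    t ^+ 3 / 6 * (Ex P (fun w => F w ^+ 3) - 8 * k%:R)|.
  apply: cvg_norm; rewrite eRG eG3.
  rewrite [X in _ --> X](_ : _ = Ex P (fun w => sin (t * F w)) + t ^+ 3 / 6 * Ex P (fun w => F w ^+ 3) -
    (Ex P (fun w => sin (t * G w)) + t ^+ 3 / 6 * (8 * k%:R))); last by ring.
  apply: cvgB; last exact: cvg_cst.
  rewrite (_ : (fun m => _) = fun m => Ex P (fun w => sin (t * psum N c m w)) +
     t ^+ 3 / 6 * (8 * \sum_(i < m) c i ^+ 3)); first by apply: cvgD => //; exact: cvgMr.
  by apply/funext => m; rewrite (HP m).2; have [_ _ _ -> _] := psum_moments hN m sc.
rewrite -(cvg_lim _ hc)//; apply: limr_le; first by apply/cvg_ex; eexists; exact: hc.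
exists k => // m /= km.
have [it2 et2 it4 et4 [iat eat]] := tail_moments km; have /andP[tau0 tt] := tau_bounds km.
have mr1 : measurable_fun setT (sinr1 t) by apply: continuous_measurable_fun; exact: continuous_sinr1.
have id' : intgr P (fun w => sinr1 t (A w)).
  apply: (@intgr_le _ _ _ P _ (fun w => t ^+ 4 * (A w ^+ 2 + A w ^+ 4))).
  - exact: measurableT_comp.
  - move=> w; apply: le_trans (sinr1_le _ t0) _; apply: ler_wpM2l; first exact: exprn_ge0.
    rewrite (_ : A w ^+ 4 = `|A w| ^+ 4); last first.
      by rewrite -normrX ger0_norm// (exprM _ 2 2) sqr_ge0.
    rewrite -(real_normK (num_real (A w))); have := sqr_ge0 (`|A w| - `|A w| ^+ 2).
    by have : 0 <= `|A w| ^+ 2 + `|A w| ^+ 4; [rewrite addr_ge0// exprn_ge0|lra].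
  - by apply: intgrZ; apply: intgrD; exact: (iP k).
have [ix ex] := head_tail_cross km mr1 id'.
have E w : sinr t (psum N c m w) - sinr t (G w) =
    (sinr t (psum N c m w) - sinr t (A w) - sinr1 t (A w) * Tm m w) + (sinr1 t (A w) * Tm m w) +
    (sinr t (A w) - sinr t (G w)) by ring.
have ia : intgr P (fun w => sinr t (psum N c m w) - sinr t (A w)).
  by apply: intgrB; [exact: (HP m).1|exact: (HP k).1].
have ir : intgr P (fun w => sinr t (psum N c m w) - sinr t (A w) - sinr1 t (A w) * Tm m w) by exact: intgrB.
have ig : intgr P (fun w => sinr t (A w) - sinr t (G w)) by apply: intgrB => //; exact: (HP k).1.
rewrite -ExB//; last exact: (HP m).1.
rewrite (@eq_Ex _ _ _ P _ _ E) ExD//; last exact: intgrD.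
rewrite ExD// ex addr0; apply: le_trans (ler_normD _ _) _.
have t4 : 0 <= t ^+ 4 by exact: exprn_ge0.
have ak : 0 <= \sum_(i < k) c i ^+ 2 <= k%:R.
  rewrite (sum_sqr_le cV k) andbT; apply: sumr_ge0 => i _; exact: sqr_ge0.
have b1 : `|Ex P (fun w => sinr t (psum N c m w) - sinr t (A w) - sinr1 t (A w) * Tm m w)| <=
    t ^+ 4 * (136 * k%:R * theta).
  apply: (@le_trans _ _ (Ex P (fun w => t ^+ 4 * (4 * (A w ^+ 2 * Tm m w ^+ 2) + 2 * Tm m w ^+ 4)))).
    apply: le_norm_Ex_le => //.
      by apply: intgrZ; apply: intgrD; exact: intgrZ.
    by move=> w; have := sinr_taylor (A w) (Tm m w) t0; rewrite {1}/Tm addrCA subrr addr0.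
  rewrite ExZ; last by apply: intgrD; exact: intgrZ.
  apply: ler_wpM2l => //; rewrite ExD; [|exact: intgrZ|exact: intgrZ].
  rewrite !ExZ// eat; set a := \sum_(i < k) _ in ak *; case/andP: ak => a0 ak.
  have th : theta <= k%:R by rewrite /theta -/a; lra.
  have p1 : a * tau m <= k%:R * theta by apply: ler_pM.
  have p2 : tau m ^+ 2 <= k%:R * theta by rewrite expr2; apply: ler_pM => //; exact: le_trans th.
  move: et4 p1 p2; rewrite -!mulrA; lra.
have b2 : `|Ex P (fun w => sinr t (A w) - sinr t (G w))| <= t ^+ 4 * ((k%:R + 1) ^+ 3 * Q4_bound * om).
  have [i4 e4] := Q_fourth.
  have C0 : 0 <= t ^+ 4 * (k%:R + 1) ^+ 3 * om by rewrite !mulr_ge0 ?exprn_ge0 ?addr_ge0.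
  apply: (@le_trans _ _ (Ex P (fun w => t ^+ 4 * (k%:R + 1) ^+ 3 * om * Q w ^+ 4))); last first.
    rewrite ExZ//; apply: le_trans (ler_wpM2l C0 e4) _.
    by rewrite le_eqVlt; apply/orP; left; apply/eqP; ring.
  apply: le_norm_Ex_le => //; first exact: intgrZ.
  move=> w; apply: le_trans (sinr_dist _ _ t0) _.
  rewrite (_ : _ * Q w ^+ 4 = t ^+ 4 * ((k%:R + 1) * Q w) ^+ 3 * (om * Q w)); last by ring.
  apply: ler_pM => //.
    by rewrite mulr_ge0// exprn_ge0// addr_ge0.
  by apply: ler_wpM2l => //; rewrite lerXn2r ?nnegrE ?mulr_ge0 ?addr_ge0.
apply: le_trans (lerD b1 b2) _; rewrite -mulrDr; apply: ler_wpM2l => //.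
have th0 : 0 <= theta by exact: le_trans tt.
have q0 : 0 <= (k%:R + 1) ^+ 3 * Q4_bound * theta.
  by apply: mulr_ge0 => //; rewrite !mulr_ge0 ?exprn_ge0 ?addr_ge0.
have k0 : 0 <= 136 * k%:R * om by rewrite !mulr_ge0.
rewrite /sin_const; move: th0 q0 k0; move: theta (136 * k%:R) (_ * Q4_bound) => th p M th0 q0 k0.
rewrite (_ : (p + M) * (th + om) = p * th + M * om + (M * th + p * om)); last by ring.
by rewrite lerDl addr_ge0.
Qed.

End HeadTail.

(** * Third and fourth cumulants of a centered variable *)

Section Cumulants.
Context (R : realType) d (T : measurableType d) (P : probability T R).

Lemma momentE (Y : T -> R) n : moment P Y n = Ex P (fun w => Y w ^+ n).
Proof. by rewrite /moment unlock. Qed.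

(** For a centered variable the polynomial of moments is divisible by ['X^2]; its [j]-th power
    starts at degree [2 j], so only [j <= 2] contributes up to order four. *)
Let coef_sqrX (v : {poly R}) j n : (('X^2 * v) ^+ j)`_n = if (n < 2 * j)%N then 0 else (v ^+ j)`_(n - 2 * j).
Proof. by rewrite exprMn -exprM coefXnM. Qed.

Lemma cumulant3E (Y : T -> R) : Ex P Y = 0 -> cumulant P 3 Y = Ex P (fun w => Y w ^+ 3).
Proof.
move=> Y0; rewrite /cumulant.
have m1 : moment P Y 1 = 0 by rewrite momentE.
pose v : {poly R} := (moment P Y 2 / 2)%:P + (moment P Y 3 / 6) *: 'X.
set u := (X in \sum_(_ <= j < _) _ *: X ^+ j).
have -> : u = 'X^2 * v.
  rewrite /u /index_iota /= !big_cons big_nil m1 mul0r scale0r add0r addr0 /v mulrDr.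
  by rewrite -scalerAr -exprSr -mul_polyC mulrC.
rewrite /index_iota /= !big_cons big_nil !coefD !coefZ !coef_sqrX coef0 /=.
rewrite /v expr1 !mulr0 !addr0 coefD coefC coefZ coefX /= add0r mulr1 -momentE.
by rewrite (_ : 3`! = 6)%N//; field.
Qed.

Lemma cumulant4E (Y : T -> R) : Ex P Y = 0 ->
  cumulant P 4 Y = Ex P (fun w => Y w ^+ 4) - 3 * Ex P (fun w => Y w ^+ 2) ^+ 2.
Proof.
move=> Y0; rewrite /cumulant.
have m1 : moment P Y 1 = 0 by rewrite momentE.
pose v : {poly R} := (moment P Y 2 / 2)%:P + ((moment P Y 3 / 6) *: 'X + (moment P Y 4 / 24) *: 'X^2).
set u := (X in \sum_(_ <= j < _) _ *: X ^+ j).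
have -> : u = 'X^2 * v.
  rewrite /u /index_iota /= !big_cons big_nil m1 mul0r scale0r add0r addr0 /v !mulrDr.
  by rewrite -!scalerAr -exprSr -exprD -mul_polyC (mulrC 'X^2 _%:P).
rewrite /index_iota /= !big_cons big_nil !coefD !coefZ !coef_sqrX coef0 /=.
rewrite subnn expr2 coef0M !addr0 !mulr0 !addr0 /v expr1 !coefD !coefC !coefZ !coefX !coefXn /=.
rewrite !mulr0 !add0r !addr0 mulr1 -!momentE (_ : 4`! = 24)%N//; by field.
Qed.

End Cumulants.

(** * Trigonometric test functions *)

Section TestFunctions.
Context (R : realType).
Implicit Types (f : R -> R) (t u x : R).

Lemma class_H2_intro f f1 f2 : (forall x, is_derive x (1 : R) f (f1 x)) ->
  (forall x, is_derive x (1 : R) f1 (f2 x)) -> (forall x, `|f1 x| <= 1) ->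
  (forall x, `|f2 x| <= 1) -> class_H2 f.
Proof.
move=> d1 d2 b1 b2.
have E1 : derive1 f = f1 by apply/funext => x; rewrite derive1E; have [] := d1 x.
have E2 : derive1 f1 = f2 by apply/funext => x; rewrite derive1E; have [] := d2 x.
split; rewrite ?E1 ?E2//.
- exact: continuous_is_derive d2.
- exists 1 => -[x y] _ /=; have [z [_ _ _ ->]] := mvt_sqr y x d2.
  by rewrite normrM ler_wpM2r.
- by apply: aeW => x; split=> //; have [] := d2 x.
Qed.

Lemma class_H2_sin t : 0 <= t <= 1 -> class_H2 (fun x => sin (t * x)).
Proof.
move=> /andP[t0 t1].
have d2 x : is_derive x (1 : R) (fun x => t * cos (t * x)) (t * - (t * sin (t * x))).
  exact: (@is_deriveZ _ _ _ _ t x 1 _ (is_derive_cos_lin t x)).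
apply: (class_H2_intro (is_derive_sin_lin t) d2) => x.
  by rewrite normrM (ger0_norm t0) mulr_ile1// ler_norml cos_geN1 cos_le1.
rewrite normrM normrN normrM (ger0_norm t0) mulr_ile1 ?mulr_ge0//.
by rewrite mulr_ile1// ler_norml sin_geN1 sin_le1.
Qed.

Lemma class_H2_cos t : 0 <= t <= 1 -> class_H2 (fun x => cos (t * x)).
Proof.
move=> /andP[t0 t1].
have d2 x : is_derive x (1 : R) (fun x => - (t * sin (t * x))) (- (t * (t * cos (t * x)))).
  have h := @is_deriveZ _ _ _ _ (- t) x 1 _ (is_derive_sin_lin t x).
  by apply: (is_derive_conv h) => [y|]; rewrite /= /GRing.scale /=; ring.
apply: (class_H2_intro (is_derive_cos_lin t) d2) => x.
  by rewrite normrN normrM (ger0_norm t0) mulr_ile1// ler_norml sin_geN1 sin_le1.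
rewrite normrN normrM normrM (ger0_norm t0) mulr_ile1 ?mulr_ge0//.
by rewrite mulr_ile1// ler_norml cos_geN1 cos_le1.
Qed.

Definition cosr u := cos u - 1 + u ^+ 2 / 2.

Lemma norm_sin_le u : `|sin u| <= `|u|.
Proof.
have [z [_ _ _ ]] := mvt_sqr 0 u (fun x => is_derive_sin x).
by rewrite sin0 !subr0 => ->; rewrite normrM ler_piMl// ler_norml cos_geN1 cos_le1.
Qed.

Lemma sin_dist3 u : `|u - sin u| <= `|u| ^+ 3.
Proof.
have df x : is_derive x (1 : R) (fun x => x - sin x) (1 - cos x) by exact: is_deriveB.
have [z [_ _ zu e]] := mvt_sqr 0 u df.
rewrite sin0 !subr0 in zu e; rewrite e normrM exprSr; apply: ler_wpM2r => //.
have [y [_ _ yz e2]] := mvt_sqr 0 z (fun x => is_derive_cos x).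
rewrite cos0 !subr0 in yz e2; rewrite distrC e2 normrM normrN expr2.
apply: ler_pM => //.
by apply: le_trans (norm_sin_le y) (le_trans yz zu).
Qed.

Lemma cosr_le u : `|cosr u| <= u ^+ 4.
Proof.
have df x : is_derive x (1 : R) cosr (x - sin x).
  pose p : {poly R} := 2^-1 *: 'X^2 - 1%:P.
  have hp : is_derive x (1 : R) (fun x => x ^+ 2 / 2 - 1) x.
    apply: (is_derive_conv (is_derive_poly p x)); first by move=> y; rewrite /p !hornerE /=; ring.
    by rewrite /p derivB derivC !derivZ derivXn !hornerE/=; field.
  apply: (is_derive_conv (@is_deriveD _ _ _ _ _ _ _ _ _ (is_derive_cos x) hp)).
    by move=> y; rewrite addrfctE /cosr; ring.
  by rewrite addrC.
have [z [_ _ zu e]] := mvt_sqr 0 u df.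
have c0 : cosr 0 = 0 by rewrite /cosr cos0 subrr expr0n mul0r addr0.
rewrite c0 !subr0 in zu e; rewrite e normrM.
rewrite (_ : u ^+ 4 = `|u| ^+ 3 * `|u|); last first.
  by rewrite -exprSr -normrX ger0_norm// (exprM _ 2 2) sqr_ge0.
apply: ler_wpM2r => //; apply: le_trans (sin_dist3 z) _.
by rewrite lerXn2r ?nnegrE.
Qed.

Lemma cosr_dist u : `|cosr u - u ^+ 4 / 24| <= `|u| ^+ 6.
Proof.
pose q u : R := u - sin u - u ^+ 3 / 6.
have dq x : is_derive x (1 : R) q (- cosr x).
  pose p : {poly R} := 'X - 6^-1 *: 'X^3.
  have hp : is_derive x (1 : R) (fun x => x - x ^+ 3 / 6) (1 - x ^+ 2 / 2).
    apply: (is_derive_conv (is_derive_poly p x)); first by move=> y; rewrite /p !hornerE /=; ring.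
    by rewrite /p derivB derivX !derivZ derivXn !hornerE/=; field.
  apply: (is_derive_conv (@is_deriveB _ _ _ _ _ _ _ _ _ hp (is_derive_sin x))).
    by move=> y; rewrite (_ : (_ - _) y = y - y ^+ 3 / 6 - sin y)// /q; ring.
  by rewrite /cosr; ring.
have dr x : is_derive x (1 : R) (fun u => cosr u - u ^+ 4 / 24) (q x).
  pose p : {poly R} := 2^-1 *: 'X^2 - 24^-1 *: 'X^4 - 1%:P.
  have hp : is_derive x (1 : R) (fun x => x ^+ 2 / 2 - x ^+ 4 / 24 - 1) (x - x ^+ 3 / 6).
    apply: (is_derive_conv (is_derive_poly p x)); first by move=> y; rewrite /p !hornerE /=; ring.
    by rewrite /p !derivB derivC !derivZ !derivXn !hornerE/=; field.
  apply: (is_derive_conv (@is_deriveD _ _ _ _ _ _ _ _ _ (is_derive_cos x) hp)).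
    by move=> y; rewrite addrfctE /cosr; ring.
  by rewrite /q; ring.
have q_le x : `|q x| <= `|x| ^+ 5.
  have [z [_ _ zx e]] := mvt_sqr 0 x dq.
  have q0 : q 0 = 0 by rewrite /q sin0 expr0n/= mul0r !subr0.
  rewrite q0 !subr0 in zx e; rewrite e normrM normrN exprSr; apply: ler_wpM2r => //.
  apply: le_trans (cosr_le z) _.
  rewrite (_ : z ^+ 4 = `|z| ^+ 4); first by rewrite lerXn2r ?nnegrE.
  by rewrite -normrX ger0_norm// (exprM _ 2 2) sqr_ge0.
have [z [_ _ zu e]] := mvt_sqr 0 u dr.
have c0 : cosr 0 - 0 ^+ 4 / 24 = 0 by rewrite /cosr cos0 !expr0n/= !mul0r subrr addr0 subr0.
rewrite c0 !subr0 in zu e; rewrite e normrM exprSr; apply: ler_wpM2r => //.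
by apply: le_trans (q_le z) _; rewrite lerXn2r ?nnegrE.
Qed.

(** The sixth-power error of [cosr_dist] enters pointwise only; under the expectation the domination
    is [cosr_le], for which fourth moments suffice. *)
Lemma cosr_scaled_cvg x :
  24 * cosr (harmonic n * x) / harmonic n ^+ 4 @[n --> \oo] --> x ^+ 4.
Proof.
pose bd (sg : R) n := x ^+ 4 + sg * (24 * (harmonic n * harmonic n) * `|x| ^+ 6).
have cbd sg : bd sg n @[n --> \oo] --> x ^+ 4.
  rewrite -[X in _ --> X](_ : x ^+ 4 + sg * (24 * (0 * 0) * `|x| ^+ 6) = _); last by ring.
  apply: cvgD; first exact: cvg_cst.
  by apply: cvgMr; apply: cvgMl; apply: cvgMr; apply: cvgM; exact: cvg_harmonic.
apply: (squeeze_cvgr _ (cbd (- 1)) (cbd 1)); apply: nearW => n.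
have := harmonic_gt0 n : 0 < harmonic n :> R; rewrite /bd; move: (harmonic n) => t t0.
suff : `|24 * cosr (t * x) / t ^+ 4 - x ^+ 4| <= 24 * (t * t) * `|x| ^+ 6.
  by rewrite ler_norml; lra.
have t4 : 0 < t ^+ 4 by rewrite exprn_gt0.
rewrite (_ : _ - _ = 24 * (cosr (t * x) - (t * x) ^+ 4 / 24) / t ^+ 4); last first.
  by field; rewrite gt_eqF.
rewrite !normrM normfV (ger0_norm (ltW t4)) (ger0_norm (ler0n R 24)) ler_pdivrMr//.
apply: le_trans (ler_wpM2l (ler0n R 24) (cosr_dist (t * x))) _.
rewrite normrM (gtr0_norm t0) exprMn le_eqVlt; apply/orP; left; apply/eqP; ring.
Qed.

End TestFunctions.

(** * Constants valid for every index *)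

Section UniformConstants.
Context (R : realType).

(** The threshold is lowered one index at a time: at no cost where [M] vanishes, and otherwise by
    taking the minimum and maximum of the constants with the ratio [D / M]. *)
Lemma uniform_constants (D M : nat -> R) (n0 : nat) (c1 c2 : R) : 0 < c1 -> 0 < c2 ->
  (forall n, 0 <= M n) -> (forall n, M n = 0 -> D n = 0) -> (forall n, 0 < M n -> 0 < D n) ->
  (forall n, (n0 <= n)%N -> c1 * M n <= D n <= c2 * M n) ->
  exists C1 C2, [/\ 0 < C1, C1 < C2 & forall n, C1 * M n <= D n <= C2 * M n].
Proof.
move=> c10 c20 M0 D0 Dp; elim: n0 c1 c2 c10 c20 => [|n0 IH] c1 c2 c10 c20 h.
  (* The sum, instead of [c2], makes the inequality between the constants strict. *)
  exists c1, (c1 + c2); split=> //; first by rewrite ltrDl.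
  move=> n; have /andP[h1 h2] := h n (leq0n n).
  by rewrite h1/=; apply: le_trans h2 _; apply: ler_wpM2r => //; rewrite lerDr ltW.
have := M0 n0; rewrite le_eqVlt => /predU1P[/esym m0|mp].
  apply: (IH c1 c2) => // n; rewrite leq_eqVlt => /predU1P[<-|]; last exact: h.
  by rewrite D0// m0 !mulr0 lexx.
pose r := D n0 / M n0; have r0 : 0 < r by rewrite divr_gt0// Dp.
apply: (IH (Num.min c1 r) (Num.max c2 r)).
- by rewrite lt_min c10.
- by rewrite lt_max c20.
- move=> n; rewrite leq_eqVlt => /predU1P[<-|n0n].
    rewrite -ler_pdivlMr// -/r ge_min lexx orbT/=.
    by rewrite -ler_pdivrMr// -/r le_max lexx orbT.
  have /andP[h1 h2] := h n n0n; apply/andP; split.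
    by apply: le_trans h1; apply: ler_wpM2r => //; rewrite ge_min lexx.
  by apply: le_trans h2 _; apply: ler_wpM2r => //; rewrite le_max lexx.
Qed.

End UniformConstants.

(** * Moment gaps in terms of theta and omega *)

Section MomentGaps.
Context (R : realType) (c : nat -> R) (k : nat) (om : R).
Hypothesis cV : \sum_(i < m) c i ^+ 2 @[m --> \oo] --> (k%:R : R).
Hypotheses (hom : forall i, (i < k)%N -> `|1 - c i| <= om) (om0 : 0 <= om).

Let theta : R := k%:R - \sum_(i < k) c i ^+ 2.

Let tail_le (p : nat) (B : R) m : (k <= m)%N -> 0 <= B ->
  (forall i, (k <= i)%N -> `|c i ^+ p.+3| <= B * c i ^+ 2) ->
  `|\sum_(i < m) c i ^+ p.+3 - \sum_(i < k) c i ^+ p.+3| <= B * theta.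
Proof.
move=> km B0 h; rewrite -(sum_tail c km (isT : 0 < p.+3)%N).
apply: le_trans (ler_norm_sum _ _ _) _.
apply: (@le_trans _ _ (\sum_(i < m) B * ((k <= i)%:R * c i) ^+ 2)).
  apply: ler_sum => i _; case: (leqP k i) => [ki|_]; first by rewrite !mul1r; exact: h.
  by rewrite !mul0r !expr0n normr0 mulr0.
rewrite -mulr_sumr (sum_tail c km (isT : 0 < 2)%N); apply: ler_wpM2l => //.
by rewrite /theta lerD2r; exact: (sum_sqr_le cV).
Qed.

Let head_le (f : R -> R) (B : R) : (forall i, (i < k)%N -> `|f (c i)| <= B) ->
  `|\sum_(i < k) f (c i)| <= k%:R * B.
Proof.
move=> h; apply: le_trans (ler_norm_sum _ _ _) _.
rewrite -[k in k%:R]card_ord mulr_natl -sumr_const; apply: ler_sum => i _; exact: h.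
Qed.

Let tail_sqr i : (k <= i)%N -> c i ^+ 2 <= theta.
Proof.
move=> ki; have h := sum_sqr_le cV i.+1; rewrite big_ord_recr/= in h.
by have := sum_sqr_nd c ki; rewrite /theta; lra.
Qed.

(** On the head, [f] in the proof equals [(1 - x)^2 (3/2 - (1 - x))], at most [5/2 om^2], and
    [1 - x^2] sums to [theta]. On the tail [|c_i| <= eta], so the cubes sum to at most [eta theta].
    All is multiplied by [8]. *)
Lemma third_moment_gap (eta m3 : R) : 8 * \sum_(i < m) c i ^+ 3 @[m --> \oo] --> m3 ->
  0 <= eta -> theta <= eta ^+ 2 -> om <= 1 ->
  `|m3 - 8 * k%:R + 12 * theta| <= 20 * k%:R * om ^+ 2 + 8 * eta * theta.
Proof.
move=> c3 eta0 thE om1.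
have hc : `|8 * \sum_(i < m) c i ^+ 3 - 8 * k%:R + 12 * theta| @[m --> \oo] --> `|m3 - 8 * k%:R + 12 * theta|.
  by apply: cvg_norm; apply: cvgD; [apply: cvgB => //|]; exact: cvg_cst.
rewrite -(cvg_lim _ hc)//; apply: limr_le; first by apply/cvg_ex; eexists; exact: hc.
exists k => // m /= km.
have ht := @tail_le 0 eta m km eta0 (fun i ki => ltac:(
  rewrite exprS normrM (ger0_norm (sqr_ge0 (c i))); apply: ler_wpM2r; [exact: sqr_ge0|];
  rewrite -(ler_pXn2r (ltn0Sn 1)) ?nnegrE// real_normK ?num_real//;
  exact: le_trans (tail_sqr ki) thE)).
pose f (x : R) := x ^+ 3 - 1 + 3 / 2 * (1 - x ^+ 2).
have hh := @head_le f (5 / 2 * om ^+ 2) (fun i ik => ltac:(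
  rewrite (_ : f (c i) = (1 - c i) ^+ 2 * (3 / 2 - (1 - c i))); [|by rewrite /f; field];
  rewrite normrM normrX mulrC; have h := hom ik; apply: ler_pM => //;
  [apply: le_trans (ler_normB _ _) _; rewrite ger0_norm//; lra|by rewrite lerXn2r ?nnegrE])).
have fE : \sum_(i < k) f (c i) = \sum_(i < k) c i ^+ 3 - k%:R + 3 / 2 * theta.
  rewrite /f big_split/= sumrB -mulr_sumr sumrB sumr_const card_ord /theta; ring.
rewrite fE in hh.
rewrite (_ : 8 * _ - 8 * k%:R + 12 * theta = 8 * (\sum_(i < k) c i ^+ 3 - k%:R + 3 / 2 * theta) +
  8 * (\sum_(i < m) c i ^+ 3 - \sum_(i < k) c i ^+ 3)); last by field.
apply: le_trans (ler_normD _ _) _; rewrite !normrM (ger0_norm (ler0n R 8)).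
by apply: le_trans (lerD (ler_wpM2l (ler0n R 8) hh) (ler_wpM2l (ler0n R 8) ht)) _; lra.
Qed.

Let c_sqr_le i : c i ^+ 2 <= k%:R.
Proof.
apply: le_trans (sum_sqr_le cV i.+1); rewrite big_ord_recr/= lerDr.
by apply: sumr_ge0 => j _; exact: sqr_ge0.
Qed.

(** A first-order bound is enough, as this gap enters only the upper estimate of the cumulant gap;
    [720 = 48 * 15]. *)
Lemma fourth_moment_gap (m4 : R) :
  48 * \sum_(i < m) c i ^+ 4 + 12 * (\sum_(i < m) c i ^+ 2) ^+ 2 @[m --> \oo] --> m4 -> om <= 1 ->
  `|m4 - (48 * k%:R + 12 * k%:R ^+ 2)| <= 720 * k%:R * om + 48 * k%:R * theta.
Proof.
move=> c4 om1.
have hc : `|48 * \sum_(i < m) c i ^+ 4 + 12 * (\sum_(i < m) c i ^+ 2) ^+ 2 -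
   12 * (\sum_(i < m) c i ^+ 2) ^+ 2 - 48 * k%:R| @[m --> \oo] --> `|m4 - (48 * k%:R + 12 * k%:R ^+ 2)|.
  apply: cvg_norm; rewrite [X in _ --> X](_ : _ = m4 - 12 * (k%:R * k%:R) - 48 * k%:R); last by ring.
  apply: cvgB; last exact: cvg_cst; apply: cvgB => //; apply: cvgMr.
  by under eq_fun do rewrite expr2; exact: cvgM.
rewrite -(cvg_lim _ hc)//; apply: limr_le; first by apply/cvg_ex; eexists; exact: hc.
exists k => // m /= km; rewrite addrK -mulrBr normrM (ger0_norm (ler0n R 48)).
have ht := @tail_le 1 k%:R m km (ler0n R k) (fun i ki => ltac:(
  rewrite (exprM _ 2 2) ger0_norm ?sqr_ge0// expr2; apply: ler_wpM2r; [exact: sqr_ge0|exact: c_sqr_le])).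
pose f (x : R) := x ^+ 4 - 1.
have hb (x : R) : `|x| <= 1 -> `|4 - 6 * x + 4 * x ^+ 2 - x ^+ 3| <= 15.
  move=> x1; have p2 : `|x ^+ 2| <= 1 by rewrite normrX exprn_ile1.
  have p3 : `|x ^+ 3| <= 1 by rewrite normrX exprn_ile1.
  by move: x1 p2 p3; rewrite !ler_norml; lra.
have hh : `|\sum_(i < k) f (c i)| <= k%:R * (15 * om).
  apply: head_le => i ik.
  rewrite (_ : f (c i) = (4 - 6 * (1 - c i) + 4 * (1 - c i) ^+ 2 - (1 - c i) ^+ 3) * - (1 - c i)); last first.
    by rewrite /f; ring.
  rewrite normrM normrN; apply: ler_pM => //; last exact: hom.
  by apply: hb; apply: le_trans om1; exact: hom.
have fE : \sum_(i < k) f (c i) = \sum_(i < k) c i ^+ 4 - k%:R.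
  by rewrite /f sumrB sumr_const card_ord.
rewrite fE in hh.
rewrite (_ : \sum_(i < m) c i ^+ 4 - k%:R = (\sum_(i < k) c i ^+ 4 - k%:R) +
  (\sum_(i < m) c i ^+ 4 - \sum_(i < k) c i ^+ 4)); last by ring.
apply: (@le_trans _ _ (48 * (k%:R * (15 * om) + k%:R * theta))); last by lra.
apply: ler_wpM2l => //; apply: le_trans (ler_normD _ _) _; exact: lerD.
Qed.

End MomentGaps.

(** * Bounds on the distance *)

Section Distance.
Context (R : realType) d (T : measurableType d) (P : probability T R)
  d' (T' : measurableType d') (P' : probability T' R).
Variables (Y : T -> R) (Z : T' -> R).
Hypotheses (mY : measurable_fun setT Y) (mZ : measurable_fun setT Z).
Hypotheses (iY : intgr P (fun w => Y w ^+ 2)) (iZ : intgr P' (fun w => Z w ^+ 2)).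

Let gap (h : R -> R) : R := `|Ex P (fun w => h (Y w)) - Ex P' (fun w => h (Z w))|.

Let measurable_H2 (h : R -> R) : class_H2 h -> measurable_fun setT h.
Proof.
move=> hh; apply: continuous_measurable_fun.
exact: (continuous_is_derive (fun x => class_H2_is_derive x hh)).
Qed.

Lemma intgr_class_H2 (h : R -> R) : class_H2 h ->
  intgr P (fun w => h (Y w)) /\ intgr P' (fun w => h (Z w)).
Proof.
move=> hh; have mh := measurable_H2 hh; have hl := class_H2_lipschitz hh.
by split; exact: lipschitz_intgr.
Qed.

Let dist2_term (h : R -> R) : class_H2 h -> (`|'E_P[h \o Y] - 'E_P'[h \o Z]| = (gap h)%:E)%E.
Proof. by move=> /intgr_class_H2[i1 i2]; rewrite unlock /= !EFin_Ex. Qed.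

Lemma dist2_le (B : R) : (forall h : R -> R, class_H2 h ->
  `|Ex P (fun w => h (Y w)) - Ex P' (fun w => h (Z w))| <= B) -> (dist2 P P' Y Z <= B%:E)%E.
Proof.
move=> hB; apply: ge_ereal_sup => _ [h hh <-].
by rewrite dist2_term// lee_fin; exact: hB.
Qed.

Lemma dist2_ge (h : R -> R) : class_H2 h ->
  (`|Ex P (fun w => h (Y w)) - Ex P' (fun w => h (Z w))|%:E <= dist2 P P' Y Z)%E.
Proof. by move=> hh; apply: ereal_sup_ubound; exists h => //; exact: dist2_term. Qed.

(** Test functions are 1-Lipschitz, so comparison with [h 0] bounds the distance by
    [E|Y| + E|Z|]. *)
Lemma dist2_fin : exists2 r : R, 0 <= r & dist2 P P' Y Z = r%:E.
Proof.
have h0 := dist2_ge (@class_H2_sin R 0 ltac:(by rewrite lexx ler01)).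
have h1 : (dist2 P P' Y Z <= (Ex P (fun w => `|Y w|) + Ex P' (fun w => `|Z w|))%:E)%E.
  apply: dist2_le => h hh; have [i1 i2] := intgr_class_H2 hh.
  have hl := class_H2_lipschitz hh.
  have b d0 (U : measurableType d0) (Q : probability U R) (W : U -> R) :
      measurable_fun setT W -> intgr Q (fun w => W w ^+ 2) -> intgr Q (fun w => h (W w)) ->
      `|Ex Q (fun w => h (W w)) - h 0| <= Ex Q (fun w => `|W w|).
    move=> mW iW i; rewrite -[h 0](Ex_cst Q) -ExB//; last exact: intgr_cst.
    apply: le_norm_Ex_le.
    - by apply: intgrB => //; exact: intgr_cst.
    - by apply: intgr_norm; exact: intgr_of_sqr.
    - by move=> w; have := hl (W w) 0; rewrite subr0.
  have := b _ _ _ _ mY iY i1; have := b _ _ _ _ mZ iZ i2.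
  have := ler_distD (h 0) (Ex P (fun w => h (Y w))) (Ex P' (fun w => h (Z w))).
  by rewrite (distrC (h 0)); lra.
case: (dist2 P P' Y Z) h0 h1 => [r| |]//; rewrite ?leye_eq// lee_fin => h0 _.
by exists r => //; apply: le_trans h0.
Qed.

Hypotheses (iY3 : intgr P (fun w => Y w ^+ 3)) (iZ3 : intgr P' (fun w => Z w ^+ 3)).
Hypotheses (iY4 : intgr P (fun w => Y w ^+ 4)) (iZ4 : intgr P' (fun w => Z w ^+ 4)).
Hypotheses (eY : Ex P Y = 0) (eZ : Ex P' Z = 0).
Hypothesis e2 : Ex P (fun w => Y w ^+ 2) = Ex P' (fun w => Z w ^+ 2).
Hypothesis d0 : dist2 P P' Y Z = 0%E.

Let Ex_class_H2_eq (h : R -> R) : class_H2 h -> Ex P (fun w => h (Y w)) = Ex P' (fun w => h (Z w)).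
Proof.
move=> hh; have := dist2_ge hh; rewrite d0 lee_fin => h0.
by apply/eqP; rewrite -subr_eq0 -normr_eq0 eq_le h0 normr_ge0.
Qed.

Lemma dist2_eq0_third : Ex P (fun w => Y w ^+ 3) = Ex P' (fun w => Z w ^+ 3).
Proof.
set m := Ex P _; set m' := Ex P' _; apply/eqP; rewrite -subr_eq0 -normr_eq0.
apply/negPn/negP => /negP dn0; set dl := `|m - m'| in dn0.
have dl0 : 0 < dl by rewrite lt_def normr_ge0 andbT; apply/negP.
pose B := Ex P (fun w => Y w ^+ 4) + Ex P' (fun w => Z w ^+ 4).
have p4 (x : R) : 0 <= x ^+ 4 by rewrite (exprM _ 2 2) sqr_ge0.
have B0 : 0 <= B by rewrite addr_ge0// Ex_ge0.
(* So small that the remainder, at most [t^4 B], does not exceed half of [t^3 dl / 6]. *)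
pose t := Num.min 1 (dl / (12 * (B + 1))).
have t0 : 0 < t by rewrite lt_min ltr01 divr_gt0// mulr_gt0// ltr_wpDl.
have t01 : 0 <= t <= 1 by rewrite (ltW t0) ge_min lexx.
have tB : t * B <= dl / 12.
  have h : t <= dl / (12 * (B + 1)) by rewrite ge_min lexx orbT.
  apply: le_trans (ler_wpM2r B0 h) _.
  have B1 : 0 < B + 1 by rewrite ltr_wpDl.
  rewrite (_ : _ * B = dl / 12 * (B / (B + 1))); last by field; rewrite gt_eqF.
  apply: ler_piMr; first by rewrite divr_ge0// ltW.
  by rewrite ler_pdivrMr// mul1r lerDl.
have [ir er] := Ex_sinr (ltW t0) mY iY4 iY3 (intgr_of_sqr mY iY) eY.
have [ir' er'] := Ex_sinr (ltW t0) mZ iZ4 iZ3 (intgr_of_sqr mZ iZ) eZ.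
have b1 : `|Ex P (fun w => sinr t (Y w))| <= t ^+ 4 * Ex P (fun w => Y w ^+ 4).
  rewrite -ExZ//; apply: le_norm_Ex_le => //; first exact: intgrZ.
  by move=> w; apply: sinr_le; exact: ltW.
have b2 : `|Ex P' (fun w => sinr t (Z w))| <= t ^+ 4 * Ex P' (fun w => Z w ^+ 4).
  rewrite -ExZ//; apply: le_norm_Ex_le => //; first exact: intgrZ.
  by move=> w; apply: sinr_le; exact: ltW.
have E : t ^+ 3 / 6 * (m - m') = Ex P (fun w => sinr t (Y w)) - Ex P' (fun w => sinr t (Z w)).
  by rewrite er er' (Ex_class_H2_eq (class_H2_sin t01)) -/m -/m'; ring.
have t3 : 0 < t ^+ 3 / 6 by rewrite divr_gt0// exprn_gt0.
have : t ^+ 3 / 6 * dl <= t ^+ 3 / 6 * (6 * (t * B)).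
  rewrite -{1}(gtr0_norm t3) -normrM E; apply: le_trans (ler_normB _ _) _.
  apply: le_trans (lerD b1 b2) _; rewrite -mulrDr -/B.
  by rewrite le_eqVlt; apply/orP; left; apply/eqP; field.
by rewrite ler_pM2l//; lra.
Qed.

(** With equal second moments the cosines determine [24 E[cosr (t Y)] / t^4], whose limit as [t]
    tends to zero is the fourth moment. *)
Lemma dist2_eq0_fourth : Ex P (fun w => Y w ^+ 4) = Ex P' (fun w => Z w ^+ 4).
Proof.
have main d1 (U : measurableType d1) (Q : probability U R) (W : U -> R) : measurable_fun setT W ->
    intgr Q (fun w => W w ^+ 4) -> intgr Q (fun w => W w ^+ 2) ->
    24 * (Ex Q (fun w => cos (harmonic n * W w)) - 1 + harmonic n ^+ 2 / 2 * Ex Q (fun w => W w ^+ 2)) /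
      harmonic n ^+ 4 @[n --> \oo] --> Ex Q (fun w => W w ^+ 4).
  move=> mW i4 i2.
  have mcosr : measurable_fun setT (@cosr R).
    apply: continuous_measurable_fun; rewrite /cosr.
    apply: contD; first by apply: contD; [exact: cont_cos (@cont_id R)|exact: cont_cst].
    by apply: contM; [exact: contX (@cont_id R)|exact: cont_cst].
  have mW1 n : measurable_fun setT (fun w => harmonic n * W w).
    by apply: measurable_funM => //; exact: measurable_cst.
  have mf n : measurable_fun setT (fun w => 24 * cosr (harmonic n * W w) / harmonic n ^+ 4).
    apply: measurable_funM; [|exact: measurable_cst].
    by apply: measurable_funM; [exact: measurable_cst|exact: measurableT_comp mcosr (mW1 n)].
  have bf n w : `|24 * cosr (harmonic n * W w) / harmonic n ^+ 4| <= 24 * W w ^+ 4.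
    have t0 := harmonic_gt0 n : 0 < harmonic n :> R; move: (harmonic n) t0 => t t0.
    have t4 : 0 < t ^+ 4 by rewrite exprn_gt0.
    rewrite !normrM normfV (gtr0_norm t4) (ger0_norm (ler0n R 24)) ler_pdivrMr// -mulrA.
    by apply: ler_wpM2l => //; rewrite mulrC -exprMn; exact: cosr_le.
  have [_ h] := Ex_dct mf (measurable_funX 4 mW) (fun w => @cosr_scaled_cvg R (W w)) (intgrZ 24 i4) bf.
  apply: cvg_trans h; apply: near_eq_cvg; apply: nearW => n.
  have t0 := harmonic_gt0 n : 0 < harmonic n :> R; move: (harmonic n) t0 => t t0.
  have ic : intgr Q (fun w => cos (t * W w)).
    apply: (@intgr_bounded _ _ _ Q 1) => [|w]; last by rewrite ler_norml cos_geN1 cos_le1.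
    by apply: measurable_cos_comp; apply: measurable_funM => //; exact: measurable_cst.
  have E w : 24 / t ^+ 4 * (cos (t * W w) - 1 + t ^+ 2 / 2 * W w ^+ 2) = 24 * cosr (t * W w) / t ^+ 4.
    by rewrite /cosr exprMn; field; rewrite gt_eqF.
  have i1 : intgr Q (fun w => cos (t * W w) - 1) by apply: intgrB => //; exact: intgr_cst.
  rewrite -(@eq_Ex _ _ _ Q _ _ E) ExZ; last by apply: intgrD => //; exact: intgrZ.
  rewrite ExD//; last exact: intgrZ.
  by rewrite ExB// ?Ex_cst ?ExZ//; [ring|exact: intgr_cst].
have h1 := main _ _ _ _ mY iY4 iY; have h2 := main _ _ _ _ mZ iZ4 iZ.
apply: (cvg_unique _ h1) => //; move: h2; apply: cvg_trans; apply: near_eq_cvg; apply: nearW => n.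
rewrite e2 (Ex_class_H2_eq (class_H2_cos _))// harmonic_ge0/=.
by rewrite /harmonic/= invf_le1 ?ler1n.
Qed.

End Distance.

(** * The centered Gamma law as a finite chi-square sum *)

Section CenteredGammaLaw.
Context (R : realType) d (T : measurableType d) (P : probability T R)
  d' (T' : measurableType d') (P' : probability T' R) (G : {RV P' >-> R}) (k : nat).
Hypotheses (hG : forall A : set R, measurable A ->
  P' (G @^-1` A) = centered_gamma_law k%:R A).
Variables (N : nat -> T -> R) (s : pred nat).
Hypotheses (hN : gaussian_family P N s) (sk : forall i, (i < k)%N -> s i).

Lemma centered_gamma_head (B : set R) : measurable B ->
  fine (P' (G @^-1` B)) = fine (P (psum N (@head_ind R k) k @^-1` B)).
Proof.
move=> mB.
(* The normalization of the density is the total mass of the law of [G]. *)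
have pdf1 : (\int[@lebesgue_measure R]_x (gamma_pdf (k%:R / 2) x)%:E = 1)%E.
  have := hG (measurableT : measurable (setT : set R)).
  by rewrite /centered_gamma_law /gamma_law !preimage_setT probability_setT => /esym.
have mB' : measurable ((fun x : R => 2 * x - k%:R) @^-1` B).
  rewrite -[X in measurable X]setTI; apply: (_ : measurable_fun setT (fun x : R => 2 * x - k%:R)) => //.
  apply: measurable_funB; last exact: measurable_cst.
  by apply: measurable_funM; [exact: measurable_cst|exact: measurable_id].
rewrite hG// /centered_gamma_law (gamma_law_psum pdf1 hN sk mB').
congr (fine (P _)); apply/seteqP; split=> w /=.
  by rewrite mulrC divfK ?pnatr_eq0// addrK.
by rewrite mulrC divfK ?pnatr_eq0// addrK.
Qed.

End CenteredGammaLaw.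

(** * The rates theta and omega *)

Section Sequences.
Context (R : realType).

Lemma nneseries_sqr_cvg (c : nat -> R) (nu : R) :
  (2%:E * \sum_(0 <= i <oo) (c i ^+ 2)%:E = (2 * nu)%:E)%E ->
  \sum_(i < m) c i ^+ 2 @[m --> \oo] --> nu.
Proof.
set S := (\sum_(0 <= i <oo) _)%E => hS.
have cS : (\sum_(0 <= i < m) (c i ^+ 2)%:E)%E @[m --> \oo] --> S.
  by apply: is_cvg_nneseries => n _ _; rewrite lee_fin sqr_ge0.
have SE : S = nu%:E.
  case: (S) hS => [r| |].
  - by rewrite -EFinM => -[] h; congr EFin; lra.
  - by rewrite gt0_muley ?lte_fin.
  - by rewrite gt0_muleNy ?lte_fin.
rewrite SE in cS; move/fine_cvg : cS; apply: cvg_trans; apply: near_eq_cvg; apply: nearW => m.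
by rewrite /= sumEFin big_mkord.
Qed.

Lemma theta_rateE (c : nat -> R) (k : nat) (V : R) :
  \sum_(i < m) c i ^+ 2 @[m --> \oo] --> V -> theta_rate k c = V - \sum_(i < k) c i ^+ 2.
Proof.
move=> cV; rewrite /theta_rate; apply: cvg_lim => //.
have h : \sum_(i < m) c i ^+ 2 - \sum_(i < k) c i ^+ 2 @[m --> \oo] --> V - \sum_(i < k) c i ^+ 2.
  by apply: cvgB => //; exact: cvg_cst.
apply: cvg_trans h; apply: near_eq_cvg; exists k => // m /= km.
by rewrite -!(big_mkord xpredT (fun i => c i ^+ 2)) (big_cat_nat (leq0n k) km)/= addrAC subrr add0r.
Qed.

Lemma omega_rate_ge (c : nat -> R) (k i : nat) : (i < k)%N -> `|1 - c i| <= omega_rate k c.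
Proof. by move=> ik; exact: (le_bigmax 0 (fun i : 'I_k => `|1 - c i|) (Ordinal ik)). Qed.

Lemma omega_rate_le (c : nat -> R) (k : nat) (e : R) : 0 <= e ->
  (forall i, (i < k)%N -> `|1 - c i| <= e) -> omega_rate k c <= e.
Proof. by move=> e0 h; apply: bigmax_le => // i _; exact: h. Qed.

Lemma omega_rate_ge0 (c : nat -> R) (k : nat) : 0 <= omega_rate k c.
Proof. exact: bigmax_ge_id. Qed.

Lemma approx_const_le (C : R) (a b : nat -> R) : (forall n, 0 <= b n) -> approx_const C a b ->
  exists n0, forall n, (n0 <= n)%N -> b n <= 2 / C * a n.
Proof.
move=> b0 [C0 hC].
move/cvgrPdist_le : hC => /(_ (C / 2) ltac:(by rewrite divr_gt0))[n0 _ h]; exists n0 => n nn.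
have := h n nn; rewrite /= ler_norml => /andP[_ h1].
have h2 : C / 2 <= a n / b n by lra.
have bp : 0 < b n.
  rewrite lt_def b0 andbT; apply/eqP => bn; move: h2; rewrite bn invr0 mulr0.
  by rewrite leNgt divr_gt0.
move: h2; rewrite ler_pdivlMr// => h2.
have := ler_wpM2l (_ : 0 <= 2 / C) h2; rewrite divr_ge0 ?(ltW C0)// => /(_ isT).
by rewrite mulrA (_ : 2 / C * (C / 2) = 1) ?mul1r//; field; rewrite gt_eqF.
Qed.

End Sequences.

(** * Convergence in law and comparison of the distance with the cumulant gap *)

Section Main.
Context (R : realType) d (Om : measurableType d) (P : probability Om R)
  (H : completeNormedModType R) (ip : H -> H -> R) (X : H -> {RV P >-> R}).
Hypotheses (hip : inner_product ip) (hX : isonormal ip X).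
Variables (nu : R) (F : nat -> {RV P >-> R}) (e : nat -> nat -> H) (c : nat -> nat -> R).
Hypotheses (hnu : 0 < nu) (hF : forall n, second_chaos_series ip X (e n) (c n) (F n)).
Hypothesis hsorted : forall n, sorted_coef (c n).
Hypothesis cV : forall n, \sum_(i < m) c n i ^+ 2 @[m --> \oo] --> nu.

Let c0 n : c n 0%N != 0.
Proof.
apply/eqP => c00; have h : \sum_(i < m) c n i ^+ 2 @[m --> \oo] --> (0 : R).
  rewrite (_ : (fun m => _) = cst 0); first exact: cvg_cst.
  apply/funext => m; rewrite big1// => i _.
  have := sorted_coef_le (hsorted n) (leq0n i).
  by rewrite c00 normr0 normr_le0 => /eqP ->; rewrite expr0n.
have nu0 : nu = 0 by exact: (cvg_unique _ (cV n) h).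
by move: hnu; rewrite nu0 ltxx.
Qed.

(** The assumption covers every version of [Gamma_1]; it is applied to the explicit version
    [2 * total_energy], for which the variance is [8 * Q n]. *)
Lemma coef_limits :
  (forall Gam : nat -> {RV P >-> R},
     (forall n, gamma_operator ip X 1 (F n) (Gam n)) ->
     ('V_P[fun w => (Gam n w - 2 * F n w)%R])%E @[n --> \oo] --> 0%E) ->
  exists k : nat, nu = k%:R /\ forall e, 0 < e -> exists n0 : nat, forall n, (n0 <= n)%N ->
    forall i, (i < k)%N -> `|1 - c n i| <= e.
Proof.
move=> hVar; pose Q n := limn (fun m => \sum_(i < m) (c n i ^+ 2 - c n i) ^+ 2).
have cQ n : \sum_(i < m) (c n i ^+ 2 - c n i) ^+ 2 @[m --> \oo] --> Q n.
  exact: (sum_sqr_shift_cvg (cV n)).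
apply: (sorted_coef_integer hsorted cV cQ).
have [Gam hGam] : exists Gam : nat -> {RV P >-> R}, forall n w,
    Gam n w = 2 * total_energy (fun i => X (e n i) : Om -> R) (c n) w.
  have h n : exists G : {RV P >-> R}, forall w, G w = 2 * total_energy (fun i => X (e n i) : Om -> R) (c n) w.
    apply: RV_of_measurable; apply: measurable_funM; first exact: measurable_cst.
    exact: (measurable_total_energy (second_chaos_family hX (hF n))).
  have [g hg] := choice h; by exists g.
have := hVar Gam (fun n => chaos_gamma hip hX (hF n) (cV n) (c0 n) (hGam n)).
under eq_fun do rewrite (chaos_gamma_variance hX (hF _) (cV _) (hGam _) (cQ _)).
move/fine_cvg => /= h.
have h2 : 8^-1 * (8 * Q n) @[n --> \oo] --> (8^-1 * 0 : R) by exact: cvgMr.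
rewrite mulr0 in h2; move: h2; apply: cvg_trans; apply: near_eq_cvg; apply: nearW => n.
by rewrite mulrA mulVf// mul1r.
Qed.

Variables (d' : measure_display) (Om' : measurableType d') (P' : probability Om' R)
  (G : {RV P' >-> R}) (k : nat).
Hypothesis hG : forall A : set R, measurable A -> P' (G @^-1` A) = centered_gamma_law nu A.
Hypothesis nuE : nu = k%:R.
Hypothesis near1 : forall e, 0 < e -> exists n0 : nat, forall n, (n0 <= n)%N ->
    forall i, (i < k)%N -> `|1 - c n i| <= e.

Let k0 : (0 < k)%N. Proof. by move: hnu; rewrite nuE ltr0n. Qed.

Let cVk n : \sum_(i < m) c n i ^+ 2 @[m --> \oo] --> (k%:R : R).
Proof. by rewrite -nuE. Qed.

Let N n i : Om -> R := X (e n i).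
Let hN n : gaussian_family P (N n) (nonzero (c n)) := second_chaos_family hX (hF n).
Let sc n : supported (nonzero (c n)) (c n) := @supported_nonzero R (c n).
(** A candidate copy of [G] on the space of [F n], built from the same Gaussian variables: in this
    coupling, comparing [F n] with [G] amounts to comparing coefficients. *)
Let Gn n : Om -> R := psum (N n) (@head_ind R k) k.
(** Orthonormality of the [e n i] is known where [c n i] is nonzero, so this condition is what gives
    [Gn n] the law of [G]. *)
Let head n := forall i, (i < k)%N -> nonzero (c n) i.
Let mF n : measurable_fun setT (F n : Om -> R) := measurable_funPT (F n).
Let mG : measurable_fun setT (G : Om' -> R) := measurable_funPT G.
Let mGn n : measurable_fun setT (Gn n) := measurable_psum (hN n) (@head_ind R k) k.

Let law_head n : head n -> forall B, measurable B ->
  fine (P' (G @^-1` B)) = fine (P (Gn n @^-1` B)).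
Proof.
move=> hn B mB; have hG' (A : set R) : measurable A -> P' (G @^-1` A) = centered_gamma_law k%:R A.
  by move=> /hG ->; rewrite nuE.
exact: (centered_gamma_head hG' (hN n) hn mB).
Qed.

Let head_near : exists n0, forall n, (n0 <= n)%N -> head n.
Proof.
have [n0 h] := near1 (ltac:(by rewrite invr_gt0) : 0 < 2^-1 :> R).
exists n0 => n nn i ik; apply/eqP => ci; have := h n nn i ik.
by rewrite ci subr0 normr1; lra.
Qed.

Let Ex_G n (f : R -> R) : head n -> measurable_fun setT f -> intgr P (fun w => f (Gn n w)) ->
  intgr P' (fun w => f (G w)) /\ Ex P' (fun w => f (G w)) = Ex P (fun w => f (Gn n w)).
Proof.
move=> hn mf i; have [i' <-] := law_Ex (mGn n) mG (fun B mB => esym (law_head hn mB)) mf i.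
by [].
Qed.

Let head_sum p : (0 < p)%N -> \sum_(i < k) @head_ind R k i ^+ p = k%:R.
Proof.
move=> p0; rewrite (eq_bigr (fun=> 1)) ?sumr_const ?card_ord// => i _.
by rewrite /head_ind ltn_ord expr1n.
Qed.

(** Read off at a single large index, where the copy [Gn] of [G] is available. *)
Let G_moments : [/\ forall p, (p <= 4)%N -> intgr P' (fun w => G w ^+ p), Ex P' (fun w => G w) = 0,
  Ex P' (fun w => G w ^+ 2) = 2 * k%:R, Ex P' (fun w => G w ^+ 3) = 8 * k%:R &
  Ex P' (fun w => G w ^+ 4) = 48 * k%:R + 12 * k%:R ^+ 2].
Proof.
have [n0 /(_ n0 (leqnn n0)) hn] := head_near.
have mX p : measurable_fun setT (fun x : R => x ^+ p) by apply: measurable_funX; exact: measurable_id.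
have [i e1 e2 e3 e4] := psum_moments (hN n0) k (supported_head_ind R hn).
rewrite !head_sum// in e2 e3 e4.
have h p p4 := Ex_G hn (mX p) (i p p4).
split.
- by move=> p p4; exact: (h p p4).1.
- by have := (h 1%N isT).2; rewrite (_ : Ex P _ = 0).
- by rewrite (h 2%N isT).2.
- by rewrite (h 3%N isT).2.
- by rewrite (h 4%N isT).2.
Qed.

Let F_moments n := chaos_moments (hN n) (@sc n) (mF n) (cVk n) (hF n).2.

Let theta n : R := k%:R - \sum_(i < k) c n i ^+ 2.

Let theta_ge0 n : 0 <= theta n.
Proof. by rewrite subr_ge0; exact: (sum_sqr_le (cVk n)). Qed.

Let om n := omega_rate k (c n).

Let om_small e0 : 0 < e0 -> exists n0, forall n, (n0 <= n)%N -> om n <= e0.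
Proof.
move=> e00; have [n0 h] := near1 e00; exists n0 => n nn.
by apply: omega_rate_le; [exact: ltW|exact: h].
Qed.

Let theta_small e0 : 0 < e0 -> exists n0, forall n, (n0 <= n)%N -> theta n <= e0.
Proof.
move=> e00; pose r := Num.min 1 (e0 / (3 * k%:R)).
have k0R : 0 < k%:R :> R by rewrite ltr0n.
have r0 : 0 < r by rewrite lt_min ltr01 divr_gt0// mulr_gt0.
have r1 : r <= 1 by rewrite ge_min lexx.
have re : r * (3 * k%:R) <= e0 by rewrite -ler_pdivlMr ?mulr_gt0// ge_min lexx orbT.
have [n0 h] := near1 r0; exists n0 => n nn; apply: le_trans re.
rewrite /theta -[k in X in X - _](card_ord k) -sumr_const -sumrB.
rewrite (_ : r * (3 * k%:R) = (3 * r) *+ k); last by rewrite -mulr_natr; ring.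
rewrite -[k in _ *+ k]card_ord -sumr_const; apply: ler_sum => i _.
have := h n nn i (ltn_ord i); rewrite ler_norml => /andP[h1 h2].
have := sqr_ge0 (1 - c n i); lra.
Qed.

(** In the coupling [F n - Gn n] has coefficients [c_i - 1] on the head and [c_i] on the tail, so
    its second moment is at most [2 (k om^2 + theta)]; [bounded_continuous_le] then applies. *)
Lemma chaos_cvg_in_law : cvg_in_law P P' F G.
Proof.
move=> f cf [B fB]; have mf : measurable_fun setT f by exact: continuous_measurable_fun.
have iF n : intgr P (fun w => f (F n w)).
  by apply: (@intgr_bounded _ _ _ P B) => //; exact: measurableT_comp.
have iGn n : intgr P (fun w => f (Gn n w)).
  by apply: (@intgr_bounded _ _ _ P B) => //; exact: measurableT_comp.
have iG : intgr P' (fun w => f (G w)).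
  by apply: (@intgr_bounded _ _ _ P' B) => //; exact: measurableT_comp.
rewrite (_ : (fun n => _) = (fun n => (Ex P (fun w => f (F n w)))%:E)); last first.
  by apply/funext => n; rewrite unlock /= EFin_Ex.
rewrite (_ : 'E_P'[_]%E = (Ex P' (fun w => f (G w)))%:E); last by rewrite unlock /= EFin_Ex.
apply: cvg_EFin; first exact: nearW.
(* After the shift the copy [Gn] of [G] is available at every index. *)
have [n0 hn0] := head_near; rewrite -(cvg_shiftn n0).
pose dl n := 2 * (k%:R * (om n * om n) + theta n).
have d0 : dl (n + n0)%N @[n --> \oo] --> 0.
  rewrite (cvg_shiftn n0).
  have cm : om n @[n --> \oo] --> 0.
    apply/cvgrPdist_le => e1 e10; have [n1 h] := om_small e10.
    by exists n1 => // n /h; rewrite /= sub0r normrN ger0_norm// omega_rate_ge0.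
  have ct : theta n @[n --> \oo] --> 0.
    apply/cvgrPdist_le => e1 e10; have [n1 h] := theta_small e10.
    by exists n1 => // n /h; rewrite /= sub0r normrN ger0_norm.
  have h : dl n @[n --> \oo] --> (2 * (k%:R * (0 * 0) + 0) : R).
    by apply: cvgMr; apply: cvgD => //; apply: cvgMr; exact: cvgM.
  by rewrite !(mulr0, addr0) in h.
apply: (cvg_of_eps_bound (K := 1 + 2 * k%:R)) d0 => ep /andP[ep0 _].
have [C C0 hC] := bounded_continuous_le cf fB ep0; exists C => n'.
set n := (n' + n0)%N; have hn : head n by apply: hn0; rewrite leq_addl.
rewrite (Ex_G hn mf (iGn n)).2 -ExB//.
have [ig _ eg2 _ _] := psum_moments (hN n) k (supported_head_ind R hn).
rewrite head_sum// in eg2.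
pose b i := c n i - @head_ind R k i.
have sb : supported (nonzero (c n)) b.
  by move=> i si; rewrite /b (sc si) (supported_head_ind R hn si) subrr.
have [iF2 _ _ _ _] := F_moments n.
have psum_b m w : (k <= m)%N -> psum (N n) b m w = psum (N n) (c n) m w - Gn n w.
  move=> km; rewrite /Gn -(subnKC km); elim: (m - k)%N => [|j IH].
    by rewrite addn0 /psum -sumrB; apply: eq_bigr => i _; rewrite /b mulrBl.
  rewrite addnS !psumS IH /b /head_ind ltnNge leq_addr/= subr0; ring.
have i2 : intgr P (fun w => (F n w - Gn n w) ^+ 2).
  by apply: intgr_sqrB => //; [exact: (iF2 2%N)|exact: (ig 2%N)].
have E2 : Ex P (fun w => (F n w - Gn n w) ^+ 2) <= dl n.
  have hL := chaos_L2lim (hN n) (@sc n) (mF n) (hF n).2; have [a1 a2 a3 a4 a5] := hL.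
  have hL' : L2lim P (fun m w => psum (N n) (c n) m w - Gn n w) (fun w => F n w - Gn n w).
    split=> //.
    - by move=> m; exact: measurable_funB.
    - exact: measurable_funB.
    - by move=> m; apply: intgr_sqrB => //; exact: (ig 2%N).
    - apply: cvg_trans a5; apply: near_eq_cvg; apply: nearW => m; apply: eq_Ex => w.
      by congr (_ ^+ 2); ring.
  have h := L2lim_sqr hL'.
  rewrite -(cvg_lim _ h)//; apply: limr_le; first by apply/cvg_ex; eexists; exact: h.
  exists k => // m /= km.
  rewrite (@eq_Ex _ _ _ P _ (fun w => psum (N n) b m w ^+ 2)); last by move=> w; rewrite psum_b.
  have [_ _ -> _ _] := psum_moments (hN n) m sb; apply: ler_wpM2l => //.
  have -> : \sum_(i < m) b i ^+ 2 = \sum_(i < k) (1 - c n i) ^+ 2 +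
      (\sum_(i < m) c n i ^+ 2 - \sum_(i < k) c n i ^+ 2).
    rewrite -(subnKC km); elim: (m - k)%N => [|j IH].
      rewrite addn0 subrr addr0; apply: eq_bigr => i _; rewrite /b /head_ind ltn_ord /=; ring.
    by rewrite addnS !big_ord_recr/= IH /b /head_ind ltnNge leq_addr/= subr0; ring.
  apply: lerD; last by rewrite lerD2r; exact: (sum_sqr_le (cVk n)).
  rewrite mulr_natl -[k in _ *+ k]card_ord -sumr_const; apply: ler_sum => i _.
  rewrite -(real_normK (num_real (1 - c n i))) -expr2 lerXn2r ?nnegrE ?omega_rate_ge0//.
  exact: omega_rate_ge.
apply: (@le_trans _ _ (Ex P (fun w => ep * (1 + Gn n w ^+ 2) + C * (F n w - Gn n w) ^+ 2))).
  apply: le_norm_Ex_le => //; first exact: intgrB.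
  apply: intgrD; apply: intgrZ => //.
  by apply: intgrD; [exact: intgr_cst|exact: (ig 2%N)].
have i1 : intgr P (fun w => 1 + Gn n w ^+ 2) by apply: intgrD; [exact: intgr_cst|exact: (ig 2%N)].
rewrite ExD ?ExZ//; [|exact: intgrZ|exact: intgrZ].
rewrite ExD ?Ex_cst ?eg2; [|exact: intgr_cst|exact: (ig 2%N)].
by rewrite lerD2l; exact: ler_wpM2l.
Qed.

Let D n : R := fine (dist2 P P' (F n) G).
Let M n : R := cumulant_gap P P' (F n) G.
Let m3 n : R := Ex P (fun w => F n w ^+ 3).
Let m4 n : R := Ex P (fun w => F n w ^+ 4).

Let ME n : M n = Num.max `|m3 n - 8 * k%:R| `|m4 n - (48 * k%:R + 12 * k%:R ^+ 2)|.
Proof.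
have [_ g1 g2 g3 g4] := G_moments; have [_ f1 f2 _ _] := F_moments n.
rewrite /M /cumulant_gap !cumulant3E// !cumulant4E// f2 g2 g3 g4.
by congr (Num.max _ `|_|); rewrite -/(m4 n); ring.
Qed.

Let iF2 n : intgr P (fun w => F n w ^+ 2). Proof. by have [h _ _ _ _] := F_moments n; exact: h. Qed.
Let iG2 : intgr P' (fun w => G w ^+ 2). Proof. by have [h _ _ _ _] := G_moments; exact: h. Qed.

Let DE n : dist2 P P' (F n) G = (D n)%:E.
Proof. by rewrite /D; have [r _ ->] := dist2_fin (mF n) mG (iF2 n) iG2. Qed.

Let D_ge0 n : 0 <= D n.
Proof. by rewrite /D; have [r r0 ->] := dist2_fin (mF n) mG (iF2 n) iG2. Qed.

Let D_le n : head n -> D n <= 2 * theta n + 2 * k%:R * om n.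
Proof.
move=> hn; rewrite -lee_fin -DE; apply: (dist2_le (mF n) mG (iF2 n) iG2) => h hh.
have mh : measurable_fun setT h.
  by apply: continuous_measurable_fun; exact: (continuous_is_derive (fun x => class_H2_is_derive x hh)).
have [ig _ _ _ _] := psum_moments (hN n) k (supported_head_ind R hn).
have iGn : intgr P (fun w => h (Gn n w)).
  by apply: lipschitz_intgr => //; [exact: class_H2_lipschitz|exact: (ig 2%N)].
rewrite (Ex_G hn mh iGn).2.
exact: (Ex_class_H2_dist (hN n) (@sc n) hn (mF n) (cVk n) (hF n).2
  (fun i => @omega_rate_ge R (c n) k i) (omega_rate_ge0 _ _) hh).2.
Qed.

Let M_ge0 n : 0 <= M n. Proof. by rewrite ME le_max normr_ge0. Qed.

(* Equality of the third and fourth cumulants forces all the coefficients to be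
   [0] or [1]. *)
Let M0 n : M n = 0 -> D n = 0.
Proof.
rewrite ME => hm.
have e3 : m3 n = 8 * k%:R.
  apply/eqP; rewrite -subr_eq0 -normr_eq0 eq_le normr_ge0 andbT -hm le_max lexx//.
have e4 : m4 n = 48 * k%:R + 12 * k%:R ^+ 2.
  apply/eqP; rewrite -subr_eq0 -normr_eq0 eq_le normr_ge0 andbT -[leRHS]hm le_max lexx orbT//.
have [_ _ _ l3 l4] := F_moments n; rewrite -/(m3 n) e3 in l3; rewrite -/(m4 n) e4 in l4.
(* [sum c^4 - 2 sum c^3 + sum c^2] tends to [k - 2 k + k = 0]: the two cumulants and the variance
   fix the three limits. *)
have cQ : \sum_(i < m) (c n i ^+ 2 - c n i) ^+ 2 @[m --> \oo] --> (0 : R).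
  have h : 48^-1 * (48 * \sum_(i < m) c n i ^+ 4 + 12 * (\sum_(i < m) c n i ^+ 2) ^+ 2 -
      12 * (\sum_(i < m) c n i ^+ 2) ^+ 2) - 4^-1 * (8 * \sum_(i < m) c n i ^+ 3) +
      \sum_(i < m) c n i ^+ 2 @[m --> \oo] -->
      (48^-1 * (48 * k%:R + 12 * k%:R ^+ 2 - 12 * (k%:R * k%:R)) - 4^-1 * (8 * k%:R) + k%:R : R).
    apply: cvgD; last exact: cVk.
    apply: cvgB; last exact: cvgMr.
    apply: cvgMr; apply: cvgB => //; apply: cvgMr.
    by under eq_fun do rewrite expr2; exact: cvgM.
  move: h; rewrite [X in _ --> X -> _](_ : _ = 0); last by field.
  apply: cvg_trans; apply: near_eq_cvg; apply: nearW => m.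
  have -> : \sum_(i < m) (c n i ^+ 2 - c n i) ^+ 2 =
      \sum_(i < m) c n i ^+ 4 - 2 * \sum_(i < m) c n i ^+ 3 + \sum_(i < m) c n i ^+ 2.
    by rewrite mulr_sumr -sumrB -big_split/=; apply: eq_bigr => i _; ring.
  by field.
(* With [r = 0] the rounding is exact. *)
have [|k' [h1 h2]] := sorted_coef_rounding (hsorted n) (cVk n) cQ (sqr_ge0 0).
  by rewrite lexx ler01.
rewrite mulr0 normr_le0 subr_eq0 eqr_nat in h1; rewrite -(eqP h1) mulr0 in h2.
have c1 i : (i < k)%N -> c n i = 1.
  by move=> /h2; rewrite normr_le0 subr_eq0 => /eqP.
have hn : head n by move=> i ik; rewrite /nonzero c1// oner_eq0.
have th0 : theta n = 0.
  rewrite /theta (eq_bigr (fun=> 1)) ?sumr_const ?card_ord ?subrr// => i _.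
  by rewrite c1// expr1n.
have om_0 : om n <= 0 by apply: omega_rate_le => // i ik; rewrite c1// subrr normr0.
apply/eqP; rewrite eq_le D_ge0 andbT; apply: le_trans (D_le hn) _.
by rewrite th0 mulr0 add0r mulr_ge0_le0// mulr_ge0.
Qed.

Let M_pos n : 0 < M n -> 0 < D n.
Proof.
move=> Mp; rewrite lt_def D_ge0 andbT; apply/eqP => Dn0.
have d0 : dist2 P P' (F n) G = 0%E by rewrite DE Dn0.
have [iG g1 g2 g3 g4] := G_moments; have [iF f1 f2 _ _] := F_moments n.
have e2 : Ex P (fun w => F n w ^+ 2) = Ex P' (fun w => G w ^+ 2) by rewrite f2 g2.
have h3 := dist2_eq0_third (mF n) mG (iF2 n) iG2 (iF 3%N isT) (iG 3%N isT) (iF 4%N isT) (iG 4%N isT) f1 g1 d0.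
have h4 := dist2_eq0_fourth (mF n) mG (iF2 n) iG2 (iF 4%N isT) (iG 4%N isT) e2 d0.
by move: Mp; rewrite ME /m3 /m4 h3 h4 g3 g4 !subrr normr0 maxxx ltxx.
Qed.

Lemma chaos_dist2_bounds (C : R) :
  approx_const C (fun n => theta_rate k (c n)) (fun n => omega_rate k (c n)) ->
  exists C1 C2 : R, [/\ 0 < C1, C1 < C2 & forall n : nat,
    ((C1 * cumulant_gap P P' (F n) G)%:E <= dist2 P P' (F n) G)%E /\
    (dist2 P P' (F n) G <= (C2 * cumulant_gap P P' (F n) G)%:E)%E].
Proof.
move=> hC; have C0 : 0 < C by case: hC.
have [n1 omth] := approx_const_le (fun n => omega_rate_ge0 (c n) k) hC.
have {}omth n : (n1 <= n)%N -> om n <= 2 / C * theta n.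
  by move=> /omth; rewrite (theta_rateE k (cVk n)).
have k0R : 0 < k%:R :> R by rewrite ltr0n.
have [n2 hd] := head_near.
have [n3 om1] := om_small (ltr01 : 0 < 1 :> R).
(* Together with [om <= (2 / C) theta] this threshold gives [20 k om^2 <= 2 theta]. *)
have C20 : 0 < C / (20 * k%:R) by rewrite divr_gt0// mulr_gt0.
have [n4 omC] := om_small C20.
(* Allows [eta = 1/2], so the tail error is [4 theta]; with the [2 theta] of the head it totals
   [6 theta], half of the main term [12 theta]. *)
have [n5 th4] := theta_small (ltac:(by rewrite exprn_gt0// invr_gt0) : 0 < 2^-1 ^+ 2 :> R).
pose n0 := maxn n1 (maxn n2 (maxn n3 (maxn n4 n5))).
have [q qE] : exists q, q = 2 / C by exists (2 / C).
have q0 : 0 < q by rewrite qE divr_gt0.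
rewrite -qE in omth.
have [a aE] : exists a : R, a = 720 * k%:R by eexists.
have [b bE] : exists b : R, b = 48 * k%:R by eexists.
have a0 : 0 <= a by rewrite aE; exact: mulr_ge0 (ler0n R 720) (ler0n R k).
have b0 : 0 <= b by rewrite bE; exact: mulr_ge0 (ler0n R 48) (ler0n R k).
have third n : (n0 <= n)%N -> `|m3 n - 8 * k%:R + 12 * theta n| <= 6 * theta n.
  rewrite !geq_max => /and5P[l1 l2 l3 l4 l5]; have [_ _ _ l _] := F_moments n.
  apply: le_trans (third_moment_gap (cVk n) (fun i => @omega_rate_ge R (c n) k i)
    (omega_rate_ge0 _ _) l (_ : 0 <= 2^-1) (th4 n l5) (om1 n l3)) _; first by rewrite invr_ge0.
  rewrite -/(om n).
  have : 20 * k%:R * om n ^+ 2 <= 2 * theta n.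
    apply: (@le_trans _ _ (20 * k%:R * (C / (20 * k%:R) * (q * theta n)))).
      apply: ler_wpM2l; first by rewrite mulr_ge0.
      by rewrite expr2; apply: ler_pM; rewrite ?omega_rate_ge0//; [exact: omC|exact: omth].
    by rewrite le_eqVlt; apply/orP; left; apply/eqP; rewrite qE; field; rewrite !gt_eqF.
  by move: (theta_ge0 n); rewrite -/(theta n); lra.
(* [18 = 12 + 6] bounds the third cumulant gap; [a * q + b] bounds the fourth. *)
have [K KE] : exists K, K = 18 + a * q + b by eexists.
have aq0 : 0 <= a * q by rewrite mulr_ge0// ltW.
have K0 : 0 < K by rewrite KE; lra.
have M_le n : (n0 <= n)%N -> M n <= K * theta n.
  move=> nn; have h3 := third n nn; move: nn.
  rewrite !geq_max => /and5P[l1 l2 l3 l4 l5]; have [_ _ _ _ l] := F_moments n.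
  have h4 := fourth_moment_gap (cVk n) (fun i => @omega_rate_ge R (c n) k i)
    l (om1 n l3).
  have {}h4 : `|m4 n - (48 * k%:R + 12 * k%:R ^+ 2)| <= a * om n + b * theta n.
    by rewrite aE bE.
  have th0 := theta_ge0 n.
  have h5 := ler_wpM2l a0 (omth n l1); rewrite mulrA in h5.
  have p1 := mulr_ge0 aq0 th0; have p2 := mulr_ge0 b0 th0.
  rewrite ME ge_max KE (_ : _ * theta n = 18 * theta n + a * q * theta n + b * theta n); last by ring.
  apply/andP; split; last first.
    by apply: le_trans h4 _; apply: lerD => //; apply: le_trans h5 _; rewrite lerDr mulr_ge0.
  have h6 : `|m3 n - 8 * k%:R| <= 18 * theta n.
    have := ler_normB (m3 n - 8 * k%:R + 12 * theta n) (12 * theta n).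
    by rewrite addrK (ger0_norm (_ : 0 <= 12 * theta n)) ?mulr_ge0//; lra.
  by apply: le_trans h6 _; rewrite -addrA lerDl addr_ge0.
have g3_ge n : (n0 <= n)%N -> 6 * theta n <= `|m3 n - 8 * k%:R|.
  move=> nn; have := third n nn; have := ler_normB (m3 n - 8 * k%:R + 12 * theta n) (m3 n - 8 * k%:R).
  rewrite addrAC subrr add0r (ger0_norm (_ : 0 <= 12 * theta n)) ?mulr_ge0//; lra.
pose Ks := sin_const R k; have Ks0 : 0 <= Ks by exact: sin_const_ge0.
(* The cubic term contributes at least [t^3 theta]; this [t] keeps the remainder
   [t^4 Ks (1 + q) theta] below half of it for all large [n] at once. *)
have [t tE] : exists t, t = Num.min 1 (2 * (Ks * (1 + q) + 1))^-1 by eexists.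
have d20 : 0 < 2 * (Ks * (1 + q) + 1) by rewrite mulr_gt0// ltr_wpDl// mulr_ge0// addr_ge0// ltW.
have t0 : 0 < t by rewrite tE lt_min ltr01 invr_gt0.
have t01 : 0 <= t <= 1 by rewrite (ltW t0) tE ge_min lexx.
have tK : t * (Ks * (1 + q)) <= 2^-1.
  have h : t * (2 * (Ks * (1 + q) + 1)) <= 1.
    by rewrite -ler_pdivlMr// div1r tE ge_min lexx orbT.
  lra.
have t3 : 0 < t ^+ 3 by rewrite exprn_gt0.
have D_ge n : (n0 <= n)%N -> t ^+ 3 / 2 * theta n <= D n.
  move=> nn; have h3 := g3_ge n nn; move: nn.
  rewrite !geq_max => /and5P[l1 l2 l3 l4 l5]; have hn := hd n l2.
  rewrite -lee_fin -DE.
  apply: le_trans (dist2_ge (mF n) mG (iF2 n) iG2 (class_H2_sin t01)); rewrite lee_fin.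
  have [ig _ _ _ _] := psum_moments (hN n) k (supported_head_ind R hn).
  have msin : measurable_fun setT (fun x : R => sin (t * x)).
    by apply: continuous_measurable_fun; solve_continuous.
  have isin : intgr P (fun w => sin (t * Gn n w)).
    exact: (@lipschitz_intgr _ _ _ P (fun x => sin (t * x)) (Gn n) msin
      (class_H2_lipschitz (class_H2_sin t01)) (mGn n) (ig 2%N isT)).
  rewrite (Ex_G hn msin isin).2.
  have := Ex_sin_gap (hN n) (@sc n) hn (mF n) (cVk n) (hF n).2
    (fun i => @omega_rate_ge R (c n) k i) (omega_rate_ge0 _ _) (ltW t0).
  rewrite -/(m3 n) -/(theta n) -/(om n) -/Ks -/(Gn n).
  move: (_ - Ex P (fun w => sin (t * Gn n w))) => x hx.
  have th0 := theta_ge0 n.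
  have h4 : t ^+ 4 * (Ks * (theta n + om n)) <= t ^+ 3 / 2 * theta n.
    apply: (@le_trans _ _ (t ^+ 3 * theta n * (t * (Ks * (1 + q))))).
      rewrite (_ : t ^+ 3 * theta n * _ = t ^+ 4 * (Ks * (theta n + q * theta n))); last by ring.
      apply: ler_wpM2l; first by rewrite exprn_ge0// ltW.
      by apply: ler_wpM2l => //; rewrite lerD2l; exact: omth.
    have := ler_wpM2l (mulr_ge0 (ltW t3) th0) tK; lra.
  have h5 : t ^+ 3 * theta n <= `|t ^+ 3 / 6 * (m3 n - 8 * k%:R)|.
    rewrite normrM (ger0_norm (_ : 0 <= t ^+ 3 / 6)); last by rewrite divr_ge0// ltW.
    have := ler_wpM2l (ltW t3) h3; lra.
  have := ler_normB (x + t ^+ 3 / 6 * (m3 n - 8 * k%:R)) x.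
  by rewrite addrAC subrr add0r; lra.
(* Everything is measured in [theta]: [6 theta <= M <= K theta] and
   [t^3 theta / 2 <= D <= (2 + 2 k q) theta]. *)
pose c1 := t ^+ 3 / 2 / K; pose c2 := (2 + 2 * k%:R * q) / 6.
have c10 : 0 < c1 by rewrite !divr_gt0.
have c20 : 0 < c2 by rewrite divr_gt0// addr_gt0// !mulr_gt0.
have [|C1 [C2 [h1 h2 h3]]] := uniform_constants (n0 := n0) c10 c20 M_ge0 M0 M_pos.
  move=> n nn; apply/andP; split.
    apply: le_trans (D_ge n nn); rewrite /c1 mulrAC -mulrA.
    apply: ler_wpM2l; first by rewrite divr_ge0// ltW.
    by rewrite ler_pdivrMr// mulrC; exact: M_le.
  have h3 := g3_ge n nn; move: nn; rewrite !geq_max => /and5P[l1 l2 l3 l4 l5].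
  have hM : 6 * theta n <= M n by rewrite ME le_max h3.
  apply: le_trans (D_le (hd n l2)) _.
  rewrite (_ : c2 * M n = (2 + 2 * k%:R * q) * (M n / 6)); last by rewrite /c2; ring.
  have h6 : theta n <= M n / 6 by lra.
  apply: (@le_trans _ _ ((2 + 2 * k%:R * q) * theta n)).
    rewrite (_ : 2 * theta n + _ = 2 * (theta n + k%:R * om n)); last by ring.
    rewrite (_ : _ * theta n = 2 * (theta n + k%:R * (q * theta n))); last by ring.
    by apply: ler_wpM2l => //; rewrite lerD2l; apply: ler_wpM2l => //; exact: omth.
  by apply: ler_wpM2l => //; rewrite addr_ge0// !mulr_ge0// ltW.
exists C1, C2; split=> // n; rewrite DE !lee_fin; apply/andP; exact: h3.
Qed.

End Main.

Theorem theorem4p17 (R : realType)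
  (d : measure_display) (Om : measurableType d) (P : probability Om R)
  (H : completeNormedModType R) (ip : H -> H -> R)
  (hip : inner_product ip) (hsep : separable H)
  (X : H -> {RV P >-> R}) (hX : isonormal ip X)
  (nu : R) (hnu : 0 < nu)
  (d' : measure_display) (Om' : measurableType d') (P' : probability Om' R)
  (G : {RV P' >-> R})
  (hG : forall A : set R, measurable A ->
     P' (G @^-1` A) = centered_gamma_law nu A)
  (F : nat -> {RV P >-> R}) (e : nat -> nat -> H) (c : nat -> nat -> R)
  (hF : forall n, second_chaos_series ip X (e n) (c n) (F n))
  (hsorted : forall n, sorted_coef (c n))
  (hE : forall n,
     ('E_P[fun w => (F n w ^+ 2)%R] = 2%:E * \sum_(0 <= i <oo) (c n i ^+ 2)%:E)%E
     /\ (2%:E * \sum_(0 <= i <oo) (c n i ^+ 2)%:E = (2 * nu)%:E)%E)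
  (hVar : forall Gam : nat -> {RV P >-> R},
     (forall n, gamma_operator ip X 1 (F n) (Gam n)) ->
     ('V_P[fun w => (Gam n w - 2 * F n w)%R])%E @[n --> \oo] --> 0%E) :
  cvg_in_law P P' F G /\
  exists k : nat, nu = k%:R /\
    forall C : R,
      approx_const C (fun n => theta_rate k (c n)) (fun n => omega_rate k (c n)) ->
      exists C1 C2 : R, [/\ 0 < C1, C1 < C2 &
        forall n : nat,
          ((C1 * cumulant_gap P P' (F n) G)%:E <= dist2 P P' (F n) G)%E /\
          (dist2 P P' (F n) G <= (C2 * cumulant_gap P P' (F n) G)%:E)%E].
Proof.
have cV n := nneseries_sqr_cvg (hE n).2.
have [k [nuE near1]] := coef_limits hip hX hnu hF hsorted cV hVar.
split; first exact: (chaos_cvg_in_law hX hnu hF cV hG nuE near1).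
exists k; split=> // C hC.
exact: (chaos_dist2_bounds hX hnu hF hsorted cV hG nuE near1 hC).
Qed.
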